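(* Let $\mathcal{C}$ be a vertex-minor ideal. Then $\mathcal{C}$ has bounded depth-$2$ rank-brittleness (that is, there is an integer $k$ with $\mathrm{rb}_2(G)\le k$ for all $G\in\mathcal{C}$) if and only if \[ \{P_1, P_2, P_3, P_4, \ldots \}\not\subseteq \mathcal{C} \quad\text{and}\quad \{T_{2,1}, 2T_{2,2}, 3T_{2,3}, 4T_{2,4}, \ldots \}\not\subseteq \mathcal{C}. \]
   Context: All graphs are finite, simple and undirected. For a graph $G$ and $S\subseteq V(G)$, the cut-rank $\rho_G(S)$ is the rank over the binary field of the $S\times (V(G)\setminus S)$ $0$-$1$ matrix whose $(a,b)$-entry is $1$ iff $a,b$ are adjacent. The $\rho_G$-width of a partition $(X_1,\dots,X_m)$ of $V(G)$ is $\max\{\rho_G(\bigcup_{i\in I}X_i): I\subseteq\{1,\dots,m\}\}$. A decomposition of $G$ is a pair $(T,\sigma)$ of a tree $T$ with at least one internal node and a bijection $\sigma$ from $V(G)$ to the set of leaves of $T$; its radius is the radius of $T$. For an internal node $t$ of $T$, the components of $T-t$ give (via $\sigma$) a partition of $V(G)$, and the width of $t$ is the $\rho_G$-width of this partition; the width of $(T,\sigma)$ is the maximum width of an internal node. A $(k,r)$-decomposition is one of width at most $k$ and radius at most $r$. The depth-$d$ rank-brittleness $\mathrm{rb}_d(G)$ is the minimum $k$ such that $G$ admits a $(k,d)$-decomposition, and $\mathrm{rb}_d(G)=0$ if $|V(G)|<2$. Local complementation at a vertex $v$ replaces the subgraph induced on the neighborhood $N_G(v)$ by its complement, giving $G*v$.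 A graph $H$ is a vertex-minor of $G$ if $H$ is an induced subgraph of a graph obtained from $G$ by a sequence of local complementations. A class $\mathcal{C}$ of graphs is a vertex-minor ideal if for every $G\in\mathcal{C}$, $\mathcal{C}$ contains all graphs isomorphic to vertex-minors of $G$. $P_n$ is the path on $n$ vertices, $T_{2,n}$ is the $1$-subdivision of the star $K_{1,n}$ (each edge subdivided once), and $nH$ denotes the disjoint union of $n$ copies of $H$. *)

(* Defs.v *)
From mathcomp Require Import all_boot all_order all_algebra.
From mathcomp Require Import boolp.

Set Implicit Arguments.
Unset Strict Implicit.
Unset Printing Implicit Defensive.

Record sgraph := SGraph {
  svertex :> finType;
  sedge : rel svertex;
  sedge_sym : symmetric sedge;
  sedge_irrefl : irreflexive sedge }.

Arguments sedge {s} x y : rename.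
Notation "x -- y" := (sedge x y) (at level 30).

Definition isomorphic (G H : sgraph) : Prop :=
  exists2 f : G -> H, bijective f & {mono f : x y / x -- y}.

Definition degree (G : sgraph) (x : G) : nat := #|[set y | x -- y]|.

Section Induced.
Variables (G : sgraph) (S : {set G}).
Definition induced_rel : rel {x | x \in S} := [rel x y | val x -- val y].
Fact induced_sym : symmetric induced_rel.
Proof. by move=> x y; rewrite /induced_rel /= sedge_sym. Qed.
Fact induced_irrefl : irreflexive induced_rel.
Proof. by move=> x; rewrite /induced_rel /= sedge_irrefl. Qed.
Definition induced := SGraph induced_sym induced_irrefl.
End Induced.

(* The vertex [None] is the centre. *)
Section Star.
Variable A : finType.
Definition star_rel : rel (option A) := [rel x y | (x == None) != (y == None)].
Fact star_sym : symmetric star_rel.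
Proof. by move=> x y; rewrite /star_rel /= eq_sym. Qed.
Fact star_irrefl : irreflexive star_rel.
Proof. by move=> x; rewrite /star_rel /= eqxx. Qed.
Definition star := SGraph star_sym star_irrefl.
End Star.

Section LocalComplement.
Variables (G : sgraph) (v : G).
Definition local_complement_rel : rel G :=
  [rel x y | (x -- y) (+) [&& x != y, v -- x & v -- y]].
Fact local_complement_sym : symmetric local_complement_rel.
Proof.
by move=> x y; rewrite /= /local_complement_rel /= sedge_sym eq_sym;
   rewrite [(v -- x) && _]andbC.
Qed.
Fact local_complement_irrefl : irreflexive local_complement_rel.
Proof. by move=> x; rewrite /local_complement_rel /= sedge_irrefl eqxx. Qed.
Definition local_complement :=
  SGraph local_complement_sym local_complement_irrefl.
End LocalComplement.

Inductive locally_equivalent (G : sgraph) : sgraph -> Prop :=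
| locally_equivalent_refl : locally_equivalent G G
| locally_equivalent_step (H : sgraph) (v : H) :
    locally_equivalent G H -> locally_equivalent G (local_complement v).

Inductive vertex_minor (G : sgraph) : sgraph -> Prop :=
| VertexMinor (H : sgraph) (S : {set H}) :
    locally_equivalent G H -> vertex_minor G (induced S).

Definition vertex_minor_ideal (C : sgraph -> Prop) : Prop :=
  forall G H K : sgraph, C G -> vertex_minor G H -> isomorphic H K -> C K.

(* [ucycle] accepts the degenerate cycle [:: x; y] that walks an edge back and
   forth, hence the bound 2. *)
Definition is_tree (T : sgraph) : Prop :=
  [/\ 0 < #|T|,
      forall x y : T, connect sedge x y
    & forall c : seq T, ucycle sedge c -> size c <= 2].

Definition leaf (T : sgraph) (x : T) : bool := degree x == 1.
Definition internal (T : sgraph) (x : T) : bool := 1 < degree x.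

(* Least length of a walk from [x] to [y];
   the value is [#|T|] if there is none. *)
Definition distance (T : sgraph) (x y : T) : nat :=
  find (fun n => [exists p : n.-tuple T, path sedge x p && (last x p == y)])
       (iota 0 #|T|).

Definition eccentricity (T : sgraph) (x : T) : nat := \max_(y : T) distance x y.

(* The default value [#|T|] exceeds every eccentricity when [T] is a tree. *)
Definition radius (T : sgraph) : nat :=
  \big[minn/#|T|]_(x : T) eccentricity x.

Definition components_minus (T : sgraph) (t : T) : {set {set T}} :=
  equivalence_partition
    (connect [rel x y | [&& x -- y, x != t & y != t]]) [set~ t].

Definition cut_matrix (G : sgraph) (S : {set G}) : 'M['F_2]_(#|S|, #|~: S|) :=
  (\matrix_(i, j) (enum_val i -- enum_val j)%:R)%R.

Definition cut_rank (G : sgraph) (S : {set G}) : nat := \rank (cut_matrix S).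

(* A set of blocks [I \subset P] plays the role of the index set in the
   definition of the width of a partition. *)
Definition partition_width (G : sgraph) (P : {set {set G}}) : nat :=
  \max_(I : {set {set G}} | I \subset P) cut_rank (cover I).

Record decomposition (G : sgraph) := Decomposition {
  dtree : sgraph;
  dmap : G -> dtree;
  dtree_is_tree : is_tree dtree;
  dtree_internal : exists t : dtree, internal t;
  dmap_inj : injective dmap;
  dmap_leaves : forall x : dtree, leaf x <-> exists v : G, dmap v = x }.
Arguments dmap {G} d v : rename.

Definition node_partition (G : sgraph) (D : decomposition G) (t : dtree D) :
    {set {set G}} :=
  [set dmap D @^-1: A | A : {set dtree D} in components_minus t].

Definition node_width (G : sgraph) (D : decomposition G) (t : dtree D) : nat :=
  partition_width (node_partition t).

Definition width (G : sgraph) (D : decomposition G) : nat :=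
  \max_(t : dtree D | internal t) node_width t.

Definition has_decomposition (G : sgraph) (k r : nat) : Prop :=
  exists D : decomposition G, width D <= k /\ radius (dtree D) <= r.

Lemma degree_star_centre (A : finType) : degree (None : star A) = #|A|.
Proof.
rewrite /degree -[RHS]cardsT -(card_imset setT (@Some_inj _)).
apply: eq_card => -[a|]; rewrite inE; first by rewrite imset_f.
by rewrite sedge_irrefl; apply/esym/negbTE/imsetP => -[].
Qed.

Lemma degree_star_leaf (A : finType) (a : A) : degree (Some a : star A) = 1.
Proof.
rewrite /degree -(cards1 (None : star A)).
by apply: eq_card => -[b|]; rewrite !inE.
Qed.

Lemma star_is_tree (A : finType) : is_tree (star A).
Proof.
split; first by apply/card_gt0P; exists None.
- have cN (x : star A) : connect sedge (None : star A) x.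
    by case: x => [a|]; rewrite ?connect0 // connect1.
  have Nc (x : star A) : connect sedge x (None : star A).
    by case: x => [a|]; rewrite ?connect0 // connect1.
  by move=> x y; apply: connect_trans (cN y).
- case=> [|x [|y [|z s]]] //.
  case/andP; case: x y z => [x|] [y|] [z|] //=.
  by case: s => [|[w|] s] //=; rewrite ?inE ?eqxx ?orbT ?andbF.
Qed.

Lemma radius_le (T : sgraph) (x : T) : radius T <= eccentricity x.
Proof.
rewrite /radius; have := mem_index_enum x.
elim: (index_enum T) => // y s IHs; rewrite inE big_cons.
case/predU1P => [<-|/IHs]; first exact: geq_minl.
exact: leq_trans (geq_minr _ _).
Qed.

Lemma radius_star (A : finType) : radius (star A) <= 1.
Proof.
apply: leq_trans (radius_le (None : star A)) _.
apply/bigmax_leqP => x _; rewrite /distance card_option.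
case: x => [a|].
  have: 0 < #|A| by apply/card_gt0P; exists a.
  case: #|A| => //= n _; case: ifP => // _; rewrite ifT //.
  by apply/existsP; exists [tuple (Some a : star A)]; rewrite /= eqxx.
by rewrite /= ifT //; apply/existsP; exists [tuple]; rewrite /= eqxx.
Qed.

Lemma has_decomposition_star (G : sgraph) (d : nat) :
  0 < d -> 1 < #|G| -> exists k, has_decomposition G k d.
Proof.
move=> d_gt0 G_gt1.
have int : exists t : star G, internal t.
  by exists None; rewrite /internal degree_star_centre.
have lv (x : star G) : leaf x <-> exists v, Some v = x.
  case: x => [a|]; rewrite /leaf.
    by rewrite degree_star_leaf; split=> // _; exists a.
  by rewrite degree_star_centre gtn_eqF //; split=> // -[].
pose D := Decomposition (star_is_tree G) int (@Some_inj _) lv.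
by exists (width D), D; split=> //; apply: leq_trans (radius_star _) d_gt0.
Qed.

(* The last branch is reached only for [d = 0], see [has_decomposition_star]. *)
Definition rank_brittleness (d : nat) (G : sgraph) : nat :=
  if #|G| < 2 then 0 else
  if pselect (exists k, `[< has_decomposition G k d >]) is left ex
  then ex_minn ex else 0.

Section Path.
Variable n : nat.
Definition path_graph_rel : rel 'I_n :=
  [rel i j : 'I_n | (i.+1 == j) || (j.+1 == i)].
Fact path_graph_sym : symmetric path_graph_rel.
Proof. by move=> i j; rewrite /path_graph_rel /= orbC. Qed.
Fact path_graph_irrefl : irreflexive path_graph_rel.
Proof. by move=> i; rewrite /path_graph_rel /= orbb gtn_eqF. Qed.
Definition path_graph := SGraph path_graph_sym path_graph_irrefl.
End Path.

Definition edges (G : sgraph) : {set {set G}} :=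
  [set A : {set G} | [exists x, exists y, (x -- y) && (A == [set x; y])]].

Section Subdivision.
Variable G : sgraph.
Definition subdivision_vertex : finType :=
  (G + {A : {set G} | A \in edges G})%type.
Definition subdivision_rel : rel subdivision_vertex := fun u w =>
  match u, w with
  | inl x, inr A => x \in val A
  | inr A, inl x => x \in val A
  | _, _ => false
  end.
Fact subdivision_sym : symmetric subdivision_rel.
Proof. by move=> [x|A] [y|B]. Qed.
Fact subdivision_irrefl : irreflexive subdivision_rel.
Proof. by move=> [x|A]. Qed.
Definition subdivision := SGraph subdivision_sym subdivision_irrefl.
End Subdivision.

Definition T2 (n : nat) : sgraph := subdivision (star 'I_n).

Section Copies.
Variables (n : nat) (H : sgraph).
Definition copies_rel : rel ('I_n * H)%type :=
  [rel u w | (u.1 == w.1) && (u.2 -- w.2)].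
Fact copies_sym : symmetric copies_rel.
Proof. by move=> u w; rewrite /copies_rel /= eq_sym sedge_sym. Qed.
Fact copies_irrefl : irreflexive copies_rel.
Proof. by move=> u; rewrite /copies_rel /= sedge_irrefl andbF. Qed.
Definition copies := SGraph copies_sym copies_irrefl.
End Copies.

(* Main.v *)
Require Import Defs.
From mathcomp Require Import all_boot.
From mathcomp Require Import all_algebra boolp zify.

(* Depth-2 rank-brittleness at most [k] amounts to a partition of the vertices
   such that all unions of parts and all subsets of a part have cut-rank at
   most [k].

   Suppose there is such a partition of a path or of n T_{2,n}.  Cut the graph
   into many distant connected chunks, each with a subset of large cut-rank.
   No chunk fits into a part, so each contains an edge between two parts; a
   union of parts separating a quarter of these edges has large cut-rank.

   Conversely, maintain an induced matching [F] together with hubs, vertices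
   outside [F] such that every nonempty sum of hubs (as rows over F_2) meets
   many edges of [F].  When the hubs are maximal, each other vertex [x] agrees,
   up to few edges of [F], with the sum of a set [s x] of hubs.  Adding to each
   [x] the hubs in [s x] is a perturbation of bounded rank, realized on any
   bounded set of vertices by pivoting the hubs away.  If a component of the
   perturbed graph has a large cut-rank, it contains a bounded connected set
   with a large cut-rank, hence a long induced path or a vertex attached to a
   large induced matching, which is one more hub.  Otherwise the components of
   the perturbed graph are the parts sought.  Finally, many hubs yield n T_{2,n}:
   a Ramsey argument makes the adjacency of hubs and matching edges uniform,
   and pivots clear all of it except a block diagonal. *)

Set Implicit Arguments.
Unset Strict Implicit.
Unset Printing Implicit Defensive.

(** * Ramsey-type tools *)


(** Pivoting hubs away gives the perturbed adjacency exactly only between vertices that agree with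
    their sums of hubs on every edge of [F] still in use. Disagreement is bounded for each single
    vertex but not for all vertices together, so the pivots are made for a bounded set only: the
    edges on which its members disagree are deleted from [F], one more edge is spent per pivot, and
    [F] must be rich enough for every sum of hubs to survive these losses. This is why a large
    cut-rank is first confined to a bounded connected set. On the other hand the ends of [F] are
    left out of the perturbation and enter the rank of the error, so [F] is trimmed to a bounded
    size beforehand.

    Depth two enters as follows. At a centre of the tree the blocks are the parts. At a neighbour of
    the centre every leaf of the part below it is a block of its own, so every subset of that part
    is a union of blocks. *)

Section Combinatorics.

Lemma pigeonhole (T U : finType) (f : T -> U) (A : {set T}) (B : {set U}) k :
  {in A, forall x, f x \in B} -> k * #|B| < #|A| ->
  exists2 u, u \in B & k < #|[set x in A | f x == u]|.
Proof.
move=> fB kA; case: (boolP [exists u in B, k < #|[set x in A | f x == u]|]).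
  by case/exists_inP=> u uB ku; exists u.
rewrite negb_exists_in => /forall_inP small; move: kA.
rewrite ltnNge -sum1_card (partition_big f (mem B)) //= => /negP[].
rewrite mulnC -sum_nat_const; apply: leq_sum => u /small; rewrite -leqNgt.
by apply: leq_trans; rewrite -sum1dep_card.
Qed.

Lemma card_bigcup_le (V I : finType) (A : {set I}) (P : I -> {set V}) k :
  {in A, forall i, #|P i| <= k} -> #|\bigcup_(i in A) P i| <= #|A| * k.
Proof.
move=> Pk; rewrite -sum_nat_const.
elim/big_rec2: _ => [|i m X iA IH]; first by rewrite cards0.
by apply: leq_trans (leq_card_setU _ _) _; apply: leq_add => //; apply: Pk.
Qed.

(** Rank is at most the number of distinct rows, so a large rank supplies a large [R]. Unlike rank,
    the notion makes sense for entries of any type; pairs of bits are used later. *)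
Definition sep (A : eqType) (I J : finType) (f : I -> J -> A)
    (R : {set I}) (C : {set J}) :=
  {in R &, forall x x', x != x' -> exists2 y, y \in C & f x y != f x' y}.

Lemma row_rep (A : eqType) (I J : finType) (f : I -> J -> A)
    (R : {set I}) (C : {set J}) : exists rep : I -> I,
  {in R, forall x, rep x \in R /\ {in C, forall y, f (rep x) y = f x y}} /\
  sep f [set rep x | x in R] C.
Proof.
(* The predicate depends on the row of [x] over [C] only, so equal rows get the same
   representative. *)
pose rep x := odflt x [pick r in R | [forall y in C, f r y == f x y]].
have repP : {in R, forall x, rep x \in R /\ {in C, forall y, f (rep x) y = f x y}}.
  move=> x xR; rewrite /rep; case: pickP => [r /andP[rR /forall_inP rC]|/(_ x)] /=.
    by split=> // y /rC/eqP.
  by rewrite xR => /negbT /negP []; apply/forall_inP.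
exists rep; split=> // _ _ /imsetP[x xR ->] /imsetP[x' x'R ->] xx'.
have [_ rx] := repP x xR; have [_ rx'] := repP x' x'R.
case: (boolP [exists y in C, f x y != f x' y]) => [/exists_inP[y yY dy]|].
  by exists y => //; rewrite rx ?rx'.
rewrite negb_exists_in => /forall_inP eqd; case/eqP: xx'; rewrite /rep.
have eqp : [pick r in R | [forall y in C, f r y == f x y]]
         = [pick r in R | [forall y in C, f r y == f x' y]].
  apply: eq_pick => r /=; congr (_ && _); apply: eq_forallb_in => y yY.
  by move/eqd: yY; rewrite negbK => /eqP ->.
rewrite -eqp; case: pickP => // /(_ x); rewrite xR => /negbT/negP[].
by apply/forall_inP.
Qed.

Lemma sepS (A : eqType) (I J : finType) (f : I -> J -> A)
    (R R' : {set I}) (C C' : {set J}) :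
  R' \subset R -> C \subset C' -> sep f R C -> sep f R' C'.
Proof.
move=> /subsetP RR /subsetP CC sp x x' /RR xR /RR x'R /(sp _ _ xR x'R)[y yC].
by exists y; rewrite ?CC.
Qed.

(** If the columns in [P] show fewer than [N] distinct rows, then [N] rows of [R] coincide there and
    are separated by the remaining columns. *)
Lemma sep_split (A : eqType) (I J : finType) (f : I -> J -> A)
    (R : {set I}) (C : {set J}) (P : pred J) N :
  sep f R C -> N * N <= #|R| ->
  exists2 R' : {set I}, R' \subset R /\ N <= #|R'| &
    sep f R' [set y in C | P y] \/ sep f R' [set y in C | ~~ P y].
Proof.
move=> sp; case: N => [|N] NR.
  by exists set0; rewrite ?sub0set //; left=> x x'; rewrite inE.
have [rep [repP rsp]] := row_rep f R [set y in C | P y].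
have [Nr|rN] := leqP N.+1 #|[set rep x | x in R]|.
  exists [set rep x | x in R]; last by left.
  by split=> //; apply/subsetP=> _ /imsetP[x xR ->]; case: (repP x xR).
have [||u _ Nu] := @pigeonhole _ _ rep R [set rep x | x in R] N.
- by move=> x xR; apply: imset_f.
- apply: leq_trans NR; rewrite mulSn addSn ltnS (leq_trans _ (leq_addl _ _)) //.
  by rewrite leq_mul2l (ltnW rN) orbT.
exists [set x in R | rep x == u]; first by split=> //; apply/subsetP=> x; rewrite inE => /andP[].
right=> x x'; rewrite !inE => /andP[xR /eqP xu] /andP[x'R /eqP x'u] xx'.
have [y yC yf] := sp _ _ xR x'R xx'; exists y => //; rewrite inE yC /=.
apply: contra yf => yP; have yCP : y \in [set y in C | P y] by rewrite inE yC.
by rewrite -(repP x xR).2 // -(repP x' x'R).2 // xu x'u.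
Qed.

(** One split per colour, each taking a square root of the number of rows; hence the exponent
    [2 ^ #|K|]. *)
Lemma sep_key (A : eqType) (I J K : finType) (f : I -> J -> A) (key : J -> K) (k0 : K)
    (R : {set I}) (C : {set J}) N :
  sep f R C -> N ^ (2 ^ #|K|) <= #|R| ->
  exists2 R' : {set I}, R' \subset R /\ N <= #|R'| &
    exists k, sep f R' [set y in C | key y == k].
Proof.
move=> sp; rewrite [#|K|]cardE.
have : {in C, forall y, key y \in enum K} by move=> y _; rewrite mem_enum.
elim: (enum K) R C sp => [|k s IH] R C sp Cs NR.
  exists R; first by split; rewrite ?subxx // -[N]expn1.
  exists k0 => x x' xR x'R xx'.
  by have [y /Cs] := sp _ _ xR x'R xx'.
rewrite /= expnS mul2n -addnn expnD in NR.
have [R' [sR NR'] [sp'|sp']] := sep_split (fun y => key y == k) sp NR.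
  exists R'; last by exists k.
  split=> //; apply: leq_trans NR'; case: (N) => // M.
  by rewrite -{1}(expn1 M.+1) leq_pexp2l // expn_gt0.
have [|R2 [sR2 NR2] [k' sp2]] := IH _ _ sp' _ NR'.
- by move=> y; rewrite inE => /andP[/Cs]; rewrite inE => /predU1P[->|//]; rewrite eqxx.
exists R2; first by split=> //; apply: subset_trans sR2 sR.
exists k'; apply: sepS sp2 => //; apply/subsetP=> y; rewrite !inE.
by case/andP=> /andP[-> _].
Qed.

Section Chain.
Variable A : finType.

(* A uniform pattern [(p, al, r, s, t)]: the matrix entries on, below and above
   the diagonal, and the colours of pairs of rows and of pairs of columns. *)
Definition param : finType := (A * A * A * bool * bool)%type.

(** Greedy choice. A column [y] separating two rows differs, in one of them, from the value [al]
    that is popular at [y] among the other rows; that row becomes [x]. Keeping only rows with value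
    [al] at [y], and columns of one colour as seen from [x] and [y], makes the pair uniform towards
    all later ones. *)
Lemma chain_seq q : exists N, forall (I J : finType) (f : I -> J -> A)
    (c : rel I) (d : rel J) (R : {set I}) (C : {set J}),
  sep f R C -> N <= #|R| ->
  exists l : seq (I * J * param),
  [/\ size l = q,
      all (fun z => let: (x, y, (p, al, r, s, t)) := z in
         [&& x \in R, y \in C, f x y == p & p != al]) l
    & pairwise (fun z z' => let: (x, y, (p, al, r, s, t)) := z in
                          let: (x', y', _) := z' in
         [&& f x' y == al, f x y' == r, c x x' == s & d y y' == t]) l].
Proof.
elim: q => [|q [M IH]]; first by exists 0 => I J f c d R C _ _; exists [::].
(* [k2] rows allow for uniform columns, the factor 2 for the colour [c x], the factor [#|A|] for the
   value [al]. The 3 stands for the two rows set aside and the strict inequality in [pigeonhole]. *)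
pose k2 := M ^ (2 ^ #|{: A * bool}|); pose k1 := k2 * 2.
exists (3 + k1 * #|A|) => I J f c d R C sp NR.
have /card_gt1P [x1 [x2 [x1R x2R x12]]] : 1 < #|R| by apply: leq_trans NR.
have [y yC y12] := sp _ _ x1R x2R x12.
pose Q := R :\ x1 :\ x2.
have [||al _] := @pigeonhole _ _ (fun x => f x y) Q setT k1.
- by [].
- rewrite cardsT; move: NR; rewrite /Q (cardsD1 x1 R) x1R (cardsD1 x2 (R :\ x1)).
  by rewrite !inE eq_sym x12 x2R.
set Q1 := [set x in Q | _] => cQ1.
have [x xR xal] : exists2 x, x \in R & f x y != al.
  have [e1|] := eqVneq (f x1 y) al; last by exists x1.
  by exists x2; rewrite // -e1 eq_sym.
have [||s _] := @pigeonhole _ _ (c x) Q1 setT k2.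
- by [].
- by rewrite cardsT card_bool.
set Q2 := [set x' in Q1 | _] => cQ2.
have sQ : Q2 \subset R.
  by apply/subsetP=> z; rewrite !inE => /andP[/andP[/andP[_ /andP[_ ->]]]].
have [R' [sR' MR'] [[r t] sp']] :=
  sep_key (fun y' => (f x y', d y y')) (al, s) (sepS sQ (subxx C) sp) (ltnW cQ2).
have [l [sl lP lok]] := IH I J f c d _ _ sp' MR'.
exists ((x, y, (f x y, al, r, s, t)) :: l); split; first by rewrite /= sl.
  rewrite /= xR yC eqxx xal /=; apply: sub_all lP.
  move=> [[x' y'] [[[[p' al'] r'] s'] t']] /and4P[x'R' + -> ->].
  by rewrite inE => /andP[-> _]; rewrite (subsetP sQ) ?(subsetP sR').
rewrite /= lok andbT; apply: sub_all lP.
move=> [[x' y'] [[[[p' al'] r'] s'] t']] /and4P[/(subsetP sR') + + _ _].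
rewrite !inE => /andP[/andP[_ ->] ->] /andP[_].
by rewrite xpair_eqE => /andP[-> ->].
Qed.

Lemma chain q : 0 < q -> exists N, forall (I J : finType) (f : I -> J -> A)
    (c : rel I) (d : rel J) (R : {set I}) (C : {set J}),
  sep f R C -> N <= #|R| ->
  exists p al r s t, p != al /\ exists (x : nat -> I) (y : nat -> J),
  (forall i, i < q -> [/\ x i \in R, y i \in C & f (x i) (y i) = p]) /\
  (forall i j, i < j -> j < q ->
    [/\ f (x j) (y i) = al, f (x i) (y j) = r, c (x i) (x j) = s
      & d (y i) (y j) = t]).
Proof.
move=> q0; have [N NP] := chain_seq (q * #|{: param}|).+1.
exists N => I J f c d R C sp /(NP _ _ _ c d _ _ sp)[l [sl lP lok]].
have [u cu] : exists u : param, q <= count (fun z => z.2 == u) l.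
  case: (pickP (fun u : param => q <= count (fun z => z.2 == u) l)) => [u cu|none].
    by exists u.
  have : size l <= q * #|{: param}|.
    rewrite -sum1_size (partition_big (fun z => z.2) predT) //=.
    rewrite mulnC -sum_nat_const; apply: leq_sum => u _; rewrite sum1_count.
    by apply: ltnW; rewrite ltnNge none.
  by rewrite sl ltnn.
pose l' := [seq z <- l | z.2 == u].
have sl' : q <= size l' by rewrite size_filter.
have lP' := fun z (zl : z \in l') => allP lP z (mem_subseq (filter_subseq _ l) zl).
have := subseq_pairwise (filter_subseq (fun z => z.2 == u) l) lok.
rewrite -/l' => lok'.
have lu : all (fun z => z.2 == u) l' by apply: filter_all.
case: l' sl' lP' lok' lu => [|z0 l']; first by rewrite leqn0 => /eqP q00; rewrite q00 in q0.
set m := z0 :: l' => sm mP mok mu.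
case: u mu {cu} => [[[[p al] r] s] t] mu.
have mz i : i < q -> (nth z0 m i).2 = (p, al, r, s, t) /\
    [&& (nth z0 m i).1.1 \in R, (nth z0 m i).1.2 \in C,
     f (nth z0 m i).1.1 (nth z0 m i).1.2 == p & p != al].
  move=> iq; have iin : nth z0 m i \in m by apply/mem_nth/(leq_trans iq).
  have /eqP := allP mu _ iin; have := mP _ iin.
  case: (nth z0 m i) => [[x y] [[[[p' al'] r'] s'] t']] /= H E.
  by case: E H => -> -> -> -> -> H; split.
exists p, al, r, s, t; split; first by case: (mz 0 q0) => _ /and4P[].
exists (fun i => (nth z0 m i).1.1), (fun i => (nth z0 m i).1.2); split.
  by move=> i /mz[_ /and4P[-> -> /eqP]].
move=> i j ij jq; have iq := ltn_trans ij jq.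
have /(pairwiseP z0)/(_ i j) := mok.
rewrite !inE (leq_trans iq sm) (leq_trans jq sm) ij => /(_ isT isT isT).
have [E _] := mz i iq; move: E.
case: (nth z0 m i) => [[x y] [[[[p' al'] r'] s'] t']] /= E.
case: (nth z0 m j) => [[x' y'] u'] /= /and4P[/eqP H1 /eqP H2 /eqP H3 /eqP H4].
by case: E => _ <- <- <- <-; split.
Qed.

End Chain.

Lemma ramsey_asym a b : exists N, forall (V : finType) (e : rel V) (X : {set V}),
  symmetric e -> N <= #|X| -> exists2 Y : {set V}, Y \subset X &
    (a <= #|Y| /\ {in Y &, forall x y, x != y -> e x y = true}) \/
    (b <= #|Y| /\ {in Y &, forall x y, x != y -> e x y = false}).
Proof.
elim: a b => [|a IHa] b.
  by exists 0 => V e X _ _; exists set0; [apply: sub0set|left; split=> // x y; rewrite inE].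
elim: b => [|b [N2 IHb]].
  by exists 0 => V e X _ _; exists set0; [apply: sub0set|right; split=> // x y; rewrite inE].
have [N1 IHN1] := IHa b.+1.
exists (N1 + N2).+1 => V e X es NX.
have /card_gt0P[v vX] : 0 < #|X| by apply: leq_trans NX.
rewrite (cardsD1 v) vX ltnS -(cardsID [set y | e v y]) in NX.
have step c (Y : {set V}) : Y \subset X :\ v -> {in Y, forall y, e v y = c} ->
    {in Y &, forall x y, x != y -> e x y = c} ->
    v |: Y \subset X /\ #|v |: Y| = #|Y|.+1 /\
    {in v |: Y &, forall x y, x != y -> e x y = c}.
  move=> /subsetP YX vY YY; split; last split.
  - by apply/subsetP=> x /setU1P[->|/YX/setD1P[]].
  - by rewrite cardsU1; case: (boolP (v \in Y)) => // /YX/setD1P[]; rewrite eqxx.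
  - move=> x y /setU1P[->|xY] /setU1P[->|yY] xy; rewrite ?eqxx // in xy *.
    + exact: vY.
    + by rewrite es vY.
    + exact: YY.
have [N1X|XN1] := leqP N1 #|(X :\ v) :&: [set y | e v y]|.
  have [Y YX [[aY YY]|[bY YY]]] := IHN1 V e _ es N1X.
    have [||sub [cY hY]] := step true Y _ _ YY.
    - by apply: subset_trans YX (subsetIl _ _).
    - by move=> y /(subsetP YX); rewrite !inE => /andP[_ ->].
    by exists (v |: Y) => //; left; rewrite cY.
  exists Y; last by right.
  by apply: subset_trans YX (subset_trans (subsetIl _ _) (subsetDl _ _)).
have [|Y YX [[aY YY]|[bY YY]]] := IHb V e ((X :\ v) :\: [set y | e v y]) es.
- by rewrite -(leq_add2l N1); apply: leq_trans NX _; rewrite leq_add2r ltnW.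
- exists Y; last by left.
  by apply: subset_trans YX (subset_trans (subsetDl _ _) (subsetDl _ _)).
have [||sub [cY hY]] := step false Y _ _ YY.
- by apply: subset_trans YX (subsetDl _ _).
- by move=> y /(subsetP YX); rewrite !inE => /andP[/negbTE ->].
by exists (v |: Y) => //; right; rewrite cY.
Qed.

Lemma ramsey n : exists N, forall (V : finType) (e : rel V) (X : {set V}),
  symmetric e -> N <= #|X| -> exists2 Y : {set V}, Y \subset X /\ n <= #|Y| &
    exists b, {in Y &, forall x y, x != y -> e x y = b}.
Proof.
have [N NP] := ramsey_asym n n.
exists N => V e X es /(NP V e X es)[Y YX [[nY h]|[nY h]]]; exists Y => //.
  by exists true.
by exists false.
Qed.

End Combinatorics.

(** * Local equivalence on a fixed vertex set *)


Section LocalEquivalence.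
Variable V : finType.
Implicit Types (e d : rel V) (S X Y Z : {set V}) (l : seq V).

Definition is_graph e := symmetric e /\ irreflexive e.

Definition lc e (v : V) : rel V :=
  fun x y => e x y (+) [&& x != y, e v x & e v y].

(** Confining the complemented vertices to [S] does two jobs: rows without neighbours in [S] stay
    fixed ([reach_away]), and the sequence can be replayed in any graph that agrees with [e] on [S]
    ([reach_agree]). *)
Definition reach S e e' := exists2 l, all (mem S) l & e' = foldl lc e l.

Lemma lc_graph e v : is_graph e -> is_graph (lc e v).
Proof.
move=> [es ei]; split=> [x y|x]; rewrite /lc.
  by rewrite es eq_sym [e v x && _]andbC.
by rewrite ei eqxx.
Qed.

Lemma lc_inv e v : is_graph e -> lc (lc e v) v = e.
Proof.
move=> [es ei]; apply/funext=> x; apply/funext=> y; rewrite /lc !ei.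
by rewrite /= !andbF !addbF -addbA addbb addbF.
Qed.

Lemma reach_refl S e : reach S e e.
Proof. by exists [::]. Qed.

Lemma reach_trans S e1 e2 e3 : reach S e1 e2 -> reach S e2 e3 -> reach S e1 e3.
Proof.
move=> [l1 l1S ->] [l2 l2S ->]; exists (l1 ++ l2); last by rewrite foldl_cat.
by rewrite all_cat l1S.
Qed.

Lemma reach_sub S S' e e' : S \subset S' -> reach S e e' -> reach S' e e'.
Proof.
move=> /subsetP SS' [l /allP lS ->]; exists l => //.
by apply/allP=> x /lS /SS'.
Qed.

Lemma reach_lc S e v : v \in S -> reach S e (lc e v).
Proof. by move=> vS; exists [:: v] => //=; rewrite vS. Qed.

Lemma reach_ind S e (P : rel V -> Prop) :
  P e -> (forall d v, v \in S -> P d -> P (lc d v)) ->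
  forall e', reach S e e' -> P e'.
Proof.
move=> Pe Plc e' [l lS ->].
elim: l e Pe lS => //= v l IH e Pe /andP[vS lS].
by apply: IH lS; apply: Plc.
Qed.

Lemma reach_graph S e e' : is_graph e -> reach S e e' -> is_graph e'.
Proof. by move=> ge; apply: reach_ind => // d v _; apply: lc_graph. Qed.

Lemma reach_away S e e' x : is_graph e -> {in S, forall v, ~~ e x v} ->
  reach S e e' -> forall y, e' x y = e x y.
Proof.
move=> ge xS r; suff [] : is_graph e' /\ forall y, e' x y = e x y by [].
move: e' r; apply: reach_ind => [|d v vS [gd rd]]; first by [].
split=> [|y]; first exact: lc_graph.
by rewrite /lc rd [d v x]gd.1 rd (negbTE (xS v vS)) /= andbF addbF.
Qed.

Definition agree S e d := {in S &, forall x y, e x y = d x y}.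

Lemma reach_agree S e e' d : agree S e d -> reach S e e' ->
  exists2 d', reach S d d' & agree S e' d'.
Proof.
move=> ag; move: e'; apply: reach_ind => [|f v vS [d' rd' ag']].
  by exists d => //; apply: reach_refl.
exists (lc d' v); first exact: reach_trans rd' (reach_lc _ vS).
by move=> x y xS yS; rewrite /lc !ag'.
Qed.

(* The formula below also holds on the diagonal, where both sides vanish. *)
Lemma pivotP e c y : is_graph e -> e c y ->
  exists e', [/\ reach [set c; y] e e', is_graph e' &
    {in [set~ c] :&: [set~ y] &, forall x z,
      e' x z = e x z (+) (e x c && e z y) (+) (e x y && e z c)}].
Proof.
move=> ge ecy; exists (lc (lc (lc e c) y) c); split.
- by exists [:: c; y; c] => //=; rewrite !inE !eqxx orbT.
- by do 3!apply: lc_graph.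
have [es ei] := ge => x z; rewrite !inE => /andP[xc xy] /andP[zc zy].
rewrite /lc !ei !(eq_sym c) !(eq_sym y) ![e y c]es ![e c x]es ![e c z]es.
rewrite ![e y x]es ![e y z]es ecy xc xy zc zy.
have ncy : c != y by apply: contraTneq ecy => ->; rewrite ei.
rewrite ?[y == c]eq_sym ncy ?eqxx.
have [->|xz] := eqVneq x z; first by rewrite !ei; do 2![case: (e z _)].
by case: (e x z); case: (e x c); case: (e x y); case: (e z c); case: (e z y).
Qed.

End LocalEquivalence.

(** * Induced patterns as vertex-minors *)

Section Ideal.

Lemma SGraph_eq (V : finType) (e : rel V) s i s' i' :
  @SGraph V e s i = @SGraph V e s' i'.
Proof. by rewrite (Prop_irrelevance s s') (Prop_irrelevance i i'). Qed.

Lemma locally_equivalent_reach (G : sgraph) S (e : rel G) (s : symmetric e) i :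
  reach S (@sedge G) e -> locally_equivalent G (@SGraph G e s i).
Proof.
case: G S e s i => V e0 s0 i0 /= S e s i [l _].
elim/last_ind: l e s i => [|l v IH] e s i /=.
  move=> eE; subst e.
  by rewrite (SGraph_eq s i s0 i0); apply: locally_equivalent_refl.
rewrite foldl_rcons => eE; subst e.
have [gs gi] : is_graph (foldl (@lc V) e0 l).
  elim/last_ind: l {IH s i} => [|l u IH] //=.
  by rewrite foldl_rcons; apply: lc_graph.
have := @locally_equivalent_step _ (SGraph gs gi) v (IH _ gs gi erefl).
rewrite /local_complement.
by rewrite (SGraph_eq s i (local_complement_sym (G := SGraph gs gi) v)
  (local_complement_irrefl (G := SGraph gs gi) v)).
Qed.

(** The bridge back to the class: all later work happens among relations on one vertex set and only
    has to exhibit an induced copy of [K]. *)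
Lemma ideal_pattern (C : sgraph -> Prop) (G K : sgraph) S (e : rel G)
    (f : K -> G) :
  vertex_minor_ideal C -> C G -> reach S (@sedge G) e -> injective f ->
  {mono f : x y / x -- y >-> e x y} -> C K.
Proof.
move=> HC CG re fI fM.
have ge : is_graph e.
  by apply: reach_graph re; split; [apply: sedge_sym|apply: sedge_irrefl].
pose H := SGraph ge.1 ge.2; pose T : {set H} := [set f x | x : K].
have fT x : f x \in T by apply: imset_f.
pose g x : induced T := exist _ (f x) (fT x).
apply: (HC G (induced T) K CG).
  exact/VertexMinor/(locally_equivalent_reach ge.1 ge.2 re).
have gI : injective g by move=> x y /(congr1 val) /fI.
have gC : #|induced T| <= #|K|.
  rewrite card_sig (_ : #|_| = #|T|) ?card_imset //.
have [h gK hK] := inj_card_bij gI gC.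
exists h; first by exists g.
by move=> x y; rewrite -{2}(hK x) -{2}(hK y) -fM.
Qed.
End Ideal.

(** * Rank over the binary field *)


Section BoolRank.
Variable V : finType.
Implicit Types (d f g : V -> V -> bool) (e : rel V) (X Y Z H : {set V}).
Import GRing.Theory.

Lemma natr_addb (a b : bool) : ((a (+) b)%:R = a%:R + b%:R :> 'F_2)%R.
Proof. by apply/eqP; case: a; case: b. Qed.

Lemma natr_andb (a b : bool) : ((a && b)%:R = a%:R * b%:R :> 'F_2)%R.
Proof. by rewrite -mulnb natrM. Qed.

Lemma natr_sumb (I : Type) (r : seq I) (P : pred I) (F : I -> bool) :
  (((\big[addb/false]_(i <- r | P i) F i)%:R : 'F_2) =
     \sum_(i <- r | P i) (F i)%:R)%R.
Proof. exact: (big_morph (fun b : bool => b%:R%R : 'F_2) natr_addb (erefl _)). Qed.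

(** All matrices are square over the whole of [V], a cut being encoded by zero entries, so that
    matrices of different cuts can be added and compared. *)
Definition bmx d : 'M['F_2]_#|V| :=
  (\matrix_(i, j) (d (enum_val i) (enum_val j))%:R)%R.

Definition brank d : nat := \rank (bmx d).

Lemma eq_brank d d' : (forall x y, d x y = d' x y) -> brank d = brank d'.
Proof.
by move=> dd'; congr (\rank _); apply/matrixP=> i j; rewrite !mxE dd'.
Qed.

Lemma brank_tr d : brank (fun x y => d y x) = brank d.
Proof.
by rewrite /brank -mxrank_tr; congr (\rank _); apply/matrixP=> i j; rewrite !mxE.
Qed.

Lemma brank_add d d1 d2 : (forall x y, d x y = d1 x y (+) d2 x y) ->
  brank d <= brank d1 + brank d2.
Proof.
move=> dE; rewrite {1}/brank (_ : bmx d = bmx d1 + bmx d2)%R ?mxrank_add //.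
by apply/matrixP=> i j; rewrite !mxE dE natr_addb.
Qed.

(** The sum is a factorization through a space of dimension [#|H|]. *)
Lemma brank_sum d H f g :
  (forall x y, d x y = \big[addb/false]_(h in H) (f x h && g h y)) ->
  brank d <= #|H|.
Proof.
move=> dE.
pose A : 'M['F_2]_(#|V|, #|H|) := (\matrix_(i, k) (f (enum_val i) (enum_val k))%:R)%R.
pose B : 'M['F_2]_(#|H|, #|V|) := (\matrix_(k, j) (g (enum_val k) (enum_val j))%:R)%R.
rewrite /brank (_ : bmx d = A *m B)%R.
  exact: leq_trans (mxrankM_maxl _ _) (rank_leq_col _).
apply/matrixP=> i j; rewrite !mxE dE natr_sumb big_enum_val.
by apply: eq_bigr => k _; rewrite !mxE natr_andb.
Qed.

Lemma brank_mull d d' f :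
  (forall x y, d' x y = \big[addb/false]_h (f x h && d h y)) ->
  brank d' <= brank d.
Proof.
move=> dE; rewrite /brank (_ : bmx d' = bmx f *m bmx d)%R; first exact: mxrankM_maxr.
apply/matrixP=> i j; rewrite !mxE dE natr_sumb.
rewrite (reindex (@enum_val _ (mem V))); last first.
  by exists enum_rank => x _; rewrite ?enum_valK ?enum_rankK.
by apply: eq_bigr => k _; rewrite !mxE natr_andb.
Qed.

Lemma addb_sum1 (F : pred V) v : \big[addb/false]_h ((h == v) && F h) = F v.
Proof.
rewrite (bigD1 v) //= eqxx big1 ?addbF //= => i /negbTE -> //.
Qed.

Lemma brank_row_op d d' (u : pred V) v :
  (forall x y, d' x y = d x y (+) (u x && d v y)) -> brank d' <= brank d.
Proof.
move=> dE; apply: (brank_mull (f := fun x h => (h == x) (+) (u x && (h == v)))).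
move=> x y; rewrite dE.
under eq_bigr do rewrite andb_addl -andbA.
rewrite big_split /= addb_sum1 -big_distrr /= addb_sum1 //.
Qed.

Definition crk e Z := brank (fun x y => [&& x \in Z, y \notin Z & e x y]).

Lemma crk_setC e Z : symmetric e -> crk e (~: Z) = crk e Z.
Proof.
move=> es; rewrite -[RHS]brank_tr; apply: eq_brank => x y.
by rewrite !inE negbK es andbCA.
Qed.

(** For [v] in [Z], local complementation adds the row of [v] to the rows of its neighbours in [Z].
    The other case follows by passing to the complement of [Z]. *)
Lemma crk_lc_le e v Z : is_graph e -> crk (lc e v) Z <= crk e Z.
Proof.
move=> ge; wlog vZ : Z / v \in Z.
  move=> IH; have [/IH //|nvZ] := boolP (v \in Z).
  by rewrite -(crk_setC _ ge.1) -(crk_setC _ (lc_graph v ge).1) IH ?inE.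
apply: (@brank_row_op _ _ (fun x => (x \in Z) && e v x) v) => x y /=.
rewrite /lc vZ /=; case xZ: (x \in Z) => //=; case yZ: (y \in Z); rewrite ?andbF //=.
by case: eqP => [xy|_ //]; rewrite -xy xZ in yZ.
Qed.

Lemma crk_lc e v Z : is_graph e -> crk (lc e v) Z = crk e Z.
Proof.
move=> ge; apply/eqP; rewrite eqn_leq crk_lc_le //=.
by rewrite -{1}(lc_inv v ge) crk_lc_le //; apply: lc_graph.
Qed.

Lemma crk_reach S e e' Z : is_graph e -> reach S e e' -> crk e' Z = crk e Z.
Proof.
move=> ge r; suff [] : is_graph e' /\ crk e' Z = crk e Z by [].
move: e' r; apply: reach_ind => // d v _ [gd <-].
by split; [apply: lc_graph|apply: crk_lc].
Qed.

Lemma brank_rows d H : (forall x y, d x y -> x \in H) -> brank d <= #|H|.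
Proof.
move=> dH; apply: (brank_sum (f := fun x h => h == x) (g := d)) => x y.
have [xH|xH] := boolP (x \in H); last first.
  rewrite big1 ?(contraNF (@dH x y)) // => h hH.
  by case: eqP xH => // <-; rewrite hH.
by rewrite (bigD1 x) //= eqxx big1 ?addbF // => h /andP[_ /negbTE ->].
Qed.

Lemma brank_cols d H : (forall x y, d x y -> y \in H) -> brank d <= #|H|.
Proof. by move=> dH; rewrite -brank_tr; apply: brank_rows => x y /dH. Qed.

(* One representative of each class of equal rows; the rank of a matrix is at
   most the number of its distinct rows. *)
Lemma brank_sep d X Y : exists2 R : {set V}, R \subset X &
  sep d R Y /\ brank (fun x y => [&& x \in X, y \in Y & d x y]) <= #|R|.
Proof.
have [rep [repP rsp]] := row_rep d X Y.
exists [set rep x | x in X].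
  by apply/subsetP=> _ /imsetP[x xX ->]; case: (repP x xX).
split=> //.
apply: (brank_sum (f := fun x h => (x \in X) && (rep x == h))
                  (g := fun h y => (y \in Y) && d h y)) => x y.
case xX: (x \in X) => /=; last by rewrite big1.
rewrite (bigD1 (rep x)) /=; last exact: imset_f.
rewrite eqxx big1 ?addbF => [|h /andP[_ /negbTE]]; last by rewrite eq_sym => ->.
by case yY: (y \in Y) => //=; rewrite (repP x xX).2.
Qed.

End BoolRank.

Section CutRank.
Variable G : sgraph.
Import GRing.Theory.

Lemma cut_rank_le (Z : {set G}) : cut_rank Z <= crk (@sedge G) Z.
Proof.
rewrite /cut_rank /crk /brank.
set M := bmx _.
pose A : 'M['F_2]_(#|Z|, #|G|) := (\matrix_(i, k) (enum_val i == enum_val k)%:R)%R.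
pose B : 'M['F_2]_(#|G|, #|~: Z|) := (\matrix_(k, j) (enum_val k == enum_val j)%:R)%R.
have -> : cut_matrix Z = (A *m M *m B)%R.
  have eqs (T : {set G}) (i : 'I_#|T|) (F : 'I_#|G| -> 'F_2) :
      (\sum_k (enum_val i == enum_val k)%:R * F k = F (enum_rank (enum_val i)))%R.
    rewrite (bigD1 (enum_rank (enum_val i))) //= enum_rankK eqxx mul1r big1 ?addr0 //.
    move=> k; rewrite -(inj_eq (@enum_val_inj _ _)) enum_rankK eq_sym => /negbTE ->.
    by rewrite mul0r.
  apply/matrixP=> i j; rewrite !mxE.
  under eq_bigr do rewrite mulrC !mxE [_ == enum_val j]eq_sym.
  rewrite eqs.
  under eq_bigr do rewrite !mxE.
  rewrite eqs !enum_rankK (enum_valP i).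
  by have := enum_valP j; rewrite inE => ->.
exact: leq_trans (mxrankM_maxl _ _) (mxrankM_maxr _ _).
Qed.

(* An induced matching across the cut gives an identity submatrix. *)
Lemma cut_rank_matching (Z : {set G}) q (p r : 'I_q -> G) :
  (forall j, p j \in Z) -> (forall j, r j \notin Z) ->
  (forall i j, p i -- r j = (i == j)) -> q <= cut_rank Z.
Proof.
move=> pZ rZ pr; rewrite /cut_rank.
have rZ' j : r j \in ~: Z by rewrite inE.
pose A : 'M['F_2]_(q, #|Z|) := (\matrix_(i, k) (enum_val k == p i)%:R)%R.
pose B : 'M['F_2]_(#|~: Z|, q) := (\matrix_(k, j) (enum_val k == r j)%:R)%R.
have eqs (T : {set G}) (x : G) (xT : x \in T) (F : 'I_#|T| -> 'F_2) :
    (\sum_k (enum_val k == x)%:R * F k = F (enum_rank_in xT x))%R.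
  rewrite (bigD1 (enum_rank_in xT x)) //= enum_rankK_in // eqxx mul1r.
  rewrite big1 ?addr0 // => k; rewrite -(inj_eq (@enum_val_inj _ _)) enum_rankK_in //.
  by move/negbTE ->; rewrite mul0r.
have -> : q = \rank (A *m cut_matrix Z *m B)%R; last first.
  exact: leq_trans (mxrankM_maxl _ _) (mxrankM_maxr _ _).
rewrite (_ : A *m _ *m B = 1%:M)%R ?mxrank1 //.
apply/matrixP=> i j; rewrite !mxE.
under eq_bigr do rewrite mulrC [X in (X * _)%R]mxE.
rewrite (eqs _ _ (rZ' j)) !mxE.
under eq_bigr do rewrite [X in (X * _)%R]mxE.
by rewrite (eqs _ _ (pZ i)) !mxE !enum_rankK_in // pr.
Qed.

Lemma cut_rank_leq_card (Z : {set G}) : cut_rank Z <= #|Z|.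
Proof. exact: rank_leq_row. Qed.

End CutRank.

(** * Induced matchings from large rank *)


Section Matching.
Variable V : finType.
Implicit Types (e d : rel V) (S : {set V}) (F : {set V * V}) (x y : nat -> V).

(* Distinct edges of [F] are automatically disjoint, as a shared end would
   contradict [e p.1 q.2 = false]. *)
Definition clean e F := {in F &, forall p q,
  [/\ e p.1 q.2 = (p == q), e p.1 q.1 = false & e p.2 q.2 = false]}.

Definition ends F : {set V} := \bigcup_(p in F) [set p.1; p.2].

Lemma endsP v F : reflect (exists2 p, p \in F & v = p.1 \/ v = p.2) (v \in ends F).
Proof.
apply: (iffP bigcupP) => [[p pF /set2P vp]|[p pF vp]]; exists p => //.
exact/set2P.
Qed.

Lemma ends1 p F : p \in F -> p.1 \in ends F.
Proof. by move=> pF; apply/endsP; exists p => //; left. Qed.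

Lemma ends2 p F : p \in F -> p.2 \in ends F.
Proof. by move=> pF; apply/endsP; exists p => //; right. Qed.

Lemma endsS F F' : F \subset F' -> ends F \subset ends F'.
Proof.
by move=> /subsetP FF; apply/subsetP=> v /endsP[p pF vp]; apply/endsP; exists p; rewrite ?FF.
Qed.

Lemma endsU F F' : ends (F :|: F') = ends F :|: ends F'.
Proof. exact: bigcup_setU. Qed.

Lemma card_ends F : #|ends F| <= 2 * #|F|.
Proof.
rewrite mulnC; apply: card_bigcup_le => p _.
by rewrite cards2; case: (_ != _).
Qed.

Lemma cleanS e F F' : F \subset F' -> clean e F' -> clean e F.
Proof. by move=> /subsetP FF cF p q /FF pF /FF qF; apply: cF. Qed.

Lemma clean_edge e F p : clean e F -> p \in F -> e p.1 p.2.
Proof. by move=> cF pF; case: (cF p p pF pF) => ->; rewrite eqxx. Qed.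

Lemma clean1 e a b : is_graph e -> e a b -> clean e [set (a, b)].
Proof.
by move=> [_ ei] eab p r /set1P-> /set1P->; rewrite !ei eab eqxx.
Qed.

Lemma cleanU e F F' : is_graph e -> clean e F -> clean e F' ->
  {in ends F & ends F', forall u v, e u v = false} -> clean e (F :|: F').
Proof.
move=> [es _] cF cF' FF.
have ne p r : p \in F -> r \in F' -> p != r.
  move=> pF rF; apply/eqP => pr; have := clean_edge cF' rF.
  by rewrite -{1}pr FF ?ends1 ?ends2.
move=> p r /setUP[pF|pF] /setUP[rF|rF]; [exact: cF| | |exact: cF'].
  by rewrite !FF ?ends1 ?ends2 // (negbTE (ne _ _ pF rF)).
by rewrite ![e p.1 _]es ![e p.2 _]es !FF ?ends1 ?ends2 // eq_sym (negbTE (ne _ _ rF pF)).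
Qed.

(** The output of [chain] for an adjacency matrix: with boolean entries, a diagonal different from
    [al] is [~~ al]. The last clause keeps the two sides apart, so that the test [x != y] in [lc]
    never interferes between them. *)
Definition config e S q x y (al r s t : bool) :=
  [/\ forall i, i < q -> [/\ x i \in S, y i \in S & e (x i) (y i) = ~~ al],
      forall i j, i < j -> j < q -> [/\ e (x j) (y i) = al, e (x i) (y j) = r,
                                      e (x i) (x j) = s & e (y i) (y j) = t]
    & forall i j, i < q -> j < q -> x i != y j].

Lemma config_le e S q q' x y al r s t : q' <= q ->
  config e S q x y al r s t -> config e S q' x y al r s t.
Proof.
move=> qq [h1 h2 h3]; split=> [i iq|i j ij jq|i j iq jq].
- by apply: h1; apply: leq_trans qq.
- by apply: h2 => //; apply: leq_trans qq.
- by apply: h3; apply: leq_trans qq.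
Qed.

Lemma config_shift e S q k x y al r s t :
  config e S (k + q) x y al r s t ->
  config e S q (fun i => x (k + i)) (fun i => y (k + i)) al r s t.
Proof.
move=> [h1 h2 h3]; split=> [i iq|i j ij jq|i j iq jq].
- by apply: h1; rewrite ltn_add2l.
- by apply: h2; rewrite ltn_add2l.
- by apply: h3; rewrite ltn_add2l.
Qed.

Lemma config_injx e S q x y al r s t i j : i < q -> j < q ->
  config e S q x y al r s t -> (x i == x j) = (i == j).
Proof.
move=> iq jq [h1 h2 _]; have [->|ij] := eqVneq i j; first by rewrite eqxx.
wlog lt_ij : i j iq jq ij / i < j.
  move=> IH; have [lt|lt|/eqP] := ltngtP i j; first exact: IH.
    by rewrite eq_sym; apply: IH; rewrite // eq_sym.
  by rewrite (negbTE ij).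
apply/negbTE/eqP => xij.
have [_ _ d] := h1 i iq; have [u _ _ _] := h2 i j lt_ij jq.
by move: u; rewrite -xij d; case: (al).
Qed.

Lemma config_injy e S q x y al r s t i j : i < q -> j < q ->
  config e S q x y al r s t -> (y i == y j) = (i == j).
Proof.
move=> iq jq [h1 h2 _]; have [->|ij] := eqVneq i j; first by rewrite eqxx.
wlog lt_ij : i j iq jq ij / i < j.
  move=> IH; have [lt|lt|/eqP] := ltngtP i j; first exact: IH.
    by rewrite eq_sym; apply: IH; rewrite // eq_sym.
  by rewrite (negbTE ij).
apply/negbTE/eqP => xij.
have [_ _ d] := h1 j jq; have [u _ _ _] := h2 i j lt_ij jq.
by move: u; rewrite xij d; case: (al).
Qed.

Lemma config_lc e S q x y al r s t v a b :
  config e S q x y al r s t ->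
  (forall i, i < q -> e v (x i) = a /\ e v (y i) = b) ->
  config (lc e v) S q x y (al (+) (a && b)) (r (+) (a && b)) (s (+) a) (t (+) b).
Proof.
move=> cf vxy; have [h1 h2 h3] := cf; split=> // [i iq|i j ij jq].
  have [xS yS d] := h1 i iq; have [ax bx] := vxy i iq.
  by split=> //; rewrite /lc d h3 // ax bx addNb.
have iq := ltn_trans ij jq.
have [d1 d2 d3 d4] := h2 i j ij jq.
have [ai bi] := vxy i iq; have [aj bj] := vxy j jq.
rewrite /lc d1 d2 d3 d4 ai bi aj bj !h3 //.
by rewrite (config_injx iq jq cf) (config_injy iq jq cf) (ltn_eqF ij) !andbb.
Qed.

(* Local complementation at the first or last vertex of a side clears [s] or
   [t]; the choice of the vertex controls which other values it toggles. *)
Lemma config_norm e S q x y al r s t : is_graph e ->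
  config e S (q + 3) x y al r s t ->
  exists e' x' y' al' r',
    reach S e e' /\ config e' S q x' y' al' r' false false.
Proof.
move=> ge.
have shift1 Q e0 x0 y0 al0 r0 s0 t0 : is_graph e0 ->
    config e0 S Q.+1 x0 y0 al0 r0 s0 t0 ->
    exists e' x' y' al' r' t', reach S e0 e' /\ config e' S Q x' y' al' r' false t'.
  move=> g0 c0; have c1 := config_shift (k := 1) c0; have [h1 h2 h3] := c0.
  case: s0 c0 c1 h2 => c0 c1 h2; last first.
    exists e0, (fun i => x0 (1 + i)), (fun i => y0 (1 + i)), al0, r0, t0.
    by split=> //; apply: reach_refl.
  have hv i : i < Q -> e0 (x0 0) (x0 (1 + i)) = true /\ e0 (x0 0) (y0 (1 + i)) = r0.
    by move=> iQ; have [|| _ -> -> _] := h2 0 (1 + i).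
  have c2 := config_lc c1 hv; do 6!eexists; split; last exact: c2.
  by apply: reach_lc; case: (h1 0 isT).
rewrite addn3 => /(shift1 _ _ _ _ _ _ _ _ ge) [e1 [x1 [y1 [al1 [r1 [t1 [re1 c1]]]]]]].
have g1 := reach_graph ge re1; have c2 := config_shift (k := 1) c1.
have [h1 h2 h3] := c1.
case: t1 c1 c2 h2 => c1 c2 h2; last first.
  by exists e1, x1, y1, al1, r1; split=> //; apply: config_le c1; lia.
have hv i : i < q.+1 -> e1 (y1 0) (x1 (1 + i)) = al1 /\ e1 (y1 0) (y1 (1 + i)) = true.
  by move=> iQ; rewrite g1.1; have [|| -> _ _ ->] := h2 0 (1 + i).
have c3 := config_lc c2 hv; have r3 : reach S e1 (lc e1 (y1 0)).
  by apply: reach_lc; case: (h1 0 isT).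
have := reach_trans re1 r3; have := lc_graph (y1 0) g1.
move: (lc e1 _) c3 => e3 c3 g3 r03; rewrite andbT addbb addFb in c3.
have [h4 h5 h6] := c3.
(* Complementing at [y1 0] cleared [t], set [al] to false and set [s] to the old [al]. If that was
   true, the last vertex of the first side sees all earlier [x] and no earlier [y], so complementing
   there clears [s] and nothing else. *)
case: al1 c3 h5 {c1 c2 h1 h2 h4 h6 hv} => c3 h5; last first.
  by do 5!eexists; split; last exact: config_le c3.
have hv i : i < q -> e3 (x1 (1 + q)) (x1 (1 + i)) = true /\
                     e3 (x1 (1 + q)) (y1 (1 + i)) = false.
  by move=> iq; have [|| -> _ + _] := h5 i q; rewrite // g3.1 => ->.
have c4 := config_lc (config_le (leqnSn q) c3) hv.
do 5!eexists; split; last exact: c4.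
apply: reach_trans r03 _; apply: reach_lc.
by case: (c3) => h _ _; case: (h q (leqnn _)).
Qed.

(* Pivoting on the second rung of the half graph isolates the first rung and
   does not change the later ones. *)
Lemma half_graph_matching q : forall e S x y, is_graph e ->
  config e S (2 * q) x y false true false false ->
  exists e' F, [/\ reach S e e', clean e' F, ends F \subset S & q <= #|F|].
Proof.
elim: q => [|q IH] e S x y ge.
  exists e, set0; split; rewrite ?sub0set //; first exact: reach_refl.
    by move=> p; rewrite inE.
  by apply/subsetP=> v /endsP[p]; rewrite inE.
rewrite mulnS => cf; have [h1 h2 h3] := cf.
have h1' i : i < 2 -> [/\ x i \in S, y i \in S & e (x i) (y i) = true].
  by move=> i2; case: (h1 i) => //; apply: leq_trans i2 (leq_addr _ _).
have [x0S y0S e00] := h1' 0 isT; have [x1S y1S e11] := h1' 1 isT.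
have l01 : 1 < 2 + 2 * q by [].
have [E10 E01 X01 Y01] := h2 0 1 isT l01.
have [e1 [re1 g1 e1E]] := pivotP ge e11.
have sub : [set x 1; y 1] \subset S by rewrite subUset !sub1set x1S.
have inx i : i < 2 + 2 * q -> i != 1 -> x i \in [set~ x 1] :&: [set~ y 1].
  by move=> iq i1; rewrite !inE (config_injx iq l01 cf) i1 h3.
have iny i : i < 2 + 2 * q -> i != 1 -> y i \in [set~ x 1] :&: [set~ y 1].
  by move=> iq i1; rewrite !inE (config_injy iq l01 cf) i1 eq_sym h3.
have lt0 : 0 < 2 + 2 * q by [].
have e1sym := g1.1; have es := ge.1.
have far k i : k < 2 -> i < 2 * q ->
    ((e (x k) (x (2 + i)) = false) * (e (x (2 + i)) (x k) = false)) *
    ((e (x k) (y (2 + i)) = true) * (e (y (2 + i)) (x k) = true)) *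
    ((e (y k) (x (2 + i)) = false) * (e (x (2 + i)) (y k) = false)) *
    ((e (y k) (y (2 + i)) = false) * (e (y (2 + i)) (y k) = false)).
  move=> k2 iq; have l2 : 2 + i < 2 + 2 * q by rewrite ltn_add2l.
  have kl : k < 2 + i by apply: leq_trans k2 _; apply: leq_addr.
  by have [A B C D] := h2 k (2 + i) kl l2; rewrite !(es _ (x k)) !(es _ (y k)) (es (y k) (x _)) A B C D.
have c2 := config_shift cf.
have ix i : i < 2 * q -> x (2 + i) \in [set~ x 1] :&: [set~ y 1].
  by move=> iq; apply: inx; rewrite ?ltn_add2l.
have iy i : i < 2 * q -> y (2 + i) \in [set~ x 1] :&: [set~ y 1].
  by move=> iq; apply: iny; rewrite ?ltn_add2l.
pose S' := [set x (2 + i) | i : 'I_(2 * q)] :|: [set y (2 + i) | i : 'I_(2 * q)].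
have S'S : S' \subset S.
  by apply/subsetP=> v /setUP[] /imsetP[i _ ->]; case: (h1 (2 + i)); rewrite ?ltn_add2l.
have c1 : config e1 S' (2 * q) (fun i => x (2 + i)) (fun i => y (2 + i)) false true false false.
  case: c2 => k1 k2 k3; split=> // [i iq|i j ij jq].
    split; [by apply/setUP; left; apply/imsetP; exists (Ordinal iq)|
            by apply/setUP; right; apply/imsetP; exists (Ordinal iq)|].
    have [_ _ E] := k1 i iq.
    by rewrite e1E ?ix ?iy // E !(far 1 i).
  have iq := ltn_trans ij jq.
  have [k21 k22 k23 k24] := k2 i j ij jq.
  by rewrite !e1E ?ix ?iy // k21 k22 k23 k24 !(far 1 i) ?(far 1 j).
have [e2 [F [re2 cl2 eF cF]]] := IH _ _ _ _ g1 c1.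
have E10' : e (y 0) (x 1) = false by rewrite es.
have E01' : e (y 1) (x 0) = true by rewrite es.
have X01' : e (x 1) (x 0) = false by rewrite es.
have Y01' : e (y 1) (y 0) = false by rewrite es.
have tab := (X01, Y01, E01, E10, X01', Y01', E01', E10', e00, e11).
have in0 : (x 0 \in [set~ x 1] :&: [set~ y 1]) * (y 0 \in [set~ x 1] :&: [set~ y 1]).
  by rewrite inx ?iny.
have far0 u : u \in S' -> e1 (x 0) u = false /\ e1 (y 0) u = false.
  case/setUP=> /imsetP[i _ ->]; have iq := ltn_ord i;
  by rewrite !e1E ?ix ?iy ?in0 // !(far 0 i, far 1 i) ?tab.
have rx0 : forall w, e2 (x 0) w = e1 (x 0) w.
  by apply: (reach_away g1 _ re2) => u /far0[->].
have ry0 : forall w, e2 (y 0) w = e1 (y 0) w.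
  by apply: (reach_away g1 _ re2) => u /far0[_ ->].
have g2 := reach_graph g1 re2.
have eF' p : p \in F -> p.1 \in S' /\ p.2 \in S'.
  by move=> pF; split; apply: (subsetP eF); [apply: ends1|apply: ends2].
have F0 : {in ends [set (x 0, y 0)] & ends F, forall u v, e2 u v = false}.
  move=> u v /endsP[p /set1P-> uE] /(subsetP eF)/far0[f1 f2].
  by case: uE => ->; rewrite ?rx0 ?ry0.
have e00' : e2 (x 0) (y 0) by rewrite rx0 e1E ?in0 // !tab.
exists e2, ([set (x 0, y 0)] :|: F); split.
- exact: reach_trans (reach_sub sub re1) (reach_sub S'S re2).
- exact: cleanU (clean1 g2 e00') cl2 F0.
- apply/subsetP=> u; rewrite endsU => /setUP[/endsP[p /set1P->] [] -> //|uF].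
  exact/(subsetP S'S)/(subsetP eF).
- rewrite cardsU1 (_ : _ \notin F) ?add1n //; apply/negP=> /ends2 yF.
  by have := e00'; rewrite F0 // (@ends1 (x 0, y 0)) // inE.
Qed.

(** The four values of [(al, r)] give a matching, a half graph, a half graph with the sides swapped
    and one of them shifted by one, and the complement of a matching. In the last case the pivot on
    [x 0] and [y 1] complements all later entries between the sides. *)
Lemma config_matching e S q x y al r : is_graph e ->
  config e S (2 * q + 2) x y al r false false ->
  exists e' F, [/\ reach S e e', clean e' F, ends F \subset S & q <= #|F|].
Proof.
have direct e0 x0 y0 : is_graph e0 -> config e0 S q x0 y0 false false false false ->
    exists e' F, [/\ reach S e0 e', clean e' F, ends F \subset S & q <= #|F|].
  move=> [es ei] cf; have [h1 h2 h3] := cf; pose z (i : 'I_q) := (x0 i, y0 i).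
  exists e0, [set z i | i : 'I_q]; split.
  - exact: reach_refl.
  - move=> _ _ /imsetP[i _ ->] /imsetP[j _ ->] /=.
    rewrite xpair_eqE !(config_injx _ _ cf) ?(config_injy _ _ cf) // andbb.
    have [->|ij] := eqVneq i j; first by rewrite !ei eqxx; case: (h1 j).
    rewrite (_ : (_ == _) = false); last by apply/negbTE.
    wlog lt : i j ij / i < j.
      move=> IH; have [lt|lt|eq_ij] := ltngtP i j; first exact: IH.
        have ji : j != i by rewrite eq_sym.
        have [A B C D] := h2 j i lt (ltn_ord i).
        by rewrite A (es (x0 i)) C (es (y0 i)) D.
      by case/eqP: ij; apply: val_inj.
    by have [A B C D] := h2 i j lt (ltn_ord j); rewrite B C D.
  - by apply/subsetP=> v /endsP[_ /imsetP[i _ ->] [] ->]; case: (h1 i (ltn_ord i)).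
  - rewrite card_imset ?card_ord // => i j [/eqP + _].
    by rewrite (config_injx _ _ cf) // => /eqP/val_inj.
move=> ge cf; case: al cf; case: r => cf.
- have [h1 h2 h3] := cf; have e01 : e (x 0) (y 1) by case: (h2 0 1) => //; lia.
  have [e1 [re1 g1 e1E]] := pivotP ge e01.
  have inx i : i < 2 * q -> x (2 + i) \in [set~ x 0] :&: [set~ y 1].
    by move=> iq; rewrite !inE (config_injx _ _ cf) ?h3 //; lia.
  have iny i : i < 2 * q -> y (2 + i) \in [set~ x 0] :&: [set~ y 1].
    by move=> iq; rewrite !inE (config_injy _ _ cf) ?[y _ == x _]eq_sym ?h3 //; lia.
  have far i : i < 2 * q -> [/\ e (x (2 + i)) (x 0) = false, e (y (2 + i)) (x 0) = true,
      e (x (2 + i)) (y 1) = true & e (y (2 + i)) (y 1) = false].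
    move=> iq; have [|| A B C D] := h2 0 (2 + i); [by []|by lia|].
    have [|| A' B' C' D'] := h2 1 (2 + i); [by []|by lia|].
    by rewrite A' (ge.1 _ (x 0)) (ge.1 _ (x 0)) (ge.1 _ (y 1)) B C D'.
  have [|e2 [F [re2 cl2 eF qF]]] := direct e1 (fun i => x (2 + i)) (fun i => y (2 + i)) g1.
    have qq : q <= 2 * q by lia.
    have [k1 k2 k3] : config e S (2 * q) (fun i => x (2 + i)) (fun i => y (2 + i)) true true false false.
      by apply: config_shift; rewrite addnC.
    split=> [i iq|i j ij jq|i j iq jq].
    - have iq' := leq_trans iq qq; have [u v w] := k1 i iq'; have [A B C D] := far i iq'.
      by rewrite e1E ?inx ?iny // w A B C D.
    - have iq' := leq_trans (ltn_trans ij jq) qq; have jq' := leq_trans jq qq.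
      have [u v w z] := k2 i j ij jq'; have [A B C D] := far i iq'.
      have [A' B' C' D'] := far j jq'.
      by rewrite !e1E ?inx ?iny // u v w z A B C D A' B' C' D'.
    - by apply: k3; lia.
  exists e2, F; split=> //; apply: reach_trans re2; apply: reach_sub re1.
  have [|x0S _ _] := h1 0; first by lia. have [|_ y1S _] := h1 1; first by lia.
  by rewrite subUset !sub1set x0S.
- have [|e' [F ?]] := @half_graph_matching q e S y (fun i => x i.+1) ge; last by exists e', F.
  have [h1 h2 h3] := cf; split=> [i iq|i j ij jq|i j iq jq].
  + have [|_ yS _] := h1 i; first by lia. have [|xS _ _] := h1 i.+1; first by lia.
    by split=> //; rewrite ge.1; case: (h2 i i.+1) => //; lia.
  + have [||A B C D] := h2 i j; [by []|by lia|].
    have [||A' B' C' D'] := h2 i.+1 j.+1; [by []|by lia|].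
    rewrite D C' ge.1; split=> //; last by rewrite ge.1; case: (h2 i j.+1) => //; lia.
    have [->|ij1] := eqVneq i.+1 j; first by case: (h1 j) => //; lia.
    by case: (h2 i.+1 j) => //; lia.
  + by rewrite eq_sym h3 //; lia.
- have [|e' [F ?]] := @half_graph_matching q e S x y ge; last by exists e', F.
  by apply: config_le cf; lia.
- by apply: (direct e x y) => //; apply: config_le cf; lia.
Qed.

End Matching.

Lemma sep_matching q : exists N, forall (V : finType) (e : rel V) (R C : {set V}),
  is_graph e -> [disjoint R & C] -> sep e R C -> N <= #|R| ->
  exists e' F, [/\ reach (R :|: C) e e', clean e' F, ends F \subset R :|: C & q <= #|F|].
Proof.
have [|N NP] := @chain bool (2 * q + 2 + 3); first by rewrite addn3.
exists N => V e R C ge RC sp NR.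
have [p [al [r [s [t [pal [x [y [h1 h2]]]]]]]]] := NP V V e e e R C sp NR.
have cf : config e (R :|: C) (2 * q + 2 + 3) x y al r s t.
  split=> [i iq|//|i j iq jq].
    have [xR yC ->] := h1 i iq; rewrite !inE xR yC orbT; split=> //.
    by case: (p) (al) pal => [] [].
  have [xR _ _] := h1 i iq; have [_ yC _] := h1 j jq.
  by apply: contraTneq yC => <-; rewrite (disjointFr RC).
have [e1 [x1 [y1 [al1 [r1 [re1 c1]]]]]] := config_norm ge cf.
have [e2 [F [re2 cF eF qF]]] := config_matching (reach_graph ge re1) c1.
by exists e2, F; split=> //; apply: reach_trans re1 re2.
Qed.

(** * Hubs in connected graphs *)


Section Connectivity.
Variable V : finType.
Implicit Types (e d : rel V) (S T X Y : {set V}) (F : {set V * V}).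

Definition restr e Y : rel V := fun u v => [&& u \in Y, v \in Y & e u v].

Definition conn e Y := [forall x in Y, forall y in Y, connect (restr e Y) x y].

Lemma connP e Y : reflect {in Y &, forall x y, connect (restr e Y) x y} (conn e Y).
Proof.
by apply: (iffP forall_inP) => [h x y xY|h x xY]; [exact/forall_inP/h|apply/forall_inP=> y; apply: h].
Qed.

Lemma restr_sym e Y : symmetric e -> symmetric (restr e Y).
Proof. by move=> es x y; rewrite /restr es andbCA. Qed.

Lemma restr_connect_sym e Y : symmetric e -> connect_sym (restr e Y).
Proof. by move=> es; apply/sym_connect_sym/restr_sym. Qed.

Lemma conn_root e Y x : symmetric e ->
  {in Y, forall y, connect (restr e Y) x y} -> conn e Y.
Proof.
move=> es xY; apply/connP=> y z yY zY.
by apply: connect_trans (xY z zY); rewrite restr_connect_sym // xY.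
Qed.

Lemma connect_restrS e X Y x y : X \subset Y ->
  connect (restr e X) x y -> connect (restr e Y) x y.
Proof.
move=> /subsetP XY; apply: connect_sub => u v /and3P[uX vX euv].
by apply: connect1; rewrite /restr !XY.
Qed.

(** An edge that disappears joined two neighbours of [v], and the path through [v] replaces it. *)
Lemma conn_lc e Y v : is_graph e -> v \in Y -> conn e Y -> conn (lc e v) Y.
Proof.
move=> [es ei] vY /connP cY; apply/connP=> x y xY yY.
apply: connect_sub (cY x y xY yY) => a b /and3P[aY bY eab].
have E c : lc e v v c = e v c by rewrite /lc ei /= andbF addbF.
have [vab|vab] := boolP (e v a && e v b); last first.
  by apply: connect1; rewrite /restr aY bY /lc eab (negbTE vab) andbF.
case/andP: vab => va vb; apply: (@connect_trans _ _ v); apply: connect1.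
  by rewrite /restr aY vY (lc_graph v (conj es ei)).1 E.
by rewrite /restr bY vY E.
Qed.

Lemma conn_reach e e' Y : is_graph e -> conn e Y -> reach Y e e' -> conn e' Y.
Proof.
move=> ge cY r; suff [] : is_graph e' /\ conn e' Y by [].
move: e' r; apply: reach_ind => // d v vY [gd cd].
by split; [apply: lc_graph|apply: conn_lc].
Qed.

Definition has_path n e Y := exists u : 'I_n -> V,
  [/\ injective u, forall i, u i \in Y & forall i j, e (u i) (u j) = path_graph_rel i j].

Lemma has_pathS n e X Y : X \subset Y -> has_path n e X -> has_path n e Y.
Proof. by move=> /subsetP XY [u [ui uX ue]]; exists u; split=> // i; apply: XY. Qed.

Fixpoint ball e Y (x : V) k : {set V} :=
  if k is k'.+1 then
    ball e Y x k' :|: [set v in Y | [exists u in ball e Y x k', e u v]]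
  else [set x].

Lemma ball_le e Y x j k : j <= k -> ball e Y x j \subset ball e Y x k.
Proof.
elim: k => [|k IH]; first by rewrite leqn0 => /eqP->.
rewrite leq_eqVlt => /predU1P[-> //|/IH s]; exact: subset_trans s (subsetUl _ _).
Qed.

Lemma ball_step e Y x k u v : u \in ball e Y x k -> v \in Y -> e u v ->
  v \in ball e Y x k.+1.
Proof.
move=> uB vY euv; apply/setUP; right; rewrite inE vY.
by apply/exists_inP; exists u.
Qed.

Lemma connect_ball e Y x y : connect (restr e Y) x y -> exists k, y \in ball e Y x k.
Proof.
case/connectP=> p; elim/last_ind: p y => [|p z IH] y /=.
  by move=> _ ->; exists 0; rewrite inE.
rewrite rcons_path last_rcons => /andP[pp /and3P[_ zY ez]] ->.
by have [k yk] := IH _ pp erefl; exists k.+1; apply: ball_step ez.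
Qed.

Lemma geodesic e Y x k v : x \in Y -> v \in ball e Y x k ->
  (forall j, j < k -> v \notin ball e Y x j) ->
  exists u : nat -> V, [/\ u 0 = x, u k = v,
    forall i, i <= k -> [/\ u i \in Y, u i \in ball e Y x i
      & forall j, j < i -> u i \notin ball e Y x j]
  & forall i, i < k -> e (u i) (u i.+1)].
Proof.
move=> xY; elim: k v => [|k IH] v.
  rewrite inE => /eqP-> _; exists (fun=> x); split=> // i; rewrite leqn0 => /eqP->.
  by rewrite inE eqxx.
move=> vB vN; have := vB; rewrite [ball _ _ _ _]/= inE (negbTE (vN k (ltnSn k))) /=.
rewrite inE => /andP[vY /exists_inP[w wB ewv]].
have [|u [u0 uk uB ue]] := IH w wB.
  move=> j jk; apply: contra (vN j.+1 jk) => wj; exact: ball_step wj vY ewv.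
exists (fun i => if i <= k then u i else v); split=> //.
- by rewrite ltnn.
- move=> i ik; have [ik'|ki] := leqP i k; first exact: uB.
  by have -> : i = k.+1 by apply/eqP; rewrite eqn_leq ik.
- move=> i; rewrite ltnS => ik; rewrite ik; have [ik'|ki] := leqP i.+1 k; first exact: ue.
  by have -> : i = k by [apply/eqP; rewrite eqn_leq ik -ltnS]; rewrite uk.
Qed.

Lemma geodesic_path e Y x k v n : is_graph e -> x \in Y -> v \in ball e Y x k ->
  (forall j, j < k -> v \notin ball e Y x j) -> n <= k.+1 -> has_path n e Y.
Proof.
move=> [es ei] xY vB vN nk; have [u [_ _ uB ue]] := geodesic xY vB vN.
have lt_k (i : 'I_n) : i <= k by rewrite -ltnS; apply: leq_trans (ltn_ord i) nk.
have far i j : i.+1 < j -> j <= k -> e (u i) (u j) = false.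
  move=> ij jk; apply/negbTE/negP => euij; have [uY _ /(_ _ ij)/negP] := uB j jk; apply.
  by apply: ball_step euij => //; case: (uB i); rewrite // (leq_trans (ltnW (ltnW ij))).
exists (fun i : 'I_n => u i); split=> [i j uij|i|i j]; last 1 first.
- rewrite /path_graph_rel /=.
  wlog ij : i j / i <= j.
    by move=> IH; case/orP: (leq_total i j) => [/IH //|/IH]; rewrite es orbC.
  rewrite [j.+1 == i]gtn_eqF ?ltnS // orbF.
  move: ij; rewrite leq_eqVlt => /predU1P[/val_inj ->|]; first by rewrite ei gtn_eqF.
  rewrite leq_eqVlt => /predU1P[ij|ij].
    by rewrite -ij eqxx; apply: ue; rewrite ij.
  by rewrite far // (ltn_eqF ij).
- apply/val_inj => /=; apply/eqP; have [lt|lt|//] := ltngtP i j.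
    have [_ _ /(_ _ lt)] := uB j (lt_k j); rewrite -uij.
    by have [_ -> _] := uB i (lt_k i).
  have [_ _ /(_ _ lt)] := uB i (lt_k i); rewrite uij.
  by have [_ -> _] := uB j (lt_k j).
- by case: (uB i (lt_k i)).
Qed.

(** Geodesics are induced paths, so a vertex far from [x] yields a long one. *)
Lemma path_or_ball e Y x n : is_graph e -> conn e Y -> x \in Y ->
  has_path n e Y \/ {in Y, forall y, exists2 k, k < n & y \in ball e Y x k /\
                                    forall j, j < k -> y \notin ball e Y x j}.
Proof.
move=> ge /connP cY xY.
have [hp|nhp] := pselect (has_path n e Y); [by left|right].
move=> y yY; have ex := connect_ball (cY x y xY yY).
case: (ex_minnP ex) => k yk kmin.
have yN j : j < k -> y \notin ball e Y x j.
  by rewrite ltnNge; apply: contra => /kmin.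
exists k; last by [].
by rewrite ltnNge; apply/negP => nk; apply: nhp; apply: geodesic_path yk yN _ => //; apply: leqW.
Qed.

Lemma short_connection e Y x y k : is_graph e -> x \in Y -> y \in ball e Y x k ->
  (forall j, j < k -> y \notin ball e Y x j) ->
  exists P : {set V}, [/\ P \subset Y, x \in P, y \in P, #|P| <= k.+1
    & {in P, forall v, connect (restr e P) x v}].
Proof.
move=> ge xY yB yN; have [u [u0 uk uB ue]] := geodesic xY yB yN.
exists [set u (val i) | i : 'I_k.+1]; split.
- by apply/subsetP=> _ /imsetP[i _ ->]; case: (uB i (ltn_ord i)).
- by apply/imsetP; exists ord0.
- by apply/imsetP; exists ord_max.
- by apply: leq_trans (leq_imset_card _ _) _; rewrite card_ord.
- set P := [set _ | _ in _]; have uP i : i <= k -> u i \in P.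
    by rewrite -ltnS => ik; apply/imsetP; exists (Ordinal ik).
  move=> _ /imsetP[[i ik] _ ->] /=; elim: i ik => [|i IH] ik; first by rewrite u0.
  apply: connect_trans (IH (ltnW ik)) _; apply: connect1.
  by rewrite /restr !uP ?ue //; apply: ltnW.
Qed.

(** Take [k] of the rows and, for each ordered pair of them, one separating column. Joining these at
    most [k + k * k] vertices to a common root by geodesics of at most [n] vertices gives [T]. *)
Lemma bounded_connected e (K R C : {set V}) n k : is_graph e -> conn e K ->
  R \subset K -> C \subset K -> sep e R C -> k <= #|R| -> 0 < k ->
  has_path n e K \/ exists (T R' C' : {set V}), [/\ [/\ T \subset K, conn e T & #|T| <= (k + k * k) * n],
     [/\ R' \subset R, C' \subset C, R' \subset T & C' \subset T], sep e R' C' & k = #|R'|].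
Proof.
move=> ge cK RK CK sp kR k0.
have [R' R'R kR'] : exists2 R' : {set V}, R' \subset R & #|R'| = k.
  have := kR; rewrite -bin_gt0 -cards_draws card_gt0 => /set0Pn[R'].
  by rewrite inE => /andP[? /eqP ?]; exists R'.
have /card_gt0P[x xR'] : 0 < #|R'| by rewrite kR'.
have xK : x \in K by apply/(subsetP RK)/(subsetP R'R).
have [hp|sh] := path_or_ball n ge cK xK; [by left|right].
have /choice [col colP] (p : V * V) : exists y, p.1 \in R' -> p.2 \in R' -> p.1 != p.2 ->
    y \in C /\ e p.1 y != e p.2 y.
  have [/and3P[p1 p2 p12]|h] := boolP [&& p.1 \in R', p.2 \in R' & p.1 != p.2].
    by have [y yC ne] := sp _ _ (subsetP R'R _ p1) (subsetP R'R _ p2) p12; exists y.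
  by exists p.1 => p1 p2 p12; rewrite p1 p2 p12 in h.
pose C' := [set col p | p in [set p : V * V | [&& p.1 \in R', p.2 \in R' & p.1 != p.2]]].
have C'C : C' \subset C.
  apply/subsetP=> y /imsetP[p + yE]; rewrite inE => /and3P[a b c].
  by rewrite yE; case: (colP p a b c).
have sp' : sep e R' C'.
  move=> u v uR vR uv; have [] := colP (u, v) uR vR uv => _ ne.
  by exists (col (u, v)) => //; apply: imset_f; rewrite inE uR vR uv.
have cC' : #|C'| <= k * k.
  apply: leq_trans (leq_imset_card _ _) _; rewrite -kR' -cardsX.
  by apply/subset_leq_card/subsetP=> p; rewrite !inE => /and3P[-> -> _].
have /choice [P PP] (y : V) : exists P : {set V}, y \in K -> [/\ P \subset K, x \in P,
    y \in P, #|P| <= n & {in P, forall v, connect (restr e P) x v}].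
  have [yK|] := boolP (y \in K); last by exists set0.
  have [j jn [yB yN]] := sh y yK.
  have [P [P1 P2 P3 P4 P5]] := short_connection ge xK yB yN.
  by exists P; split=> //; apply: leq_trans P4 jn.
have inK y : y \in R' :|: C' -> y \in K.
  by case/setUP=> [/(subsetP R'R)/(subsetP RK)|/(subsetP C'C)/(subsetP CK)].
pose T := \bigcup_(y in R' :|: C') P y.
have inT y : y \in R' :|: C' -> y \in T.
  by move=> yS; apply/bigcupP; exists y => //; case: (PP y (inK y yS)).
exists T, R', C'; split=> //; split=> //.
- by apply/bigcupsP=> y yS; case: (PP y (inK y yS)).
- apply: (@conn_root _ _ x ge.1) => v /bigcupP[y yS vP].
  have [_ _ _ _ /(_ v vP)] := PP y (inK y yS).
  by apply: connect_restrS; apply: bigcup_sup.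
- apply: leq_trans (card_bigcup_le (k := n) _) _.
    by move=> y yS; case: (PP y (inK y yS)).
  rewrite leq_mul2r (leq_trans (leq_card_setU _ _)) ?orbT // kR'.
  by rewrite leq_add2l.
- by apply/subsetP=> y yR; apply: inT; rewrite inE yR.
- by apply/subsetP=> y yR; apply: inT; rewrite inE yR orbT.
Qed.

Definition has_hub w e T := exists c F, [/\ c \in T, ends F \subset T, clean e F,
  c \notin ends F & w <= #|F| /\ {in F, forall p, e c p.1 || e c p.2}].

Lemma card_ball e Y x D k : {in Y, forall v, #|[set u in Y | e v u]| <= D} -> x \in Y ->
  ball e Y x k \subset Y /\ #|ball e Y x k| <= D.+1 ^ k.
Proof.
move=> deg xY; elim: k => [|k [sB cB]]; first by rewrite sub1set cards1.
rewrite /= subUset sB; split.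
  by apply/subsetP=> v; rewrite inE => /andP[].
apply: leq_trans (leq_card_setU _ _) _; rewrite expnS mulSn leq_add //.
have sub : [set v in Y | [exists u in ball e Y x k, e u v]] \subset
   \bigcup_(u in ball e Y x k) [set v in Y | e u v].
  apply/subsetP=> v; rewrite inE => /andP[vY /exists_inP[u uB euv]].
  by apply/bigcupP; exists u => //; rewrite inE vY.
apply: leq_trans (subset_leq_card sub) _.
apply: leq_trans (card_bigcup_le (k := D) _) _; last by rewrite mulnC leq_mul2l cB orbT.
by move=> u /(subsetP sB)/deg.
Qed.

(** If every neighbour of [y] could be reached from [x] without [y], then [y] together with the
    component of [x] would be closed under adjacency, and [Y :\ y] would be connected. *)
Lemma cutvertex e Y x y : is_graph e -> conn e Y -> ~~ conn e (Y :\ y) ->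
  x \in Y -> y \in Y -> e x y ->
  exists z, [/\ z \in Y, z != y, e y z & ~~ connect (restr e (Y :\ y)) x z].
Proof.
move=> ge /connP cY ncY xY yY exy.
have [/exists_inP[z zY /and3P[]]|none] := boolP [exists z in Y,
  [&& z != y, e y z & ~~ connect (restr e (Y :\ y)) x z]]; first by exists z.
case/negP: ncY; apply: (@conn_root _ _ x ge.1) => v /setD1P[vy vY].
pose Q := [set u | (u == y) || connect (restr e (Y :\ y)) x u].
have Qcl u v' : u \in Q -> restr e Y u v' -> v' \in Q.
  rewrite !inE => uQ /and3P[uY v'Y eu]; have [//|v'y] := eqVneq v' y.
  case/orP: uQ => [/eqP uy|cu].
    move: none; rewrite negb_exists_in => /forall_inP/(_ v' v'Y).
    by rewrite uy in eu; rewrite v'y eu negbK.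
  have [uy|uy] := eqVneq u y.
    move: none; rewrite negb_exists_in => /forall_inP/(_ v' v'Y).
    by rewrite uy in eu; rewrite v'y eu negbK.
  by apply: connect_trans cu (connect1 _); rewrite /restr !inE uy v'y uY v'Y.
have : v \in Q.
  have clos p u : path (restr e Y) u p -> u \in Q -> last u p \in Q.
    by elim: p u => //= u' p IH u /andP[uu' pp] uQ; apply: IH pp (Qcl _ _ uQ uu').
  case/connectP: (cY x v xY vY) => p pp ->; apply: clos pp _.
  by rewrite inE connect0 orbT.
by rewrite inE (negbTE vy).
Qed.

Definition nbrs e Y (x : V) : {set V} := [set y in Y | e x y].

Lemma nbrsE e Y x y : (y \in nbrs e Y x) = (y \in Y) && e x y.
Proof. by rewrite inE. Qed.

(** Each cutvertex [y] next to [x] has a neighbour [z y] that [y] separates from [x]; hence [z y]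
    sees neither [x], nor another [y'], nor another [z y']. By Ramsey the chosen [y] form a clique
    or an independent set, and complementing at [x] turns a clique into an independent set without
    touching any [z y]. The Ramsey bound is a hypothesis because it is fixed before [V]. *)
Lemma cutvertex_hub e (X Y : {set V}) x w N :
  (forall (e0 : rel V) (A : {set V}), symmetric e0 -> N <= #|A| ->
     exists2 B : {set V}, B \subset A /\ w <= #|B| &
     exists b, {in B &, forall u v, u != v -> e0 u v = b}) ->
  is_graph e -> conn e Y -> x \in Y -> X \subset Y ->
  {in X, forall y, ~~ conn e (Y :\ y)} -> N <= #|nbrs e X x| ->
  exists2 e', reach Y e e' & has_hub w e' Y.
Proof.
move=> ram ge cY xY XY cut /(ram e _ ge.1)[B [BN wB] [b hB]].
have [es ei] := ge.
have BP y : y \in B -> [/\ y \in X, e x y, y \in Y & x != y].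
  move/(subsetP BN); rewrite inE => /andP[yX exy]; split=> //; first exact: (subsetP XY).
  by apply: contraTneq exy => ->; rewrite ei.
have /choice [z zP] (y : V) : exists z, y \in B ->
    [/\ z \in Y, z != y, e y z & ~~ connect (restr e (Y :\ y)) x z].
  have [yB|] := boolP (y \in B); last by exists x.
  have [yX exy yY _] := BP y yB.
  by have [z zP] := cutvertex ge cY (cut y yX) xY yY exy; exists z.
have step y u v : y \in B -> u \in Y -> v \in Y -> u != y -> v != y -> e u v ->
    connect (restr e (Y :\ y)) x u -> connect (restr e (Y :\ y)) x v.
  move=> yB uY vY uy vy euv cu; apply: connect_trans cu (connect1 _).
  by rewrite /restr !inE uy vy uY vY.
have near y : y \in B -> e x (z y) = false.
  move=> yB; have [zY zy eyz /negP nc] := zP y yB; have [_ _ _ xy] := BP y yB.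
  by apply/negbTE/negP => exz; apply: nc; apply: (step y x) => //; apply: connect0.
have reach' y y' : y \in B -> y' \in B -> y != y' -> connect (restr e (Y :\ y)) x y'.
  move=> yB y'B yy'; have [_ _ _ xy] := BP y yB; have [_ exy' y'Y _] := BP y' y'B.
  by apply: (step y x) => //; rewrite ?connect0 // eq_sym.
have cross y y' : y \in B -> y' \in B -> y != y' -> e y' (z y) = false.
  move=> yB y'B yy'; have [zY zy eyz /negP nc] := zP y yB; have [_ _ y'Y _] := BP y' y'B.
  apply/negbTE/negP => ez; apply: nc; apply: (step y y') => //; first by rewrite eq_sym.
  exact: reach'.
have zB y y' : y \in B -> y' \in B -> z y' != y.
  move=> yB y'B; have [zY zy eyz nc] := zP y' y'B.
  have [<- //|ny] := eqVneq y' y.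
  by apply: contraNneq nc => ->; apply: reach'.
have zz y y' : y \in B -> y' \in B -> y != y' -> e (z y) (z y') = false.
  move=> yB y'B yy'; have [zY zy eyz /negP nc] := zP y yB.
  have [z'Y z'y e'yz _] := zP y' y'B; have [_ _ y'Y _] := BP y' y'B.
  apply/negbTE/negP => ez; apply: nc; apply: (step y (z y')) => //; rewrite ?zB 1?es //.
  by apply: (step y y') => //; rewrite ?zB 1?eq_sym //; apply: reach'; rewrite // eq_sym.
pose e' := if b then lc e x else e.
exists e'; first by rewrite /e'; case: (b); [apply: reach_lc|apply: reach_refl].
have e'z u y : y \in B -> e' u (z y) = e u (z y).
  by move=> yB; rewrite /e'; case: (b); rewrite // /lc near // !andbF addbF.
have ge' : is_graph e' by rewrite /e'; case: (b); [apply: lc_graph|].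
have e'x u : e' x u = e x u.
  by rewrite /e'; case: (b); rewrite // /lc ei /= andbF addbF.
have e'B y y' : y \in B -> y' \in B -> e' y y' = false.
  move=> yB y'B; have [->|yy'] := eqVneq y y'; first by rewrite ge'.2.
  have [_ exy _ _] := BP y yB; have [_ exy' _ _] := BP y' y'B.
  by rewrite /e'; case: (b) (hB y y' yB y'B yy') => E; rewrite // /lc E yy' exy exy'.
exists x, [set (y, z y) | y in B]; split=> //.
- apply/subsetP=> v /endsP[_ /imsetP[y yB ->] [] -> /=]; first by case: (BP y yB).
  by case: (zP y yB).
- move=> _ _ /imsetP[y yB ->] /imsetP[y' y'B ->] /=; rewrite e'z // e'B // e'z //.
  have [_ _ eyz _] := zP y yB.
  have [<-|yy'] := eqVneq y y'; first by rewrite eyz eqxx ei.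
  have y'y : y' != y by rewrite eq_sym.
  by rewrite (cross y' y) // zz // xpair_eqE (negbTE yy').
- apply/negP=> /endsP[_ /imsetP[y yB ->] [] /= xE].
    by have [_ _ _] := BP y yB; rewrite -xE eqxx.
  have [zY zy eyz] := zP y yB; rewrite -xE => /negP[]; exact: connect0.
- split; first by rewrite card_imset // => y y' [].
  by move=> _ /imsetP[y yB ->] /=; rewrite e'x; case: (BP y yB) => _ ->.
Qed.

Lemma clean_nbrs e F p v : is_graph e -> clean e F -> p \in F ->
  (v = p.1 \/ v = p.2) -> #|nbrs e (ends F) v| <= 1.
Proof.
move=> [es ei] cF pF vp.
suff [u uP] : exists u, nbrs e (ends F) v \subset [set u].
  by rewrite -(cards1 u); apply: subset_leq_card.
case: vp => ->.
  exists p.2; apply/subsetP=> u; rewrite nbrsE => /andP[/endsP[q qF [] ->]]; rewrite inE.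
    by have [_ -> _] := cF p q pF qF.
  by have [-> _ _] := cF p q pF qF => /eqP->.
exists p.1; apply/subsetP=> u; rewrite nbrsE => /andP[/endsP[q qF [] ->]]; rewrite inE.
  by rewrite es; have [-> _ _] := cF q p qF pF => /eqP->.
by have [_ _ ->] := cF p q pF qF.
Qed.

Lemma card_ends_clean e F : clean e F -> #|F| <= #|ends F|.
Proof.
move=> cF; rewrite -(card_in_imset (f := fun p => p.1) (D := F)).
  by apply/subset_leq_card/subsetP=> _ /imsetP[p pF ->]; apply: ends1.
move=> p q pF qF pq; have := clean_edge cF qF; rewrite -pq.
by have [-> _ _] := cF p q pF qF => /eqP.
Qed.

End Connectivity.

(* In a minimal connected [Y] containing the matching, the vertices outside it
   are cutvertices.  A vertex with many of them as neighbours is a hub; if there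
   is no hub then [Y] has bounded degree, hence a long induced path. *)
Lemma connected_hub n w : exists k, forall (V : finType) (e : rel V) (T R C : {set V}),
  is_graph e -> conn e T -> R \subset T -> C \subset T -> [disjoint R & C] ->
  sep e R C -> k <= #|R| ->
  exists2 e', reach T e e' & has_path n e' T \/ has_hub w e' T.
Proof.
have [N ram] := ramsey w.
(* A degree bound when there is no hub: fewer than [N] neighbours outside the matching; inside it,
   at most one for an end of [F] and at most [2 * w] for any other vertex, which sees fewer than [w]
   edges. The next constant makes [F] larger than a ball of radius [n]. *)
pose D := N + (2 * w).+1.
have [k kP] := sep_matching (D.+1 ^ n).+1.
exists k => V e T R C ge cT RT CT RC sp kR.
have RCT : R :|: C \subset T by rewrite subUset RT.
have [e1 [F [re1 cF eF qF]]] := kP V e R C ge RC sp kR.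
have g1 := reach_graph ge re1.
have {}re1 := reach_sub RCT re1; have {}eF := subset_trans eF RCT.
have c1 := conn_reach ge cT re1.
pose good (Y : {set V}) := [&& ends F \subset Y, Y \subset T & conn e1 Y].
have goodT : good T by rewrite /good eF subxx.
case: (arg_minnP (fun Y : {set V} => #|Y|) goodT) => Y /and3P[FY YT cY] Ymin.
suff [e2 re2 [hp|hh]] : exists2 e2, reach Y e1 e2 & has_path n e2 Y \/ has_hub w e2 Y.
- exists e2; first by apply: reach_trans re1 (reach_sub YT re2).
  by left; apply: has_pathS hp.
- exists e2; first by apply: reach_trans re1 (reach_sub YT re2).
  right; have [c [F' [cT' F'Y cF' cn wF]]] := hh.
  by exists c, F'; split=> //; [apply: (subsetP YT)|apply: subset_trans YT].
have cut : {in Y :\: ends F, forall y, ~~ conn e1 (Y :\ y)}.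
  move=> y /setDP[yY yF]; apply/negP => cy.
  have : good (Y :\ y).
    rewrite /good cy andbT (subset_trans (subsetDl _ _) YT) andbT.
    apply/subsetP=> u uF; rewrite !inE (subsetP FY _ uF) andbT.
    by apply: contraNneq yF => <-.
  by move/Ymin; rewrite (cardsD1 y Y) yY ltnn.
case: (boolP [exists x in Y, N <= #|nbrs e1 (Y :\: ends F) x|]) => [|small].
  case/exists_inP=> x xY Nx.
  have [e2 re2 hh] := cutvertex_hub (ram V) g1 cY xY (subsetDl _ _) cut Nx.
  by exists e2; last right.
pose Fx x := [set p in F | e1 x p.1 || e1 x p.2].
case: (boolP [exists x in Y :\: ends F, w <= #|Fx x|]) => [|small2].
  case/exists_inP=> x /setDP[xY xF] wx; exists e1; [exact: reach_refl|right].
  have FxF : Fx x \subset F by apply/subsetP=> p; rewrite inE => /andP[].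
  exists x, (Fx x); split=> //.
  - exact: subset_trans (endsS FxF) FY.
  - exact: cleanS FxF cF.
  - by apply: contra xF; apply: (subsetP (endsS FxF)).
  - by split=> // p; rewrite inE => /andP[].
exists e1; [exact: reach_refl|left].
have deg : {in Y, forall v, #|[set u in Y | e1 v u]| <= D}.
  move=> v vY; rewrite -(cardsID (ends F)) addnC leq_add //.
    apply: leq_trans (_ : #|nbrs e1 (Y :\: ends F) v| <= _).
      by apply: subset_leq_card; apply/subsetP=> u; rewrite !inE => /and3P[-> -> ->].
    move: small; rewrite negb_exists_in => /forall_inP/(_ v vY).
    by rewrite -ltnNge => /ltnW.
  have [vF|vF] := boolP (v \in ends F).
    have /endsP[p pF vp] := vF; apply: leq_trans (_ : 1 <= _) => //.
    apply: leq_trans (clean_nbrs g1 cF pF vp); apply: subset_leq_card.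
    by apply/subsetP=> u; rewrite !inE => /andP[/andP[_ ->] ->].
  apply: leq_trans (_ : #|ends (Fx v)| <= _).
    apply: subset_leq_card; apply/subsetP=> u; rewrite inE => /andP[].
    rewrite inE => /andP[uY evu] /endsP[p pF up]; apply/endsP; exists p => //.
    by rewrite inE pF; case: up evu => -> ->; rewrite ?orbT.
  apply: leq_trans (card_ends _) _; apply: leqW; rewrite leq_mul2l /=.
  move: small2; rewrite negb_exists_in => /forall_inP/(_ v).
  by rewrite inE vF vY -ltnNge => /(_ isT)/ltnW.
have /card_gt0P[x xY] : 0 < #|Y|.
  apply: leq_trans (subset_leq_card FY); apply: leq_trans (card_ends_clean cF).
  exact: leq_trans qF.
have [//|near] := path_or_ball n g1 cY xY.
have : Y \subset ball e1 Y x n.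
  apply/subsetP=> y /near[j jn [yB _]].
  exact: (subsetP (ball_le _ _ _ (ltnW jn))).
move/subset_leq_card; have [_ cB] := card_ball n deg xY.
move/leq_trans/(_ cB); rewrite leqNgt => /negP[].
apply: leq_trans qF _; apply: leq_trans (card_ends_clean cF) _.
exact: subset_leq_card.
Qed.

Lemma bounded_connected_hub n w : exists k t, forall (V : finType) (e : rel V) (K R C : {set V}),
  is_graph e -> conn e K -> R \subset K -> C \subset K -> [disjoint R & C] ->
  sep e R C -> k <= #|R| ->
  exists2 T : {set V}, T \subset K /\ #|T| <= t &
  exists2 e', reach T e e' & has_path n e' T \/ has_hub w e' T.
Proof.
have [k kP] := connected_hub n w.
exists k.+1, (maxn n ((k.+1 + k.+1 * k.+1) * n)) => V e K R C ge cK RK CK RC sp kR.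
have [hp|[T [R' [C' [[TK cT tT] [R'R C'C R'T C'T] sp' kR']]]]] :=
    bounded_connected n ge cK RK CK sp kR isT.
  have [u [ui uK ue]] := hp.
  exists [set u i | i : 'I_n].
    split; first by apply/subsetP=> _ /imsetP[i _ ->].
    by apply: leq_trans (leq_imset_card _ _) _; rewrite card_ord leq_maxl.
  exists e; [exact: reach_refl|left].
  by exists u; split=> // i; apply: imset_f.
exists T; first by split=> //; apply: leq_trans tT (leq_maxr _ _).
apply: (kP V e T R' C') => //; last by rewrite -kR'.
exact: disjointWl R'R (disjointWr C'C RC).
Qed.

(** * Hubs over an induced matching *)


Section Legs.
Variable V : finType.
Implicit Types (e d : rel V) (S T H X Y Z D : {set V}) (F : {set V * V}).

Definition leg_end (p : V * V) (y y' : V) :=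
  (y = p.1 /\ y' = p.2) \/ (y = p.2 /\ y' = p.1).

Lemma leg_end_edge e F p y y' : is_graph e -> clean e F -> p \in F ->
  leg_end p y y' -> [/\ e y y', y \in ends F & y' \in ends F].
Proof.
move=> [es ei] cF pF; have := clean_edge cF pF => ep.
by case=> -[-> ->]; rewrite ?ends1 ?ends2 // es.
Qed.

Lemma clean_other e F p y y' v : is_graph e -> clean e F -> p \in F ->
  leg_end p y y' -> v \in ends (F :\ p) ->
  [/\ e v y = false, e v y' = false, v != y & v != y'].
Proof.
move=> ge cF pF yy' /endsP[q /setD1P[qp qF] vq].
have [es ei] := ge; have [eyy' _ _] := leg_end_edge ge cF pF yy'.
have pq : p != q by rewrite eq_sym.
have ev : e v p.1 = false /\ e v p.2 = false.
  have [E1 E2 E3] := cF p q pF qF; have [G1 G2 G3] := cF q p qF pF.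
  by case: vq => ->; rewrite ?E1 ?E2 ?E3 ?G1 ?G2 ?G3 ?(negbTE qp) // es E1 (negbTE pq).
have evy : e v y = false by case: yy' => -[-> _]; case: ev.
have evy' : e v y' = false by case: yy' => -[_ ->]; case: ev.
split=> //; first by apply: contraFneq evy' => ->.
by apply: contraFneq evy => ->; rewrite es.
Qed.

(** Ends of other edges of [F] are not adjacent to [y], so over the rest of [F] one of the two
    correction terms vanishes: the pivot adds the row of [c] to the rows of the neighbours of
    [y]. *)
Lemma pivot_leg e F p y y' c : is_graph e -> clean e F -> p \in F -> leg_end p y y' ->
  c \notin ends F -> e c y ->
  exists e1, [/\ reach setT e e1, is_graph e1, clean e1 (F :\ p),
    {in [set~ c] :&: [set~ y] &, forall u v,
      e1 u v = e u v (+) (e u c && e v y) (+) (e u y && e v c)} &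
    forall u v, u != c -> u != y -> v \in ends (F :\ p) ->
      e1 u v = e u v (+) (e u y && e c v)].
Proof.
move=> ge cF pF yy' cn ecy; have [es ei] := ge.
have [e1 [re1 g1 e1E]] := pivotP ge ecy.
have inF v : v \in ends (F :\ p) -> v \in [set~ c] :&: [set~ y].
  move=> vF; have [_ _ vy _] := clean_other ge cF pF yy' vF.
  rewrite !inE vy andbT; apply: contraNneq cn => <-.
  exact: (subsetP (endsS (subsetDl _ _))) vF.
have e1E' : forall u v, u != c -> u != y -> v \in ends (F :\ p) ->
      e1 u v = e u v (+) (e u y && e c v).
  move=> u v uc uy vF; rewrite e1E ?(inF v) //; last by rewrite !inE uc.
  have [vy _ _ _] := clean_other ge cF pF yy' vF.
  by rewrite vy andbF addbF (es v c).
exists e1; split=> //.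
- exact: reach_sub (subsetT _) re1.
- have old u v : u \in ends (F :\ p) -> v \in ends (F :\ p) -> e1 u v = e u v.
    move=> uF vF; have := inF u uF; rewrite !inE => /andP[uc uy]; rewrite e1E' //.
    by have [-> _ _ _] := clean_other ge cF pF yy' uF; rewrite addbF.
  move=> q r qF rF; rewrite !old ?ends1 ?ends2 //.
  by apply: (cleanS (subsetDl F [set p]) cF).
Qed.

Definition psum e X (y : V) : bool := \big[addb/false]_(h in X) e h y.

(** The bilinear form of the adjacency matrix over F_2, at the characteristic vectors of [X] and
    [Z]. *)
Definition bsum e X Z : bool := \big[addb/false]_(v in Z) psum e X v.

Lemma psum0 e y : psum e set0 y = false.
Proof. exact: big_set0. Qed.

Lemma psum1 e x y : psum e [set x] y = e x y.
Proof. exact: big_set1. Qed.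

Lemma psumU1 e x X y : x \notin X -> psum e (x |: X) y = e x y (+) psum e X y.
Proof. by move=> xX; rewrite /psum big_setU1. Qed.

Lemma psumD1 e x X y : x \in X -> psum e X y = e x y (+) psum e (X :\ x) y.
Proof. by move=> xX; rewrite {1}/psum (big_setD1 x). Qed.

Lemma bsum1 e X z : bsum e X [set z] = psum e X z.
Proof. exact: big_set1. Qed.

Lemma bsumE e X Z : bsum e X Z = \big[addb/false]_(u in X) \big[addb/false]_(v in Z) e u v.
Proof. by rewrite /bsum /psum exchange_big. Qed.

Lemma bsum_sym e X Z : symmetric e -> bsum e X Z = bsum e Z X.
Proof.
move=> es; rewrite bsumE /bsum; apply: eq_bigr => u _.
by apply: eq_bigr => v _; rewrite es.
Qed.

Lemma bsumU1r e X z Z : z \notin Z -> bsum e X (z |: Z) = psum e X z (+) bsum e X Z.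
Proof. by move=> zZ; rewrite /bsum big_setU1. Qed.

Lemma bsumU1l e x X Z : symmetric e -> x \notin X ->
  bsum e (x |: X) Z = psum e Z x (+) bsum e X Z.
Proof. by move=> es xX; rewrite bsum_sym // bsumU1r // [bsum e Z X]bsum_sym. Qed.

(** A symmetric matrix with zero diagonal defines an alternating form in characteristic two. This
    makes the perturbed graph irreflexive. *)
Lemma bsum_alt e Z : is_graph e -> bsum e Z Z = false.
Proof.
move=> [es ei]; move: {2}#|Z| (leqnn #|Z|) => n; elim: n Z => [|n IH] Z.
  by rewrite leqn0 cards_eq0 => /eqP->; rewrite /bsum big_set0.
have [->|[a aZ]] := set_0Vmem Z; first by move=> _; rewrite /bsum big_set0.
rewrite (cardsD1 a) aZ ltnS => /IH E.
rewrite -(setD1K aZ) bsumU1r ?bsumU1l ?psumU1 ?ei ?E //; rewrite ?inE ?eqxx //.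
by rewrite addbF addbb.
Qed.

Lemma psum_pivot e e1 Z c y v :
  {in Z, forall u, e1 u v = e u v (+) (e u y && e c v)} ->
  psum e1 Z v = psum e Z v (+) (psum e Z y && e c v).
Proof.
move=> h; rewrite /psum (eq_bigr _ h) big_split /=; congr (_ (+) _).
by rewrite big_distrl.
Qed.

Lemma bsum_pivot e e1 c y Z Z' :
  {in Z & Z', forall u v, e1 u v = e u v (+) (e u c && e v y) (+) (e u y && e v c)} ->
  bsum e1 Z Z' =
    bsum e Z Z' (+) (psum e Z c && psum e Z' y) (+) (psum e Z y && psum e Z' c).
Proof.
move=> h; rewrite /bsum.
transitivity (\big[addb/false]_(v in Z')
   (psum e Z v (+) (psum e Z c && e v y) (+) (psum e Z y && e v c))).
  apply: eq_bigr => v vZ; rewrite /psum !big_distrl /= -!big_split /=.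
  by apply: eq_bigr => u uZ; rewrite h.
by rewrite !big_split /= -!big_distrr.
Qed.

Definition touch e X F := [set p in F | psum e X p.1 || psum e X p.2].

(* The rows of [H] over [F] stay linearly independent as long as fewer than [w]
   edges of [F] are deleted. *)
Definition state e F H w :=
  [/\ clean e F, [disjoint H & ends F]
    & forall X : {set V}, X \subset H -> X != set0 -> w <= #|touch e X F|].

(* Pivoting on a hub [c] and an end [y] of an edge [yy'] of [F] gives [y'] the
   row of [c] over [F] and removes [c] from every [s x], while the bilinear form
   on the sums [x + s x] does not change. *)
Lemma pivot_hubs k : forall e F H w T (s : V -> {set V}) D, is_graph e -> state e F H w ->
  D \subset H -> #|D| = k -> k <= w -> [disjoint T & H] -> [disjoint T & ends F] ->
  {in T, forall x, s x \subset D} ->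
  {in T & ends F, forall x v, psum e (x |: s x) v = false} ->
  exists e' F' H', [/\ [/\ reach setT e e', F' \subset F & state e' F' H' (w - k)],
    #|H'| = #|H|, [disjoint T & H'], {in T & ends F', forall x v, e' x v = false}
   & {in T &, forall x z, e' x z = bsum e (x |: s x) (z |: s z)}].
Proof.
elim: k => [|k IH] e F H w T s D ge stF DH cD kw TH TF sD sF; have [es ei] := ge.
  have s0 x : x \in T -> s x = set0.
    move=> xT; apply/eqP; rewrite -subset0; move/eqP: cD; rewrite cards_eq0 => /eqP <-.
    exact: sD.
  exists e, F, H; split=> //; rewrite ?subn0.
  - by split=> //; apply: reach_refl.
  - by move=> x v xT vF; have := sF x v xT vF; rewrite s0 // setU0 psum1.
  - by move=> x z xT zT; rewrite !s0 // !setU0 bsum1 psum1.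
have /card_gt0P[c cD'] : 0 < #|D| by rewrite cD.
have cH := subsetP DH c cD'; have [cF HF wF] := stF.
have cnF : c \notin ends F by rewrite (disjointFr HF).
have /card_gt0P[p] : 0 < #|touch e [set c] F|.
  apply: leq_trans (wF _ _ _); rewrite ?sub1set //; first exact: leq_trans kw.
  by apply/set0Pn; exists c; rewrite inE.
rewrite inE !psum1 => /andP[pF ecp].
have [y [y' [yy' ecy]]] : exists y y', leg_end p y y' /\ e c y.
  by case/orP: ecp => ec; [exists p.1, p.2|exists p.2, p.1]; split=> //; [left|right].
have [e1 [re1 g1 c1 e1E e1F]] := pivot_leg ge cF pF yy' cnF ecy.
have [eyy' yF y'F] := leg_end_edge ge cF pF yy'.
have oth v : v \in ends (F :\ p) -> [/\ e v y = false, e v y' = false, v != y & v != y'].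
  exact: clean_other ge cF pF yy'.
have endsD : {subset ends (F :\ p) <= ends F} by apply/subsetP/endsS/subsetDl.
(* The far end [y'] takes over the row of [c], so it replaces [c] as a hub and the number of hubs is
   preserved. *)
pose H1 := y' |: (H :\ c).
have y'c : y' != c by apply: contraNneq cnF => <-.
have y'y : y' != y by apply: contraTneq eyy' => ->; rewrite ei.
have y'H : y' \notin H :\ c by rewrite !inE (disjointFl HF y'F) andbF.
have HyN h : h \in H -> h != y.
  by move=> hH; apply: contraTneq yF => <-; rewrite (disjointFr HF hH).
have combo X' v : X' \subset H :\ c -> v \in ends (F :\ p) ->
    psum e1 X' v = psum e X' v (+) (psum e X' y && e c v).
  move=> /subsetP XH vF; apply: psum_pivot => u /XH/setD1P[uc uH].
  by apply: e1F => //; apply: HyN.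
have st1 : state e1 (F :\ p) H1 (w - 1).
  split=> //.
    rewrite disjoints_subset subUset sub1set !inE; apply/andP; split.
      by apply/negP=> /oth[_ _ _]; rewrite eqxx.
    apply/subsetP=> h /setD1P[_ hH]; rewrite inE; apply/negP=> /endsD.
    by rewrite (disjointFr HF).
  move=> X XH1 X0; pose X' := X :\ y'.
  have X'H : X' \subset H :\ c.
    by apply/subsetP=> u /setD1P[uy' /(subsetP XH1)]; rewrite in_setU1 (negbTE uy').
  have cX' : c \notin X' by apply/negP=> /(subsetP X'H); rewrite !inE eqxx.
  (* The row of [X] after the pivot is the row of [X2] before it: [c] is added once for each member
     of [X'] adjacent to [y], and once more for [y'], whose new row is that of [c]. *)
  pose b := psum e X' y (+) (y' \in X).
  pose X2 := if b then c |: X' else X'.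
  have X2H : X2 \subset H.
    have sub : X' \subset H by apply: subset_trans X'H (subsetDl _ _).
    by rewrite /X2; case: (b); rewrite // subUset sub1set cH.
  have X20 : X2 != set0.
    rewrite /X2; case E: b; first by apply/set0Pn; exists c; rewrite !inE eqxx.
    apply: contraFneq E => X'0; rewrite /b X'0 psum0.
    case/set0Pn: X0 => u uX; have [<-|uy'] := eqVneq u y'; first by rewrite uX.
    have : u \in X' by rewrite !inE uy'.
    by rewrite X'0 inE.
  have same v : v \in ends (F :\ p) -> psum e1 X v = psum e X2 v.
    move=> vF; have E := combo _ _ X'H vF.
    have -> : psum e X2 v = psum e X' v (+) (b && e c v).
      by rewrite /X2; case: (b); rewrite ?addbF // psumU1 // addbC.
    have [y'X|y'X] := boolP (y' \in X).
      rewrite (psumD1 _ _ y'X) E e1F // (es y' y) eyy' /b y'X.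
      have [_ ey' _ _] := oth v vF; rewrite es ey'.
      by case: (psum e X' v); case: (psum e X' y); case: (e c v).
    have X'E : X' = X.
      by apply/setP=> u; rewrite !inE; case: eqP => // ->; rewrite (negbTE y'X).
    by rewrite X'E in E; rewrite E /b X'E (negbTE y'X) addbF.
  have := wF X2 X2H X20; rewrite (cardsD1 p) => wX.
  rewrite leq_subLR (leq_trans wX) // leq_add ?leq_b1 //.
  apply/subset_leq_card/subsetP=> q; rewrite !inE => /and3P[qp qF tq].
  have qF' : q \in F :\ p by rewrite !inE qp.
  by rewrite qp qF !same ?ends1 ?ends2.
have cH1 : #|H1| = #|H| by rewrite cardsU1 y'H (cardsD1 c H) cH.
pose s1 x := s x :\ c.
have TN x : x \in T -> [/\ x != c, x != y, x \notin ends F & x \notin H].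
  move=> xT; have xH := disjointFr TH xT; have xF := disjointFr TF xT.
  rewrite xH xF; split=> //; first by apply: contraFneq xH => ->.
  by apply: contraFneq xF => ->.
have Zin x u : x \in T -> u \in x |: s1 x -> u != c /\ u != y.
  move=> xT /setU1P[->|]; first by case: (TN x xT).
  case/setD1P=> uc us; split=> //; apply: HyN.
  exact/(subsetP DH)/(subsetP (sD x xT)).
have xs1 x : x \in T -> (c \in s x) -> x |: s x = c |: (x |: s1 x) /\ c \notin x |: s1 x.
  move=> xT cs; have [xc _ _ _] := TN x xT; split; last by rewrite !inE eqxx eq_sym (negbTE xc).
  by rewrite setUCA /s1 setD1K.
have xs0 x : (c \notin s x) -> x |: s1 x = x |: s x.
  move=> cs; congr (_ |: _); apply/setP=> u; rewrite !inE.
  by case: eqP => // ->; rewrite (negbTE cs).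
(* Since [x + s x] vanishes over [F], omitting [c] leaves the row of [c] exactly when [c] belongs to
   [s x]. At [v = y] this is the bit [c \in s x]. *)
have atc x v : x \in T -> v \in ends F -> psum e (x |: s1 x) v = (c \in s x) && e c v.
  move=> xT vF; have := sF x v xT vF; have [cs|cs] := boolP (c \in s x).
    by have [-> cn] := xs1 x xT cs; rewrite psumU1 //=; case: (e c v); case: psum.
  by rewrite xs0.
have [|||||||e' [F' [H' [[re' F'F st'] cH' TH' TF' eT]]]] :=
  IH e1 (F :\ p) H1 (w - 1) T s1 (D :\ c) g1 st1.
- apply/subsetP=> u /setD1P[uc uD]; rewrite !inE uc (subsetP DH) ?orbT //.
- by move: cD; rewrite (cardsD1 c) cD' => -[].
- by rewrite -ltnS subn1 prednK //; apply: leq_trans kw.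
- rewrite disjoint_sym disjoints_subset subUset sub1set !inE; apply/andP; split.
    by rewrite (disjointFl TF y'F).
  by apply/subsetP=> h /setD1P[_ hH]; rewrite inE (disjointFl TH hH).
- by rewrite disjoint_sym disjoints_subset; apply/subsetP=> v /endsD vF; rewrite inE (disjointFl TF vF).
- by move=> x xT; apply: setSD; apply: sD.
- move=> x v xT vF; rewrite (psum_pivot (e := e) (c := c) (y := y)).
    by rewrite (atc x v) ?endsD // (atc x y) // ecy andbT addbb.
  by move=> u uZ; have [uc uy] := Zin x u xT uZ; apply: e1F.
exists e', F', H'; split=> //.
- split; [exact: reach_trans re1 re'|exact: subset_trans F'F (subsetDl _ _)|].
  by move: st'; rewrite -subnDA add1n.
- by rewrite cH'.
move=> x z xT zT; rewrite eT // (bsum_pivot (e := e) (c := c) (y := y)); last first.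
  move=> u v uZ vZ; have [uc uy] := Zin x u xT uZ; have [vc vy] := Zin z v zT vZ.
  by apply: e1E; rewrite !inE ?uc ?vc.
(* The two correction terms of the pivot are the terms that the form loses when [c] is dropped from
   its two arguments; the remaining term [e c c] is zero. *)
rewrite (atc x y) // (atc z y) // ecy !andbT.
have [cx|cx] := boolP (c \in s x); have [cz|cz] := boolP (c \in s z).
- have [-> nx] := xs1 x xT cx; have [-> nz] := xs1 z zT cz.
  rewrite (bsumU1l _ es nx) (bsumU1r _ _ nz) (psumU1 _ _ nz) ei.
  by case: (psum e (x |: s1 x) c); case: (psum e (z |: s1 z) c); case: (bsum _ _ _).
- have [-> nx] := xs1 x xT cx; rewrite (xs0 z) // (bsumU1l _ es nx).
  by case: (psum e (x |: s1 x) c); case: (psum e (z |: s z) c); case: (bsum _ _ _).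
- have [-> nz] := xs1 z zT cz; rewrite (xs0 x) // (bsumU1r _ _ nz).
  by case: (psum e (x |: s x) c); case: (psum e (z |: s1 z) c); case: (bsum _ _ _).
- by rewrite !xs0 // andbF !addbF.
Qed.

End Legs.

(** * Gaining a hub or bounding all cuts *)


Section Step.
Variable V : finType.
Implicit Types (e d : rel V) (S T H X Y Z D : {set V}) (F : {set V * V}).

Lemma touchU e X F F' : touch e X (F :|: F') = touch e X F :|: touch e X F'.
Proof. by apply/setP=> p; rewrite !inE andb_orl. Qed.

(** It suffices to keep [w] witnessing edges for each nonempty set of hubs. *)
Lemma state_trim e F H w : state e F H w ->
  exists F', [/\ F' \subset F, state e F' H w & #|F'| <= 2 ^ #|H| * w].
Proof.
move=> [cF HF wF].
have /choice [W WP] (X : {set V}) : exists W : {set V * V},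
    X \subset H -> X != set0 -> W \subset touch e X F /\ #|W| = w.
  have [/andP[XH X0]|n] := boolP ((X \subset H) && (X != set0)); last first.
    by exists set0 => XH X0; rewrite XH X0 in n.
  have := wF X XH X0; rewrite -bin_gt0 -cards_draws card_gt0 => /set0Pn[W].
  by rewrite inE => /andP[WX /eqP cW]; exists W.
pose F' := \bigcup_(X in powerset H :\ set0) W X.
have F'F : F' \subset F.
  apply/bigcupsP=> X; rewrite !inE => /andP[X0 XH].
  by have [WX _] := WP X XH X0; apply: subset_trans WX _; apply/subsetP=> p; rewrite inE => /andP[].
exists F'; split=> //.
- split; first exact: cleanS F'F cF.
    exact: disjointWr (endsS F'F) HF.
  move=> X XH X0; have [/subsetP WX <-] := WP X XH X0.
  apply/subset_leq_card/subsetP=> p pW; have := WX p pW; rewrite !inE => /andP[_ ->].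
  by rewrite andbT; apply/bigcupP; exists X; rewrite ?inE ?X0.
- apply: leq_trans (card_bigcup_le (k := w) _) _.
    by move=> X; rewrite !inE => /andP[X0 XH]; case: (WP X XH X0) => _ ->.
  rewrite leq_mul2r -card_powerset; apply/orP; right.
  by apply/subset_leq_card/subsetDl.
Qed.

(* [phi] maps a vertex to a representative of its part. *)
Definition part_bound e K := exists phi : V -> V,
  (forall I : {set V}, crk e (phi @^-1: I) <= K) /\
  (forall (X : {set V}) y, X \subset phi @^-1: [set y] -> crk e X <= K).

(* The graph that pivoting the hubs away leaves on the vertices [x] that agree
   over [F] with the sum of [s x]. *)
Definition shifted e (s : V -> {set V}) : rel V := fun x z => bsum e (x |: s x) (z |: s z).

Lemma shifted_graph e s : is_graph e -> is_graph (shifted e s).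
Proof.
by move=> ge; split=> [x y|x]; [apply: bsum_sym ge.1|apply: bsum_alt].
Qed.

(** Away from [A] the two graphs differ by the matrices [psum e (s y) x] and
    [bsum e (s x) (y |: s y)]. Both factor through [H], hence have rank at most [#|H|]; rows and
    columns in [A] cost [#|A|] each. *)
Lemma shifted_crk e (s : V -> {set V}) H (A : {set V}) Z : is_graph e -> H \subset A ->
  (forall x, x \notin A -> s x \subset H) ->
  crk e Z <= brank (fun x y => [&& x \in Z :\: A, y \in ~: Z :\: A & shifted e s x y])
     + 2 * #|H| + 2 * #|A|.
Proof.
move=> ge /subsetP HA sH; have [es ei] := ge.
pose m1 x y := [&& x \in Z, y \notin Z & e x y] && (x \in A).
pose m2 x y := [&& x \in Z, y \notin Z & e x y] && ((x \notin A) && (y \in A)).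
pose m3 x y := [&& x \in Z :\: A, y \in ~: Z :\: A & shifted e s x y].
pose m4 x y := [&& x \in Z :\: A, y \in ~: Z :\: A & psum e (s y) x].
pose m6 x y := [&& x \in Z :\: A, y \in ~: Z :\: A & bsum e (s x) (y |: s y)].
have sub x h : x \notin A -> h \in s x -> h != x.
  move=> xA /(subsetP (sH x xA)) hH; apply: contraNneq xA => <-; exact: HA.
have key x y : x \notin A -> y \notin A ->
    shifted e s x y = e x y (+) psum e (s y) x (+) bsum e (s x) (y |: s y).
  move=> xA yA; rewrite /shifted bsumU1l //.
    by rewrite psumU1 ?(es y x) //; apply/negP=> /(sub y y yA); rewrite eqxx.
  by apply/negP=> /(sub x x xA); rewrite eqxx.
have le1 : brank m1 <= #|A| by apply: brank_rows => x y /andP[].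
have le2 : brank m2 <= #|A| by apply: brank_cols => x y /andP[_ /andP[]].
have le4 : brank m4 <= #|H|.
  apply: (brank_sum (f := fun x h => (x \in Z :\: A) && e x h)
                    (g := fun h y => (y \in ~: Z :\: A) && (h \in s y))) => x y.
  rewrite /m4 /psum; case xZ: (x \in _) => /=; last by rewrite big1.
  case yZ: (y \in _) => /=; last by rewrite big1 // => h _; rewrite andbF.
  rewrite [RHS]big_mkcond [LHS]big_mkcond /=; apply: eq_bigr => h _.
  rewrite es; case hs: (h \in s y); last by rewrite andbF if_same.
  rewrite andbT; suff -> : h \in H by [].
  by apply: subsetP hs; apply: sH; move: yZ; rewrite inE => /andP[].
have le6 : brank m6 <= #|H|.
  apply: (brank_sum (f := fun x h => (x \in Z :\: A) && (h \in s x))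
                    (g := fun h y => (y \in ~: Z :\: A) && psum e (y |: s y) h)) => x y.
  rewrite /m6 bsum_sym // /bsum; case xZ: (x \in _) => /=; last by rewrite big1.
  case yZ: (y \in _) => /=; last by rewrite big1 // => h _; rewrite andbF.
  rewrite [RHS]big_mkcond [LHS]big_mkcond /=; apply: eq_bigr => h _.
  case hs: (h \in s x); last by rewrite if_same.
  suff -> : h \in H by [].
  by apply: subsetP hs; apply: sH; move: xZ; rewrite inE => /andP[].
have le (a : V -> V -> bool) b (c : V -> V -> bool) : brank a <= b -> brank (fun x y => a x y (+) c x y) <= b + brank c.
  by move=> ab; apply: leq_trans (brank_add (d1 := a) (d2 := c) _) _; rewrite ?leq_add2r.
rewrite [crk e Z](_ : _ = brank (fun x y => m1 x y (+) (m2 x y (+) (m4 x y (+) (m6 x y (+) m3 x y))))).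
  have := le _ _ (fun x y => m2 x y (+) (m4 x y (+) (m6 x y (+) m3 x y))) le1.
  have := le _ _ (fun x y => m4 x y (+) (m6 x y (+) m3 x y)) le2.
  have := le _ _ (fun x y => m6 x y (+) m3 x y) le4.
  have := le _ _ m3 le6.
  by rewrite -/m3; lia.
apply: eq_brank => x y; rewrite /m1 /m2 /m3 /m4 /m6 !inE.
have [xA|xA] := boolP (x \in A); rewrite ?andbF ?addbF ?andbT //=.
have [yA|yA] := boolP (y \in A); rewrite ?andbF ?addbF ?andbT //=.
rewrite key //; case: (x \in Z); case: (y \in Z) => //=.
by case: (e x y); case: (psum _ _ _); case: (bsum _ _ _).
Qed.

Lemma conn_component e Y x : symmetric e ->
  conn e [set z | connect (restr e Y) x z].
Proof.
move=> es; apply: (@conn_root _ _ _ x es) => z; rewrite inE => /connectP[p pp ->].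
set K := [set z | _].
have clos p' x' : connect (restr e Y) x x' -> path (restr e Y) x' p' ->
    connect (restr e K) x' (last x' p').
  elim: p' x' => [|u p' IH] x' xx' //= /andP[x'u up].
  have xu := connect_trans xx' (connect1 x'u).
  apply: connect_trans (IH u xu up); apply: connect1.
  by rewrite /restr !inE xx' xu; case/and3P: x'u.
by apply: clos pp; apply: connect0.
Qed.

(** The parts are the components of the perturbed graph outside [A], and the single vertices of [A].
    A union of parts has no perturbed edge across its boundary, so only the error terms count.
    Inside a component the rank is at most the number of distinct rows, which the last hypothesis
    bounds by [k]; the summand 1 pays for the singletons. *)
Lemma no_hub_bound e (s : V -> {set V}) H (A : {set V}) k : is_graph e -> H \subset A ->
  (forall x, x \notin A -> s x \subset H) ->
  (forall K X R : {set V}, conn (shifted e s) K -> K \subset ~: A -> X \subset K -> R \subset X ->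
     sep (shifted e s) R (K :\: X) -> #|R| <= k) ->
  part_bound e (k + 1 + 2 * #|H| + 2 * #|A|).
Proof.
move=> ge HA sH none; pose d := shifted e s; pose r := restr d (~: A).
have [ds di] : is_graph d by apply: shifted_graph.
have rs : connect_sym r by apply: restr_connect_sym.
have edge x y : x \notin A -> y \notin A -> d x y -> connect r x y.
  by move=> xA yA dxy; apply: connect1; rewrite /r /restr !inE xA yA.
have stuck x y : x \in A -> connect r x y -> y = x.
  move=> xA /connectP[[|z p] /= pp ->] //.
  by case/andP: pp => /and3P[]; rewrite inE xA.
exists (fingraph.root r); split=> [I|X y XI].
  apply: leq_trans (shifted_crk _ ge HA sH) _; rewrite !leq_add2r.
  apply: leq_trans (_ : 0 <= _) => //; rewrite -(cards0 V).
  apply: brank_rows => x z /and3P[]; rewrite !inE => /andP[xA xI] /andP[zA zI] dxz.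
  by move: zI; rewrite -(fingraph.rootP rs (edge x z xA zA dxz)) xI.
have [->|[x xX]] := set_0Vmem X.
  apply: leq_trans (_ : 0 <= _) => //; rewrite -(cards0 V).
  by apply: brank_rows => x z /and3P[]; rewrite inE.
have fib z : z \in X -> connect r x z.
  move=> zX; apply/(fingraph.rootP rs).
  by have := subsetP XI z zX; have := subsetP XI x xX; rewrite !inE => /eqP-> /eqP->.
have [xA|xA] := boolP (x \in A).
  apply: leq_trans (_ : 1 <= _); last by rewrite -!addnA addnCA leq_addr.
  rewrite -(cards1 x); apply: brank_rows => z u /and3P[zX _ _].
  by rewrite inE (stuck x z xA (fib z zX)).
apply: leq_trans (shifted_crk _ ge HA sH) _; rewrite !leq_add2r.
pose K := [set z | connect r x z].
have KA : K \subset ~: A.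
  apply/subsetP=> z; rewrite !inE => xz; apply/negP=> zA; case/negP: xA.
  by rewrite (stuck z x zA) // rs.
have XK : X \subset K by apply/subsetP=> z /fib; rewrite inE.
have cK : conn d K by apply: conn_component.
have [R RX [sR cR]] := brank_sep d X (K :\: X).
have := none K X R cK KA XK RX sR => cRk.
apply: leq_trans (leq_addr _ _); apply: leq_trans cRk; apply: leq_trans cR.
rewrite [leqLHS](_ : _ = brank (fun z u => [&& z \in X, u \in K :\: X & d z u])) //.
apply: eq_brank => z u; rewrite !inE -/d.
case zX: (z \in X) => /=; last by rewrite andbF.
have := subsetP KA z (subsetP XK z zX); rewrite inE => -> /=.
case: (u \in X) => //=; first by rewrite andbF.
rewrite andbT; case dzu: (d z u); rewrite ?andbF // !andbT.
apply/idP/idP => [uA|xu]; last by have := subsetP KA u; rewrite !inE; apply.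
have zA : z \notin A by have := subsetP KA z (subsetP XK z zX); rewrite inE.
exact: connect_trans (fib z zX) (edge z u zA uA dzu).
Qed.

End Step.

Lemma leq_remainder a b c B w m : w + c + m <= a + b -> a <= c -> b <= B -> w + m <= B.
Proof. by lia. Qed.

Lemma new_hub_or_bound n m w' : exists w K, forall (V : finType) (e : rel V) F (H : {set V}),
  is_graph e -> state e F H w -> #|H| = m ->
  part_bound e K \/
  exists2 e', reach setT e e' & has_path n e' setT \/
    exists F' (H' : {set V}), state e' F' H' w' /\ #|H'| = m.+1.
Proof.
have [k [t gad]] := bounded_connected_hub n w'.
(* Each of at most [t] vertices of [T] disagrees with its sum of hubs on fewer than [w'] edges, all
   of which are deleted; the [m] pivots spend [m] more, and [w'] edges must remain for each sum. [N]
   bounds the trimmed matching. *)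
pose w := w' + t * w' + m; pose N := 2 ^ m * w.
exists w, (k.+2 + 1 + 2 * m + 2 * (m + 2 * N)) => V e F0 H ge st0 cH.
have [F [_ stF cF]] := state_trim st0; have [clF HF wF] := stF.
rewrite cH -/N in cF.
pose A := H :|: ends F.
have cA : #|A| <= m + 2 * N.
  apply: leq_trans (leq_card_setU _ _) _; rewrite cH leq_add2l.
  by apply: leq_trans (card_ends _) _; rewrite leq_mul2l.
(* Either some vertex is a further hub over [F], or every vertex agrees with
   the sum of a set of hubs on all but few edges of [F]. *)
have [[x [xA stx]]|nohub] := pselect (exists x, x \notin A /\ state e F (x |: H) w').
  right; exists e; [exact: reach_refl|right]; exists F, (x |: H); split=> //.
  by rewrite cardsU1 cH; move: xA; rewrite inE negb_or => /andP[-> _].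
have /choice [s sP] (x : V) : exists s : {set V}, x \notin A ->
    s \subset H /\ #|touch e (x |: s) F| < w'.
  have [xA|xA] := boolP (x \in A); first by exists set0.
  have [xH xF] : x \notin H /\ x \notin ends F by apply/norP; rewrite -in_setU.
  case: (boolP [exists s : {set V}, (s \subset H) && (#|touch e (x |: s) F| < w')]).
    by case/existsP=> s /andP[sH ws]; exists s.
  rewrite negb_exists => /forallP none; case: nohub; exists x; split=> //; split=> //.
    by rewrite disjoints_subset subUset sub1set !inE xF -disjoints_subset.
  move=> X XH X0; have [xX|xX] := boolP (x \in X).
    have := none (X :\ x); rewrite setD1K // negb_and -leqNgt => /orP[/negP[]|//].
    by rewrite subDset.
  apply: leq_trans (wF X _ X0); first by rewrite /w -addnA leq_addr.
  apply/subsetP=> u uX; have := subsetP XH u uX; rewrite !inE.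
  by case: eqP => // ux; rewrite -ux uX in xX.
pose d := shifted e s; have gd : is_graph d by apply: shifted_graph.
have [[K [X [R [cK KA XK RX [sR kR]]]]]|nosep] := pselect (exists K X R : {set V},
   [/\ conn d K, K \subset ~: A, X \subset K, R \subset X & sep d R (K :\: X) /\ k <= #|R|]).
  right; have KXK : K :\: X \subset K by apply: subsetDl.
  have RK := subset_trans RX XK.
  have dRX : [disjoint R & K :\: X].
    by apply: disjointWl RX _; rewrite disjoint_sym disjoints_subset setDE subsetIr.
  have [T [TK cT] [d' rd' found]] := gad V d K R (K :\: X) gd cK RK KXK dRX sR kR.
  have TA x : x \in T -> x \notin A.
    by move=> xT; have := subsetP KA x (subsetP TK x xT); rewrite inE.
  pose E := \bigcup_(x in T) touch e (x |: s x) F.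
  have cE : #|E| <= t * w'.
    apply: leq_trans (card_bigcup_le (k := w') _) _; last by rewrite leq_mul2r cT orbT.
    by move=> x xT; have [_ /ltnW] := sP x (TA x xT).
  have F1F : F :\: E \subset F by apply: subsetDl.
  have stF1 : state e (F :\: E) H (w' + m).
    split; [exact: cleanS F1F clF|exact: disjointWr (endsS F1F) HF|].
    move=> Y YH Y0; have := wF Y YH Y0; rewrite -(cardsID E) => wY.
    apply: leq_remainder wY _ _.
      by apply: leq_trans cE; apply/subset_leq_card/subsetIr.
    by apply/subset_leq_card/subsetP=> p; rewrite !inE => /and3P[-> -> ->].
  have TH : [disjoint T & H].
    by rewrite disjoints_subset; apply/subsetP=> x /TA; rewrite !inE negb_or => /andP[].
  have TF : [disjoint T & ends F].
    by rewrite disjoints_subset; apply/subsetP=> x /TA; rewrite !inE negb_or => /andP[].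
  have sT0 : {in T & ends (F :\: E), forall x v, psum e (x |: s x) v = false}.
    move=> x v xT /endsP[p /setDP[pF pE] vp]; apply/negbTE/negP => ps.
    case/negP: pE; apply/bigcupP; exists x => //; rewrite inE pF.
    by case: vp ps => -> ->; rewrite ?orbT.
  have [e1 [F2 [H1 [[re1 F2F st1] cH1 TH1 TF2 eT]]]] :=
    pivot_hubs ge stF1 (subxx H) cH (leq_addl _ _) TH
       (disjointWr (endsS F1F) TF) (fun x xT => (sP x (TA x xT)).1) sT0.
  have g1 := reach_graph ge re1; rewrite addnK in st1.
  (* On [T] the pivoted graph is the perturbed one, so the local complementations found there can be
     replayed in [e1]. *)
  have ag : agree T d e1 by move=> x z xT zT; rewrite eT.
  have [e2 re2 ag2] := reach_agree ag rd'.
  exists e2; first exact: reach_trans re1 (reach_sub (subsetT _) re2).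
  case: found => [[u [ui uT ue]]|[c [FT [cT' FTT cFT cn [wFT hub]]]]].
    by left; exists u; split=> // i j; rewrite -ag2.
  (* The new hub [c] vanishes over [F2], as every vertex of [T] does. Hence a set with an old hub is
     tested on [F2], where [c] does not matter, and the set of [c] alone on [FT]. *)
  right; exists (F2 :|: FT), (c |: H1); have g2 := reach_graph g1 re2.
  have [clF2 HF2 wF2] := st1.
  have rowF2 v h : v \in ends F2 -> e2 v h = e1 v h.
    by move=> vF; apply: (reach_away g1 _ re2) => x xT; rewrite g1.1 TF2.
  have colF2 v h : v \in ends F2 -> e2 h v = e1 h v.
    by move=> vF; rewrite g2.1 rowF2 // g1.1.
  have FTin p : p \in FT -> p.1 \in T /\ p.2 \in T.
    by move=> pF; split; apply: (subsetP FTT); [apply: ends1|apply: ends2].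
  have cH' : c \notin H1 by rewrite (disjointFr TH1).
  have F2A v : v \in ends F2 -> v \notin T.
    move=> vF; rewrite (disjointFl TF) //.
    exact: (subsetP (endsS (subset_trans F2F F1F))).
  split; last by rewrite cardsU1 cH' cH1 cH.
  split.
  - apply: cleanU => //.
    + move=> p q pF qF; rewrite !rowF2 ?ends1 ?ends2 //; exact: clF2.
    + move=> p q pF qF; have [p1 p2] := FTin p pF; have [q1 q2] := FTin q qF.
      by rewrite -!ag2 //; apply: cFT.
    + by move=> u v uF /(subsetP FTT) vT; rewrite rowF2 // g1.1 TF2.
  - rewrite disjoints_subset subUset sub1set !inE endsU !inE (negbTE cn) orbF.
    apply/andP; split; first by apply/negP=> /F2A; rewrite cT'.
    apply/subsetP=> h hH; rewrite !inE (disjointFr HF2 hH) /=.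
    by apply/negP=> /(subsetP FTT); rewrite (disjointFl TH1 hH).
  - move=> Y YH Y0; rewrite touchU.
    have Y'H : Y :\ c \subset H1 by rewrite subDset.
    have [Y'0|Y'0] := eqVneq (Y :\ c) set0.
      have YE : Y = [set c].
        have Yc v : v \in Y -> v = c.
          by move=> vY; apply: contra_eq Y'0 => vc; apply/set0Pn; exists v; rewrite !inE vc.
        apply/setP=> v; rewrite inE; apply/idP/eqP => [/Yc //|->].
        by case/set0Pn: Y0 => u uY; rewrite -(Yc u uY).
      apply: leq_trans wFT _; apply/subset_leq_card/subsetP=> p pF.
      have [p1 p2] := FTin p pF.
      by rewrite in_setU [in X in _ || X]inE pF YE !psum1 -!ag2 // hub ?orbT.
    apply: leq_trans (wF2 _ Y'H Y'0) _; apply/subset_leq_card/subsetP=> p.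
    rewrite !inE => /andP[pF tp]; rewrite pF /=; apply/orP; left.
    have same v : v \in ends F2 -> psum e2 Y v = psum e1 (Y :\ c) v.
      move=> vF; have [cY|cY] := boolP (c \in Y).
        rewrite (psumD1 _ _ cY) colF2 // TF2 //=; apply: eq_bigr => h _; exact: colF2.
      rewrite (_ : Y :\ c = Y); first by apply: eq_bigr => h _; apply: colF2.
      by apply/setP=> u; rewrite !inE; case: eqP => // ->; rewrite (negbTE cY).
    by rewrite !same ?ends1 ?ends2.
left.
have -> : k.+2 + 1 + 2 * m = k.+2 + 1 + 2 * #|H| by rewrite cH.
have [phi [p1 p2]] : part_bound e (k.+2 + 1 + 2 * #|H| + 2 * #|A|).
  apply: (no_hub_bound (s := s)) => //.
  - exact: subsetUl.
  - by move=> x /sP[].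
  - move=> K X R cK KA XK RX sR; rewrite leqNgt; apply/negP => kR; apply: nosep.
    by exists K, X, R; split=> //; split=> //; apply: leq_trans kR; apply: leqW; apply: leqW.
exists phi; split=> [I|Y y Yy]; [apply: leq_trans (p1 I) _|apply: leq_trans (p2 Y y Yy) _];
  by rewrite leq_add2l leq_mul2l cA.
Qed.

Lemma part_bound_le (V : finType) (e : rel V) K K' : K <= K' ->
  part_bound e K -> part_bound e K'.
Proof.
move=> KK [phi [h1 h2]]; exists phi; split=> [I|X y Xy].
  exact: leq_trans (h1 I) KK.
exact: leq_trans (h2 X y Xy) KK.
Qed.

(** Adding a hub lowers the threshold, so thresholds are chosen backwards from the last hub. The
    empty matching without hubs meets every initial threshold. *)
Lemma iterated_step n m w : exists K, forall (V : finType) (e : rel V), is_graph e ->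
  exists2 e', reach setT e e' & [\/ has_path n e' setT, part_bound e' K |
    exists F (H : {set V}), state e' F H w /\ #|H| = m].
Proof.
elim: m w => [|m IH] w.
  exists 0 => V e ge; exists e; first exact: reach_refl.
  apply: Or33; exists set0, set0; rewrite cards0; split=> //; split.
  - by move=> p; rewrite inE.
  - by rewrite disjoints_subset sub0set.
  - by move=> X; rewrite subset0 => ->.
have [w1 [K1 st]] := new_hub_or_bound n m w; have [K2 it] := IH w1.
exists (maxn K1 K2) => V e ge; have [e1 re1 [hp|pb|[F [H [sH cH]]]]] := it V e ge.
- by exists e1 => //; apply: Or31.
- by exists e1 => //; apply: Or32; apply: part_bound_le pb; apply: leq_maxr.
have [pb|[e2 re2 [hp|fH]]] := st V e1 F H (reach_graph ge re1) sH cH.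
- by exists e1 => //; apply: Or32; apply: part_bound_le pb; apply: leq_maxl.
- by exists e2; [apply: reach_trans re1 re2|apply: Or31].
- by exists e2; [apply: reach_trans re1 re2|apply: Or33].
Qed.

(** * Separating the hubs *)


(** Pairs of bits are vectors of F_2 x F_2: the adjacencies of a hub to the two ends of an edge of
    [F]. *)
Definition addp (a b : bool * bool) := (a.1 (+) b.1, a.2 (+) b.2).
Definition sel (b : bool) (a : bool * bool) := if b then a.1 else a.2.
Definition zerop : bool * bool := (false, false).

Lemma addpp a : addp a a = zerop.
Proof. by case: a => a1 a2; rewrite /addp !addbb. Qed.

Lemma addp0 a : addp a zerop = a.
Proof. by case: a => a1 a2; rewrite /addp !addbF. Qed.

Lemma addp_neq0 a b : a != b -> addp a b != zerop.
Proof. by case: a b => [[] []] [[] []]. Qed.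

Lemma sel_neq0 a : a != zerop -> exists b, sel b a.
Proof. by case: a => [[] []] // _; [exists true|exists true|exists false]. Qed.

Section Blocks.
Variable V : finType.
Implicit Types (e d : rel V) (F : {set V * V}) (M : nat -> nat -> bool * bool)
  (c : nat -> V) (B : nat -> {set V * V}).

Definition adjp e (h : V) (z : V * V) := (e h z.1, e h z.2).

(** [M] is a matrix of hubs against blocks with entries in F_2 x F_2; it is brought to diagonal form
    by elimination, with pivots as row operations. *)
Definition blocks e F w q c B M :=
  [/\ clean e F,
      forall i, i < q -> [/\ c i \notin ends F, B i \subset F & w <= #|B i|],
      forall i j, i < q -> j < q -> i != j -> c i != c j /\ [disjoint B i & B j]
    & forall i j z, i < q -> j < q -> z \in B j -> adjp e (c i) z = M i j].

Lemma blocks_ext e F w q q' c B M M' : q' <= q ->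
  (forall i j, i < q' -> j < q' -> M i j = M' i j) ->
  blocks e F w q c B M -> blocks e F w q' c B M'.
Proof.
move=> qq MM [h1 h2 h3 h4]; split=> // [i iq|i j iq jq|i j z iq jq zB].
- by apply: h2; apply: leq_trans qq.
- by apply: h3; apply: leq_trans qq.
- by rewrite -MM // (h4 _ j) // (leq_trans _ qq).
Qed.

(** Pivoting hub [k] with end [b] of one edge of block [l] adds row [k] to every row that sees this
    end. Hubs and blocks share their indices, so [f] has to avoid both [k] and [l]. *)
Lemma blocks_cut e F w q q' c B M b k l (f : nat -> nat) : is_graph e -> 0 < w ->
  blocks e F w q c B M -> k < q -> l < q -> sel b (M k l) ->
  (forall i, i < q' -> [/\ f i < q, f i != k & f i != l]) ->
  (forall i j, i < q' -> j < q' -> f i = f j -> i = j) ->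
  exists e1 F1, [/\ reach setT e e1, is_graph e1 & blocks e1 F1 w q' (c \o f) (B \o f)
    (fun i j => addp (M (f i) (f j)) (if sel b (M (f i) l) then M k (f j) else zerop))].
Proof.
move=> ge w0 [cF hB hD hM] kq lq Mkl fq finj.
have /card_gt0P[z zB] : 0 < #|B l| by case: (hB l lq) => _ _; apply: leq_trans.
have zF : z \in F by case: (hB l lq) => _ /subsetP/(_ z zB).
pose y := if b then z.1 else z.2; pose y' := if b then z.2 else z.1.
have yy' : leg_end z y y' by rewrite /y /y'; case: (b); [left|right].
have ey i : i < q -> e (c i) y = sel b (M i l).
  by move=> iq; rewrite -(hM i l z) // /y; case: (b).
have [cnF _ _] := hB k kq.
have [e1 [re1 g1 c1 _ e1E]] := pivot_leg ge cF zF yy' cnF (etrans (ey k kq) Mkl).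
have [_ yF _] := leg_end_edge ge cF zF yy'.
have BF j u : j < q' -> u \in B (f j) -> u \in F :\ z.
  move=> jq uB; have [fj fk fl] := fq j jq; have [_ /subsetP/(_ u uB) uF _] := hB _ fj.
  rewrite !inE uF andbT; apply: contraTneq zB => <-.
  by have [_ dj] := hD _ _ fj lq fl; rewrite (disjointFr dj).
exists e1, (F :\ z); split=> //; split=> //.
- move=> i iq; have [fi _ _] := fq i iq; have [cn _ wB] := hB _ fi; split=> //.
    by apply: contra cn; apply/subsetP/endsS/subsetDl.
  by apply/subsetP=> u; apply: BF iq.
- move=> i j iq jq ij; apply: hD; try by [case: (fq i iq)|case: (fq j jq)].
  by apply: contra_neq ij; apply: finj.
- move=> i j u iq jq uB; have [fi fik fil] := fq i iq; have [fj _ _] := fq j jq.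
  have uF := BF j u jq uB.
  have cik : c (f i) != c k by case: (hD _ _ fi kq fik).
  have ciy : c (f i) != y.
    by have [cn _ _] := hB _ fi; apply: contraNneq cn => ->.
  rewrite /adjp !e1E ?ends1 ?ends2 //= ey // -(hM (f i) (f j) u) // -(hM k (f j) u) //.
  by case: (sel _ _).
Qed.

Definition tri (p al r : bool * bool) i j :=
  if i < j then r else if i == j then p else al.

(* The last hub has type [al] on all other blocks; pivoting it with an edge of
   the first block adds [al] to all other rows. *)
Lemma blocks_kill_lower e F w q c B p al r : is_graph e -> 0 < w -> p != al ->
  blocks e F w (q + 2) c B (tri p al r) ->
  exists e1 F1 c1 B1 p1 r1, [/\ reach setT e e1, is_graph e1, p1 != zerop &
    blocks e1 F1 w q c1 B1 (tri p1 zerop r1)].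
Proof.
move=> ge w0 pal bl; have [al0|/sel_neq0[b bal]] := eqVneq al zerop.
  exists e, F, c, B, p, r; rewrite -al0; split=> //; first exact: reach_refl.
  by apply: blocks_ext bl => //; apply: leq_addr.
rewrite addn2 in bl.
have [|||||e1 [F1 [re1 g1 bl1]]] := @blocks_cut e F w _ q c B _ b q.+1 0 S ge w0 bl.
- by [].
- by [].
- by [].
- by move=> i iq; split=> //; [rewrite !ltnS ltnW|rewrite eqSS ltn_eqF].
- by move=> i j _ _ [].
exists e1, F1, (c \o S), (B \o S), (addp p al), (addp r al); split=> //.
  exact: addp_neq0.
apply: blocks_ext bl1 => // i j iq jq.
rewrite /tri /= bal !ltnS !eqSS [q < j]ltnNge (ltnW jq) (gtn_eqF jq) /=.
by case: ifP => _ //; case: ifP => _ //; rewrite addpp.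
Qed.

Definition part_tri (p r : bool * bool) k i j :=
  if i < j then (if i < k then zerop else r) else if i == j then p else zerop.

(* Pivoting the hub [k.+1] with an edge of the block [k.+2] adds the row [k.+1]
   to the row [k]; both are equal to [r] from the block [k.+3] on. *)
Lemma blocks_clear_row e F w q c B p r k : is_graph e -> 0 < w -> r != zerop ->
  k + 3 <= q -> blocks e F w q c B (part_tri p r k) ->
  exists e1 F1 c1 B1, [/\ reach setT e e1, is_graph e1 &
    blocks e1 F1 w (q - 2) c1 B1 (part_tri p r k.+1)].
Proof.
move=> ge w0 /sel_neq0[b br] kq bl.
(* The indices [k.+1] and [k.+2], of the hub and the block used, are skipped. *)
pose f i := if i <= k then i else i.+2.
have [|||||e1 [F1 [re1 g1 bl1]]] :=
  @blocks_cut e F w q (q - 2) c B _ b k.+1 k.+2 f ge w0 bl.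
- by lia.
- by lia.
- by rewrite /part_tri ltnSn ltnNge leqnSn.
- by move=> i iq; rewrite /f; case: (leqP i k) => ik; split; lia.
- by move=> i j _ _; rewrite /f; case: (leqP i k); case: (leqP j k); lia.
exists e1, F1, (c \o f), (B \o f); split=> //.
apply: blocks_ext bl1 => // i j iq jq.
have fE m : f m = if m <= k then m else m.+2 by [].
have -> : part_tri p r k (f i) k.+2 = if i == k then r else zerop.
  rewrite /part_tri fE; case: (ltngtP i k) => ik.
  - by rewrite (ltn_trans ik (leqnSn _)) ik.
  - by rewrite !ltnS !eqSS (leq_gtF (ltnW ik)) (gtn_eqF ik).
  - by rewrite ik leqnSn ltnn.
have -> : part_tri p r k k.+1 (f j) = if j <= k then zerop else r.
  rewrite /part_tri fE; case: (leqP j k) => jk.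
    by rewrite (leq_gtF (leqW jk)) (gtn_eqF (_ : j < k.+1)).
  by rewrite !ltnS (ltnW jk) (leq_gtF (leqnSn k)).
have -> : part_tri p r k (f i) (f j) = part_tri p r k i j.
  rewrite /part_tri !fE; case: (leqP i k) => ik; case: (leqP j k) => jk //.
  - by rewrite (leq_ltn_trans ik jk) (leq_trans (leq_ltn_trans ik jk) (leqW (leqnSn j))).
  - have ji := leq_ltn_trans jk ik.
    rewrite (leq_gtF (ltnW ji)) (gtn_eqF ji) (leq_gtF (leqW (leqW (ltnW ji)))).
    by rewrite (gtn_eqF (leqW (leqW ji))).
  - by rewrite !ltnS !eqSS (leq_gtF (ltnW ik)) (leq_gtF (leqW (leqW (ltnW ik)))).
rewrite /part_tri; have [->|ik] := eqVneq i k.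
  by rewrite br ltnn ltnSn; case: (ltngtP k j) => jk; rewrite ?addpp ?addp0.
rewrite (_ : sel b zerop = false) ?addp0; last by case: (b).
by rewrite [i < k.+1]ltnS [i <= k]leq_eqVlt (negbTE ik).
Qed.

(** Clearing a row costs two indices, so clearing [n] rows leaves [n] of the initial [3 * n]. *)
Lemma blocks_clear_upper e F w n c B p r k : is_graph e -> 0 < w -> r != zerop -> k <= n ->
  blocks e F w (3 * n) c B (part_tri p r 0) ->
  exists e1 F1 c1 B1, [/\ reach setT e e1, is_graph e1 &
    blocks e1 F1 w (3 * n - 2 * k) c1 B1 (part_tri p r k)].
Proof.
move=> ge w0 r0; elim: k => [|k IH] kn bl.
  by exists e, F, c, B; split=> //; [exact: reach_refl|rewrite subn0].
have [e1 [F1 [c1 [B1 [re1 g1 bl1]]]]] := IH (ltnW kn) bl.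
have [|e2 [F2 [c2 [B2 [re2 g2 bl2]]]]] := blocks_clear_row g1 w0 r0 _ bl1; first by lia.
exists e2, F2, c2, B2; split=> //; first exact: reach_trans re1 re2.
by rewrite mulnS addnC subnDA.
Qed.

Definition diag (p : bool * bool) i j := if i == j :> nat then p else zerop.

Lemma blocks_diag e F w n c B p r : is_graph e -> 0 < w ->
  blocks e F w (3 * n) c B (tri p zerop r) ->
  exists e1 F1 c1 B1, [/\ reach setT e e1, is_graph e1 & blocks e1 F1 w n c1 B1 (diag p)].
Proof.
move=> ge w0 bl; have [r0|r0] := eqVneq r zerop.
  exists e, F, c, B; split=> //; first exact: reach_refl.
  apply: blocks_ext bl; first by rewrite leq_pmull.
  by move=> i j _ _; rewrite /tri /diag r0; case: ltngtP.
have bl' : blocks e F w (3 * n) c B (part_tri p r 0) by apply: blocks_ext bl.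
have [e1 [F1 [c1 [B1 [re1 g1 bl1]]]]] := blocks_clear_upper ge w0 r0 (leqnn n) bl'.
exists e1, F1, c1, B1; split=> //; apply: blocks_ext bl1; first by lia.
by move=> i j iq jq; rewrite /part_tri /diag iq; case: ltngtP.
Qed.

(* Local complementation at one end of a leg whose two ends are both adjacent
   to the hub removes one of these two edges. *)
Lemma blocks_untwist e F w n c B : is_graph e -> blocks e F w n c B (diag (true, true)) ->
  (forall i j, i < n -> j < n -> e (c i) (c j) = false) ->
  exists e1, [/\ reach setT e e1, is_graph e1, blocks e1 F w n c B (diag (true, false)) &
    forall i j, i < n -> j < n -> e1 (c i) (c j) = false].
Proof.
move=> ge bl ind; have [cF hB hD hM] := bl.
pose U := \bigcup_(i < n) B i.
suff main l : uniq l -> {subset l <= U} -> exists e1, [/\ reach setT e e1, is_graph e1,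
    clean e1 F, forall i j, i < n -> j < n -> e1 (c i) (c j) = false &
    forall i j z, i < n -> j < n -> z \in B j ->
      adjp e1 (c i) z = if i == j then (true, z \notin l) else zerop].
  have [|z|e1 [re1 g1 c1 i1 a1]] := main (enum U); first exact: enum_uniq.
    by rewrite mem_enum.
  exists e1; split=> //; split=> // i j z iq jq zB; rewrite (a1 i j) //.
  by rewrite mem_enum (_ : z \in U) //; apply/bigcupP; exists (Ordinal jq).
elim: l => [|z0 l IH] /=.
  by move=> _ _; exists e; split=> //; exact: reach_refl.
case/andP=> z0l ul lU; have [|e1 [re1 g1 c1 i1 a1]] := IH ul.
  by move=> z zl; apply: lU; rewrite inE zl orbT.
have /bigcupP[[j0 j0q] _ /= z0B] : z0 \in U by apply: lU; rewrite inE eqxx.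
have z0F : z0 \in F by case: (hB j0 j0q) => _ /subsetP/(_ z0 z0B).
have [es ei] := g1.
have hubz i : i < n -> e1 z0.1 (c i) = (i == j0).
  move=> iq; have := a1 i j0 z0 iq j0q z0B; rewrite es.
  by case: eqP => _ [-> _].
have legz1 z : z \in F -> e1 z0.1 z.1 = false by move=> zF; have [_ ->] := c1 z0 z z0F zF.
have legz2 z : z \in F -> e1 z0.1 z.2 = (z0 == z) by move=> zF; have [->] := c1 z0 z z0F zF.
exists (lc e1 z0.1); split.
- exact: reach_trans re1 (reach_lc _ (in_setT _)).
- exact: lc_graph.
- move=> z z' zF z'F; have [E1 E2 E3] := c1 z z' zF z'F.
  rewrite /lc E1 E2 E3 !legz1 // !legz2 // !andbF !addbF; split=> //.
  have [<-|] := eqVneq z0 z; last by rewrite andbF.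
  by have [<-|] := eqVneq z0 z'; rewrite ?andbF // eqxx.
- move=> i j iq jq; rewrite /lc i1 // !hubz //.
  have [->|] := eqVneq i j0; last by rewrite andbF.
  by have [->|] := eqVneq j j0; rewrite ?andbF // eqxx.
- move=> i j z iq jq zB; have := a1 i j z iq jq zB.
  have zF : z \in F by case: (hB j jq) => _ /subsetP/(_ z zB).
  rewrite /adjp /lc hubz // legz1 // legz2 // !andbF !addbF inE negb_or.
  have cz : c i != z.2 by case: (hB i iq) => cn _ _; apply: contraNneq cn => ->; apply: ends2.
  rewrite cz /=; have [zz|zz] := eqVneq z0 z.
    rewrite -zz ?eqxx /= ?andbT; have jj0 : j = j0.
      apply/eqP; apply: contraTT z0B => jj; have [_ dj] := hD j j0 jq j0q jj.
      by rewrite -zz in zB; rewrite (disjointFr dj).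
    by rewrite jj0; case: eqP => [_ [-> ->]|_ [-> ->]]; rewrite ?z0l.
  by rewrite andbF addbF.
Qed.

End Blocks.

(** Ramsey on [n.+1] hubs: if they form a clique, complementing at one of them makes the others
    independent. That hub sees only its own block, which is dropped from the matching, so nothing
    else changes. *)
Lemma blocks_indep n : exists N, forall (V : finType) (e : rel V) F w c B p, is_graph e ->
  blocks e F w N c B (diag p) ->
  exists e1 F1 c1 B1, [/\ reach setT e e1, is_graph e1, blocks e1 F1 w n c1 B1 (diag p) &
    forall i j, i < n -> j < n -> e1 (c1 i) (c1 j) = false].
Proof.
have [N NP] := ramsey n.+1.
exists N.+1 => V e F w c B p ge bl; have [es ei] := ge.
have [||Y [_ nY] [b hY]] := NP _ (fun i j : 'I_N.+1 => e (c i) (c j)) setT.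
- by move=> i j; apply: es.
- by rewrite cardsT card_ord.
pose f i : nat := nth ord0 (enum Y) i.
have szY : size (enum Y) = #|Y| by rewrite -cardE.
have fY i : i < n.+1 -> nth ord0 (enum Y) i \in Y.
  by move=> iq; rewrite -mem_enum mem_nth // szY (leq_trans iq).
have fI i j : i < n.+1 -> j < n.+1 -> (f i == f j) = (i == j).
  move=> iq jq; rewrite -(@nth_uniq _ ord0 (enum Y) i j) ?enum_uniq // szY.
    exact: leq_trans iq nY.
  exact: leq_trans jq nY.
have fN i : f i < N.+1 by rewrite /f.
have hub i j : i < n.+1 -> j < n.+1 -> i != j -> e (c (f i)) (c (f j)) = b.
  by move=> iq jq ij; apply: hY; rewrite ?fY // -(inj_eq val_inj) /= fI.
have [cF hB hD hM] := bl.
have blf : blocks e F w n.+1 (c \o f) (B \o f) (diag p).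
  split=> // [i iq|i j iq jq ij|i j z iq jq zB]; first exact: hB.
    by apply: hD; rewrite ?fI.
  by rewrite (hM _ (f j)) // /diag fI.
pose h := c (f n).
pose F1 := \bigcup_(i < n) B (f i).
exists (if b then lc e h else e), F1, (c \o f), (B \o f).
have rlc : reach setT e (if b then lc e h else e).
  by case: (b); [apply: reach_lc|apply: reach_refl].
split=> //; first by case: (b); [apply: lc_graph|].
  have le i : i < n -> i < n.+1 by apply: leqW.
  have F1F : F1 \subset F by apply/bigcupsP=> i _; case: (hB (f i) (fN i)).
  have far i z : i < n -> z \in B (f i) -> e h z.1 = false /\ e h z.2 = false.
    move=> iq zB; have [_ _ _ /(_ n i z (ltnSn n) (le i iq) zB)] := blf.
    by rewrite /diag gtn_eqF // => -[-> ->].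
  have farF z : z \in F1 -> e h z.1 = false /\ e h z.2 = false.
    by case/bigcupP=> i _; apply: far.
  split.
  - move=> z z' zF z'F; have := cF z z' (subsetP F1F z zF) (subsetP F1F z' z'F).
    have [z1 z2] := farF z zF; have [z1' z2'] := farF z' z'F.
    by case: (b); rewrite /lc ?z1 ?z2 ?z1' ?z2' ?andbF ?addbF.
  - move=> i iq; have [cn _ wB] := hB (f i) (fN i); split=> //.
      by apply: contra cn; apply/subsetP/endsS.
    exact: (bigcup_sup (Ordinal iq)).
  - by move=> i j iq jq ij; apply: hD; rewrite ?fI ?le.
  - move=> i j z iq jq zB; have [_ _ _ /(_ i j z (le i iq) (le j jq) zB) <-] := blf.
    case: (b) => //.
    by have [z1 z2] := far j z jq zB; rewrite /adjp /lc z1 z2 !andbF !addbF.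
move=> i j iq jq; case: b hub {rlc hY} => hub /=.
  have [->|ij] := eqVneq i j; first by case: (lc_graph h ge).
  have hn m : m < n -> e h (c (f m)) by move=> mn; rewrite hub ?ltnSn ?leqW ?gtn_eqF.
  have [_ _ /(_ i j (leqW iq) (leqW jq) ij)[cij _] _] := blf.
  by rewrite /lc !hn // hub ?leqW // andbT cij.
have [->|ij] := eqVneq i j; first exact: ei.
by apply: hub; rewrite ?leqW.
Qed.

(** * Copies of the subdivided star *)


Lemma star_edge (A : finType) (E : {set star A}) : E \in edges (star A) ->
  exists k, E = [set None; Some k].
Proof.
rewrite inE => /existsP[x /existsP[y /andP[exy /eqP ->]]].
by case: x y exy => [x|] [y|] //= _; [exists x; rewrite setUC|exists y].
Qed.

Section Embedding.
Variables (V : finType) (e : rel V) (F : {set V * V}) (n : nat).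
Variables (c : nat -> V) (B : nat -> {set V * V}) (b : bool).
Hypothesis ge : is_graph e.
Hypothesis bl : blocks e F n n c B (diag (b, ~~ b)).
Hypothesis ind : forall i j, i < n -> j < n -> e (c i) (c j) = false.

(** Copy [i] has centre [c i]; its legs are [n] edges of block [i], the end seen by the hub being
    the subdivision vertex. *)
Lemma blocks_embedding : 0 < n ->
  exists2 f : copies n (T2 n) -> V, injective f & {mono f : x y / x -- y >-> e x y}.
Proof.
move=> n0; have [cF hB hD hM] := bl; have [es ei] := ge.
have /card_gt0P[z0 _] : 0 < #|B 0| by case: (hB 0 n0) => _ _; apply: leq_trans.
pose k0 := Ordinal n0.
pose near (z : V * V) := if b then z.1 else z.2.
pose far (z : V * V) := if b then z.2 else z.1.
pose leg (i k : 'I_n) := nth z0 (enum (B i)) k.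
(* The default [k0] never occurs, since every edge of the star contains some [Some k]. *)
pose idx (E : {A : {set star 'I_n} | A \in edges (star 'I_n)}) :=
  odflt k0 [pick k | Some k \in val E].
have idxE E : val E = [set None; Some (idx E)].
  have [k Ek] := star_edge (valP E); rewrite {1}Ek /idx; congr [set _; _].
  case: pickP => [k' |/(_ k)] /=; rewrite Ek !inE ?eqxx //.
  by move/eqP => [->].
have idxI E E' : (idx E == idx E') = (E == E').
  apply/eqP/eqP => [kk|-> //]; apply: val_inj.
  by rewrite [LHS]idxE kk -idxE.
have legB i k : leg i k \in B i.
  by rewrite -mem_enum mem_nth // -cardE; case: (hB i) => // _ _; apply: leq_trans.
have legF i k : leg i k \in F by case: (hB i (ltn_ord i)) => _ /subsetP/(_ _ (legB i k)).
have legI i k j l : (leg i k == leg j l) = (i == j) && (k == l).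
  have [<-|ij] /= := eqVneq i j.
    rewrite nth_uniq ?enum_uniq // -cardE; case: (hB i) => // _ _ h.
      exact: leq_trans (ltn_ord k) h.
    exact: leq_trans (ltn_ord l) h.
  apply: contraNF ij => /eqP kl; apply/eqP/val_inj/eqP; apply/negPn/negP => ij.
  have [//|//|_ dij] := hD i j _ _ ij; have := legB i k.
  by rewrite (disjointFl dij) // kl.
have nn z z' : z \in F -> z' \in F -> e (near z) (near z') = false.
  by move=> zF z'F; have [_ E1 E2] := cF z z' zF z'F; rewrite /near; case: (b).
have ff z z' : z \in F -> z' \in F -> e (far z) (far z') = false.
  by move=> zF z'F; have [_ E1 E2] := cF z z' zF z'F; rewrite /far; case: (b).
have nf z z' : z \in F -> z' \in F -> e (near z) (far z') = (z == z').
  move=> zF z'F; have [E1 _ _] := cF z z' zF z'F; have [E2 _ _] := cF z' z z'F zF.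
  by rewrite /near /far; case: (b); rewrite // es E2 eq_sym.
have fn z z' : z \in F -> z' \in F -> e (far z) (near z') = (z == z').
  by move=> zF z'F; rewrite es nf // eq_sym.
have cn (i j k : 'I_n) : e (c i) (near (leg j k)) = (i == j :> nat) .
  have := hM i j _ (ltn_ord i) (ltn_ord j) (legB j k); rewrite /diag /adjp /near.
  by case: eqP => _; case: (b) => /= -[E1 E2]; rewrite ?E1 ?E2.
have cf (i j k : 'I_n) : e (c i) (far (leg j k)) = false.
  have := hM i j _ (ltn_ord i) (ltn_ord j) (legB j k); rewrite /diag /adjp /far.
  by case: eqP => _; case: (b) => /= -[E1 E2]; rewrite ?E1 ?E2.
have nc (i j k : 'I_n) : e (near (leg j k)) (c i) = (i == j :> nat) by rewrite es cn.
have fc (i j k : 'I_n) : e (far (leg j k)) (c i) = false by rewrite es cf.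
pose f (u : copies n (T2 n)) := match u.2 with
  | inl None => c u.1
  | inl (Some k) => far (leg u.1 k)
  | inr E => near (leg u.1 (idx E))
  end.
have cends i : c (i : 'I_n) \notin ends F by case: (hB i (ltn_ord i)).
have nends z : z \in F -> near z \in ends F.
  by move=> zF; rewrite /near; case: (b); [apply: ends1|apply: ends2].
have fends z : z \in F -> far z \in ends F.
  by move=> zF; rewrite /far; case: (b); [apply: ends2|apply: ends1].
have nfne z z' : z \in F -> z' \in F -> near z != far z'.
  move=> zF z'F; apply/eqP => E; have := fn z' z' z'F z'F.
  by rewrite eqxx -E nn.
have nI z z' : z \in F -> z' \in F -> near z = near z' -> z = z'.
  by move=> zF z'F E; apply/eqP; rewrite -nf // E nf.
have fI z z' : z \in F -> z' \in F -> far z = far z' -> z = z'.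
  by move=> zF z'F E; apply/eqP; rewrite -nf // -E nf.
exists f.
  have cne i z : z \in ends F -> c (i : 'I_n) <> z by move=> zF E; case/negP: (cends i); rewrite E.
  move=> [i [[k|]|E]] [j [[l|]|E']]; rewrite /f /=.
  - by move/(fI _ _ (legF _ _) (legF _ _))/eqP; rewrite legI => /andP[/eqP-> /eqP->].
  - by move/esym/cne; case; apply: fends.
  - by move/esym/eqP; rewrite (negbTE (nfne _ _ _ _)).
  - by move/cne; case; apply: fends.
  - move=> cc; congr (_, _); apply/val_inj/eqP/negPn/negP => ij.
    by have [//|//|/eqP] := hD i j _ _ ij.
  - by move/cne; case; apply: nends.
  - by move/eqP; rewrite (negbTE (nfne _ _ _ _)).
  - by move/esym/cne; case; apply: nends.
  - move/(nI _ _ (legF _ _) (legF _ _))/eqP; rewrite legI idxI.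
    by move=> /andP[/eqP-> /eqP->].
move=> [i [[k|]|E]] [j [[l|]|E']]; rewrite /f /= /copies_rel /=.
- by rewrite ff // andbF.
- by rewrite fc andbF.
- by rewrite fn // legI idxE !inE /= (inj_eq Some_inj).
- by rewrite cf andbF.
- by rewrite ind // andbF.
- by rewrite cn idxE !inE eqxx andbT.
- by rewrite nf // legI idxE !inE /= (inj_eq Some_inj) 1?[l == _]eq_sym 1?[i == _]eq_sym.
- by rewrite nc idxE !inE eqxx andbT eq_sym.
- by rewrite nn // andbF.
Qed.

End Embedding.

(** Edges of [F] fall into at most [2 ^ m * 2 ^ m] classes by their adjacency to all hubs. The sum
    of two hubs meets so many edges that one of them lies in a class of at least [n] edges, so the
    large classes separate the hubs. [chain] then picks hubs and representatives, and their classes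
    are the blocks. *)
Lemma state_blocks N n : 0 < N -> 0 < n -> exists m w, forall (V : finType) (e : rel V) F (H : {set V}),
  is_graph e -> state e F H w -> #|H| = m -> exists c B p al r,
    p != al /\ blocks e F n N c B (tri p al r).
Proof.
move=> N0 n0; have [m mP] := @chain (bool * bool)%type N N0.
exists m, (n * (2 ^ m * 2 ^ m)).+1 => V e F H ge [cF HF wF] cH; have [es ei] := ge.
pose class z := [set z' in F | [forall h in H, adjp e h z' == adjp e h z]].
pose C := [set z in F | n <= #|class z|].
have sp : sep (adjp e) H C.
  move=> h h' hH h'H hh'.
  have sub : [set h; h'] \subset H by rewrite subUset !sub1set hH.
  have ne : [set h; h'] != set0 by apply/set0Pn; exists h; rewrite !inE eqxx.
  pose typ (z : V * V) := ([set u in H | e u z.1], [set u in H | e u z.2]).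
  have [||u _ nu] := @pigeonhole _ _ typ (touch e [set h; h'] F)
      (setX (powerset H) (powerset H)) n.
  - move=> z _; rewrite !inE /=.
    by apply/andP; split; apply/subsetP=> u; rewrite inE => /andP[].
  - by rewrite cardsX !card_powerset cH; apply: leq_trans (wF _ sub ne).
  have /card_gt0P[z] := leq_ltn_trans (leq0n _) nu.
  rewrite !inE => /andP[/andP[zF zt] /eqP zu].
  have ps v : psum e [set h; h'] v = e h v (+) e h' v.
    by rewrite psumU1 ?psum1 // inE.
  rewrite !ps in zt; exists z; last first.
    by rewrite /adjp xpair_eqE negb_and; move: zt; do 4!case: (e _ _).
  rewrite inE zF; apply: leq_trans (ltnW nu) _; apply/subset_leq_card/subsetP=> z'.
  rewrite !inE => /andP[/andP[z'F _] /eqP z'u]; rewrite z'F /=.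
  apply/forall_inP=> g gH; rewrite /adjp; have [t1 t2] : typ z' = typ z by rewrite zu.
  have := congr1 (fun S : {set V} => g \in S) t1.
  have := congr1 (fun S : {set V} => g \in S) t2.
  by rewrite !inE gH /= => -> ->.
have [p [al [r [s [t [pal [x [y [h1 h2]]]]]]]]] :=
  mP V _ (adjp e) (fun _ _ => false) (fun _ _ => false) H C sp (eq_leq (esym cH)).
have cl i j z : i < N -> j < N -> z \in class (y j) -> adjp e (x i) z = adjp e (x i) (y j).
  move=> iq jq; rewrite inE => /andP[_ /forall_inP h]; apply/eqP/h.
  by case: (h1 i iq).
have tp i j : i < N -> j < N -> adjp e (x i) (y j) = tri p al r i j.
  move=> iq jq; rewrite /tri; case: ltngtP => [ij|ji|->].
  - by case: (h2 i j ij jq).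
  - by case: (h2 j i ji iq).
  - by case: (h1 j jq).
exists x, (fun i => class (y i)), p, al, r; split=> //; split=> //.
- move=> i iq; have [xH yC _] := h1 i iq; split.
  + by rewrite (disjointFr HF).
  + by apply/subsetP=> z; rewrite inE => /andP[].
  + by move: yC; rewrite inE => /andP[].
- have lt i j : i < j -> j < N -> x i != x j /\ [disjoint class (y i) & class (y j)].
    move=> ij jq; have iq := ltn_trans ij jq; split.
      apply: contra_neq pal => xx; have := tp i i iq iq; have := tp j i jq iq.
      by rewrite xx /tri ltnn eqxx [j < i]ltnNge (ltnW ij) /= (gtn_eqF ij) => <- <-.
    rewrite disjoints_subset; apply/subsetP=> z zi; rewrite in_setC; apply: contra_neqN pal => zj.
    have := cl j i z jq iq zi; rewrite (cl j j z jq jq zj) !tp //.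
    by rewrite /tri ltnn eqxx [j < i]ltnNge (ltnW ij) /= (gtn_eqF ij).
  move=> i j iq jq ij; have [lij|lji|E] := ltngtP i j.
  + exact: lt.
  + by rewrite eq_sym disjoint_sym; apply: lt.
  + by rewrite E eqxx in ij.
- by move=> i j z iq jq zj; rewrite (cl i j) // tp.
Qed.

Lemma hub_extraction n : 0 < n -> exists m w, forall (V : finType) (e : rel V) F (H : {set V}),
  is_graph e -> state e F H w -> #|H| = m ->
  exists2 e', reach setT e e' & exists2 f : copies n (T2 n) -> V,
    injective f & {mono f : x y / x -- y >-> e' x y}.
Proof.
move=> n0.
suff [N NP] : exists N, forall (V : finType) (e : rel V) F c B p, is_graph e -> p != zerop ->
    blocks e F n N c B (diag p) ->
    exists2 e', reach setT e e' & exists2 f : copies n (T2 n) -> V,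
    injective f & {mono f : x y / x -- y >-> e' x y}.
  (* Clearing below the diagonal costs two indices, clearing above it two thirds of the rest. *)
  have [|m [w mw]] := @state_blocks (3 * N + 2) n _ n0; first by rewrite addn2.
  exists m, w => V e F H ge st cH.
  have [c [B [p [al [r [pal bl]]]]]] := mw V e F H ge st cH.
  have [e1 [F1 [c1 [B1 [p1 [r1 [re1 g1 p10 bl1]]]]]]] := blocks_kill_lower ge n0 pal bl.
  have [e2 [F2 [c2 [B2 [re2 g2 bl2]]]]] := blocks_diag g1 n0 bl1.
  have [e3 re3 h3] := NP V e2 F2 c2 B2 p1 g2 p10 bl2.
  by exists e3 => //; apply: reach_trans (reach_trans re1 re2) re3.
have [N NP] := blocks_indep n.
exists N => V e F c B p ge p0 bl.
have [e1 [F1 [c1 [B1 [re1 g1 bl1 ind1]]]]] := NP V e F n c B p ge bl.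
have done b : p = (b, ~~ b) -> exists2 e', reach setT e e' & exists2 f : copies n (T2 n) -> V,
    injective f & {mono f : x y / x -- y >-> e' x y}.
  move=> pb; rewrite pb in bl1; exists e1 => //.
  exact: blocks_embedding g1 bl1 ind1 n0.
case: p p0 bl bl1 done => [[] []] // _ _ bl1 done; last 2 first.
- exact: (done true).
- exact: (done false).
have [e2 [re2 g2 bl2 ind2]] := blocks_untwist g1 bl1 ind1.
exists e2; first exact: reach_trans re1 re2.
exact: (@blocks_embedding _ e2 F1 n c1 B1 true).
Qed.

(** * From partitions to decompositions of radius two *)


Lemma ucycle_nbrs (T : sgraph) (s : seq T) x : ucycle sedge s -> 2 < size s -> x \in s ->
  exists y z, [/\ y != z, y \in s, z \in s & x -- y /\ x -- z].
Proof.
case/andP=> cs us ss xs; have [i s' si] := rot_to xs.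
have mems : s =i x :: s' by move=> u; rewrite -si mem_rot.
have us' : uniq (x :: s') by rewrite -si rot_uniq.
have cs' : cycle sedge (x :: s') by rewrite -si rot_cycle.
have ss' : 2 < size (x :: s') by rewrite -si size_rot.
case: s' {si} mems us' cs' ss' => [|y [|z s']] // mems us' cs' _.
exists y, (last z s'); split.
- by case/and3P: us' => _ /memPn/(_ _ (mem_last z s')); rewrite eq_sym.
- by rewrite mems !inE eqxx orbT.
- by rewrite mems 2!inE mem_last !orbT.
- move: cs'; rewrite /= rcons_path => /and4P[-> _ _ lx]; split=> //.
  by rewrite sedge_sym.
Qed.

Lemma distance_path (T : sgraph) (x : T) (p : seq T) : path sedge x p -> size p < #|T| ->
  distance x (last x p) <= size p.
Proof.
move=> pp sp; rewrite /distance leqNgt; apply/negP => lt.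
have /= := before_find 0 lt; rewrite nth_iota // add0n => /negbT/negP[].
by apply/existsP; exists (in_tuple p); rewrite /= pp eqxx.
Qed.

Section TreeOfParts.
Variables (G : sgraph) (phi : G -> G).

Definition big_fiber (y : G) := 1 < #|phi @^-1: [set y]|.

(** Only parts with at least two vertices get an inner node: a node for an empty fibre would be a
    spurious leaf, and a singleton part hangs directly from the root. *)
Definition part_node := option (G + {y : G | big_fiber y}).

Definition part_rel : rel part_node := fun u w =>
  match u, w with
  | Some (inl v), Some (inr y) => phi v == val y
  | Some (inr y), Some (inl v) => phi v == val y
  | Some (inl v), None | None, Some (inl v) => ~~ big_fiber (phi v)
  | Some (inr _), None | None, Some (inr _) => true
  | _, _ => false
  end.

Fact part_sym : symmetric part_rel.
Proof. by move=> [[v|y]|] [[w|z]|]. Qed.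

Fact part_irrefl : irreflexive part_rel.
Proof. by move=> [[v|y]|]. Qed.

Definition part_tree := SGraph part_sym part_irrefl.

Definition leaf_node (v : G) : part_tree := Some (inl v).
Definition inner_node (y : {y : G | big_fiber y}) : part_tree := Some (inr y).
Definition root_node : part_tree := None.

Definition parent (v : G) : part_tree :=
  if insub (phi v) is Some y then inner_node y else root_node.

Lemma parentP v w : leaf_node v -- w = (w == parent v).
Proof.
rewrite /parent; case: insubP => [y by_ yE|nb].
  by case: w => [[w|z]|] //=; rewrite ?by_ // -yE; apply/eqP/eqP => [/val_inj->|[->]].
case: w => [[w|z]|] //=; rewrite ?nb //.
by apply: contraNF nb => /eqP ->; apply: valP.
Qed.

Lemma part_tree_is_tree : is_tree part_tree.
Proof.
split; first by apply/card_gt0P; exists root_node.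
  have cr (x : part_tree) : connect sedge x root_node.
    case: x => [[v|y]|]; [|exact: connect1|exact: connect0].
    have vp : leaf_node v -- parent v by rewrite parentP.
    apply: connect_trans (connect1 vp) _; rewrite /parent.
    by case: insubP => [y _ _|_]; [apply: connect1|apply: connect0].
  move=> x y; apply: connect_trans (cr x) _.
  by rewrite (sym_connect_sym (@sedge_sym part_tree)).
move=> s us; rewrite leqNgt; apply/negP => s3.
(* A vertex on a cycle has two distinct neighbours on it. This excludes the leaves, then the inner
   nodes, whose only other neighbour is the root, and finally the root. *)
have nbr := ucycle_nbrs us s3.
have nl v : leaf_node v \notin s.
  apply/negP=> /nbr[y [z [yz _ _ []]]]; rewrite !parentP => /eqP yE /eqP zE.
  by rewrite yE zE eqxx in yz.
have ni y : inner_node y \notin s.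
  apply/negP=> /nbr[u [w [uw us' ws []]]].
  case: u w uw us' ws => [[v|z]|] [[v'|z']|] // _ us' ws; first by case/negP: (nl v).
    by case/negP: (nl v).
  by case/negP: (nl v').
have nr : root_node \notin s.
  apply/negP=> /nbr[[[v|y]|] [w [uw us' ws []]]] //; first by case/negP: (nl v).
  by case/negP: (ni y).
have [u us'] : exists u, u \in s by case: s s3 {us nl ni nr nbr} => // u s; exists u; rewrite inE eqxx.
case: u us' => [[v|y]|] us'; first by case/negP: (nl v).
  by case/negP: (ni y).
by case/negP: nr.
Qed.

Lemma internal_root (v1 v2 : G) : phi v1 != phi v2 -> internal root_node.
Proof.
move=> v12; pose top v : part_tree := if insub (phi v) is Some y then inner_node y else leaf_node v.
have rt v : root_node -- top v by rewrite /top; case: insubP.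
apply/card_gt1P; exists (top v1), (top v2); rewrite !inE !rt; split=> //.
rewrite /top; case: insubP => [y _ yE|_]; case: insubP => [z _ zE|_] //.
  by apply: contraNneq v12 => -[yz]; rewrite -yE -zE yz.
by apply: contraNneq v12 => -[->].
Qed.

Lemma leaf_nodeP (v1 v2 : G) : phi v1 != phi v2 ->
  forall x : part_tree, leaf x <-> exists v, leaf_node v = x.
Proof.
move=> v12 x; have deg_leaf v : degree (leaf_node v) = 1.
  rewrite /degree -(cards1 (parent v)); apply: eq_card => w.
  by rewrite !inE parentP.
split=> [|[v <-]]; last by rewrite /leaf deg_leaf.
case: x => [[v|y]|] lx; first by exists v.
  have /card_gt1P[v [_ [vy _ _]]] := valP y; rewrite !inE in vy.
  have : 1 < degree (inner_node y).
    by apply/card_gt1P; exists root_node, (leaf_node v); rewrite !inE /=.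
  by rewrite (eqP lx).
by have := internal_root v12; rewrite /internal (eqP lx).
Qed.

Lemma radius_part_tree (v1 v2 : G) : v1 != v2 -> radius part_tree <= 2.
Proof.
move=> v12; apply: leq_trans (radius_le root_node) _; apply/bigmax_leqP => x _.
have T3 : 2 < #|part_tree|.
  rewrite card_option card_sum !ltnS; apply: leq_trans (leq_addr _ _).
  by apply/card_gt1P; exists v1, v2.
suff [p [pp <- sp]] : exists p, [/\ path sedge root_node p, last root_node p = x & size p <= 2].
  exact: leq_trans (distance_path pp (leq_ltn_trans sp T3)) sp.
case: x => [[v|y]|]; [|by exists [:: inner_node y]|by exists [::]].
have := parentP v (parent v); rewrite eqxx sedge_sym /parent.
case: insubP => [y _ _|_] /= E.
  by exists [:: inner_node y; leaf_node v]; rewrite /= E.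
by exists [:: leaf_node v]; rewrite /= E.
Qed.

Variable K : nat.
Hypothesis unionK : forall I : {set G}, crk (@sedge G) (phi @^-1: I) <= K.
Hypothesis fiberK : forall (X : {set G}) y, X \subset phi @^-1: [set y] -> crk (@sedge G) X <= K.

Lemma parts_decomposition : 1 < #|G| -> has_decomposition G K 2.
Proof.
move=> G1; case: (pickP (fun p : G * G => phi p.1 != phi p.2)) => [[v1 v2] /= v12|const].
  have v12' : v1 != v2 by apply: contraNneq v12 => ->.
  have int : exists t : part_tree, internal t.
    by exists root_node; apply: internal_root v12.
  have leafI : injective leaf_node by move=> v w [].
  pose D := Decomposition part_tree_is_tree int leafI (leaf_nodeP v12).
  exists D; split; last exact: radius_part_tree v12'.
  apply/bigmax_leqP => t tint; apply/bigmax_leqP => I IP.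
  pose R := [rel x y : part_tree | [&& x -- y, x != t & y != t]].
  have Rs : connect_sym R.
    by apply: sym_connect_sym => x y /=; rewrite part_sym; congr (_ && _); apply: andbC.
  have sat v w : connect R (leaf_node v) (leaf_node w) -> leaf_node w != t ->
      v \in cover I -> w \in cover I.
    move=> vw wt /bigcupP[S SI vS]; apply/bigcupP; exists S => //.
    have /imsetP[A /imsetP[x xt AE] SE] := subsetP IP S SI.
    move: vS; rewrite SE AE !inE => /andP[_ xv]; rewrite wt /=.
    exact: connect_trans xv vw.
  have nl v : leaf_node v != t.
    apply: contraTneq tint => <-; have : leaf (leaf_node v) by apply/leaf_nodeP; [exact: v12|exists v].
    by rewrite /leaf /internal => /eqP->.
  have step v y : phi v = val y -> inner_node y != t -> connect R (leaf_node v) (inner_node y).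
    by move=> vy yt; apply: connect1; rewrite /= vy eqxx nl.
  have top v : parent v != t -> connect R (leaf_node v) (parent v).
    by move=> vt; apply/connect1/and3P; split; rewrite ?nl // parentP.
  case: t tint @R Rs sat nl step top IP => [[v|y]|] tint R Rs sat nl step top IP.
  - by have := nl v; rewrite eqxx.
  (* All leaves outside the fibre of [y] lie in one component, that of the root. So either a union
     of blocks or its complement is contained in the fibre. *)
  - case: (boolP [exists v in cover I, phi v != val y]) => [/exists_inP[v vI vy]|none].
      apply: leq_trans (cut_rank_le _) _; rewrite -(crk_setC _ (@sedge_sym G)).
      apply: (fiberK (y := val y)); apply/subsetP=> w; rewrite !inE; apply: contraR => wy.
      have rtop u : phi u != val y -> connect R (leaf_node u) root_node.
        move=> uy; apply: connect_trans (top u _) _.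
          rewrite /parent; case: insubP => [z _ zE|_] //.
          by apply: contraNneq uy => -[<-]; rewrite zE.
        rewrite /parent; case: insubP => [z _ zE|_]; last exact: connect0.
        apply: connect1; rewrite /= andbT.
        by apply: contraNneq uy => -[<-]; rewrite zE.
      apply: sat vI => //; apply: connect_trans (rtop v vy) _.
      by rewrite Rs; apply: rtop.
    apply: leq_trans (cut_rank_le _) _; apply: (fiberK (y := val y)).
    apply/subsetP=> v vI; rewrite !inE; apply: contraR none => vy.
    by apply/exists_inP; exists v.
  - apply: leq_trans (cut_rank_le _) _.
    suff -> : cover I = phi @^-1: (phi @: cover I) by apply: unionK.
    apply/setP=> w; rewrite inE; apply/idP/imsetP => [wI|[v vI wv]]; first by exists w.
    have [-> //|wv'] := eqVneq w v.
    have by_ : big_fiber (phi w).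
      by apply/card_gt1P; exists w, v; rewrite !inE -wv eqxx.
    apply: sat vI => //; apply: (@connect_trans _ _ (inner_node (Sub (phi w) by_))).
      by apply: step; rewrite //= SubK.
    by rewrite Rs; apply: step; rewrite //= SubK.
(* With a single part the root would have degree one, so the star serves instead; every vertex set
   is then a subset of the one fibre. *)
have allK (X : {set G}) : cut_rank X <= K.
  apply: leq_trans (cut_rank_le _) _; have /card_gt0P[v _] : 0 < #|G| by apply: ltnW.
  apply: (fiberK (y := phi v)); apply/subsetP=> w _; rewrite !inE.
  by have := const (w, v); case: eqP.
have [k [D [_ rD]]] := @has_decomposition_star G 2 isT G1.
exists D; split=> //; apply/bigmax_leqP => t _; apply/bigmax_leqP => I _; exact: allK.
Qed.

End TreeOfParts.

Lemma rank_brittleness_le (G : sgraph) K d :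
  (1 < #|G| -> has_decomposition G K d) -> rank_brittleness d G <= K.
Proof.
move=> dec; rewrite /rank_brittleness; case: ltnP => // G1.
case: pselect => // ex; case: ex_minnP => m _; apply.
by apply/asboolP; apply: dec.
Qed.

Lemma rank_brittleness_decomposition (G : sgraph) k d : 0 < d -> 1 < #|G| ->
  rank_brittleness d G <= k -> has_decomposition G k d.
Proof.
move=> d0 G1; rewrite /rank_brittleness ltnNge G1 /=.
case: pselect => [ex|nex].
  by case: ex_minnP => m /asboolP[D [wD rD]] _ mk; exists D; split=> //; apply: leq_trans mk.
by case: nex; have [m dec] := has_decomposition_star d0 G1; exists m; apply/asboolP.
Qed.

(** * From decompositions of radius two to partitions *)


(* Averaging over all sets [I]: an ordered pair of distinct elements is split
   by a quarter of them. *)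
Lemma quarter_cut (T J : finType) (a b : J -> T) : (forall j, a j != b j) ->
  exists I : {set T}, #|J| <= 4 * #|[set j | (a j \in I) && (b j \notin I)]|.
Proof.
move=> ab; pose N j := [set I : {set T} | (a j \in I) && (b j \notin I)].
have N4 j : #|{set T}| <= #|N j| * 4.
  pose g (I : {set T}) := ((a j |: I) :\ b j, (a j \in I, b j \in I)).
  have gI : injective g.
    move=> I I' [E Ea Eb]; apply/setP=> x.
    have [->|xa] := eqVneq x (a j); first by [].
    have [->|xb] := eqVneq x (b j); first by [].
    by have := congr1 (fun S : {set T} => x \in S) E; rewrite !inE xb (negbTE xa).
  rewrite -cardsT -(card_imset setT gI).
  have -> : #|N j| * 4 = #|setX (N j) [set: bool * bool]|.
    by rewrite cardsX cardsT card_prod card_bool.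
  apply/subset_leq_card/subsetP=> _ /imsetP[I _ ->].
  by rewrite !inE /= eqxx ab eqxx.
case: (pickP (fun I : {set T} => #|J| <= 4 * #|[set j | (a j \in I) && (b j \notin I)]|)).
  by move=> I; exists I.
move=> small; suff : \sum_(I : {set T}) #|J| < \sum_(I : {set T}) #|J| by rewrite ltnn.
have lt (I : {set T}) : 4 * #|[set j | (a j \in I) && (b j \notin I)]| < #|J|.
  by rewrite ltnNge small.
apply: leq_trans (_ : (\sum_(I : {set T}) 4 * #|[set j | (a j \in I) && (b j \notin I)]|).+1 <= _).
  rewrite ltnS -big_distrr /= [leqRHS](_ : _ = 4 * \sum_(j : J) #|N j|).
    rewrite sum_nat_const mulnC big_distrr /= -sum_nat_const; apply: leq_sum => j _.
    by rewrite mulnC.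
  congr (4 * _); under eq_bigr do rewrite -sum1_card big_mkcond.
  rewrite exchange_big /=; apply: eq_bigr => j _; rewrite -sum1_card [RHS]big_mkcond.
  by apply: eq_bigr => I _; rewrite !inE.
rewrite (bigD1 set0) //= [X in _ < X](bigD1 set0) //= -addSn; apply: leq_add => //.
by apply: leq_sum => I _; apply: ltnW.
Qed.

Section Chunks.
Variables (G : sgraph) (T : finType) (phi : G -> T) (k q : nat) (Y Z : 'I_q -> {set G}).
Hypothesis unionK : forall I : {set T}, cut_rank (phi @^-1: I) <= k.
Hypothesis fiberK : forall X : {set G}, {in X &, forall x y, phi x = phi y} -> cut_rank X <= k.
Hypothesis Yconn : forall i, conn (@sedge G) (Y i).
Hypothesis Yfar : forall i j, i != j -> {in Y i & Y j, forall x y, ~~ (x -- y)}.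
Hypothesis ZY : forall i, Z i \subset Y i.
Hypothesis Zk : forall i, k < cut_rank (Z i).

Lemma chunks_bound : q <= 4 * k.
Proof.
have /choice [p pP] (i : 'I_q) : exists p : G * G,
    [/\ p.1 \in Y i, p.2 \in Y i, p.1 -- p.2 & phi p.1 != phi p.2].
  case: (pickP (fun p : G * G => [&& p.1 \in Y i, p.2 \in Y i, p.1 -- p.2 & phi p.1 != phi p.2])).
    by move=> p /and4P[? ? ? ?]; exists p.
  move=> none; have := Zk i; rewrite ltnNge => /negP[]; apply: fiberK => x y xZ yZ.
  have /connP/(_ x y) := Yconn i; rewrite !(subsetP (ZY i)) // => /(_ isT isT).
  case/connectP=> s ps ->; elim: s x ps {xZ} => //= u s IH x /andP[/and3P[xY uY xu] pu].
  rewrite -(IH u pu); apply/eqP; have := none (x, u); rewrite /= xY uY xu /=.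
  by move/negbT; rewrite negbK.
have [|I qI] := @quarter_cut _ _ (fun i => phi (p i).1) (fun i => phi (p i).2).
  by move=> i; case: (pP i).
rewrite card_ord in qI; apply: leq_trans qI _; rewrite leq_mul2l /=.
set J := [set j | _]; apply: leq_trans (unionK I).
apply: (@cut_rank_matching _ _ _ (fun j => (p (enum_val (A := J) j)).1)
          (fun j => (p (enum_val (A := J) j)).2)).
- by move=> j; have := enum_valP j; rewrite !inE => /andP[].
- by move=> j; have := enum_valP j; rewrite !inE => /andP[].
- move=> i j; have [->|ij] := eqVneq i j; first by case: (pP (enum_val j)).
  have ij' : enum_val i != enum_val j by apply: contra_neq ij; apply: enum_val_inj.
  apply/negbTE; have [p1 _ _ _] := pP (enum_val i); have [_ p2 _ _] := pP (enum_val j).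
  exact: Yfar ij' _ _ p1 p2.
Qed.

End Chunks.

(** The bound [r < #|T|] rules out the default value of the minimum. *)
Lemma radius_centre (T : sgraph) r : r < #|T| -> radius T <= r -> exists x : T, eccentricity x <= r.
Proof.
move=> rT; case: (pickP (fun x : T => eccentricity x <= r)) => [x xr _|none].
  by exists x.
rewrite leqNgt /radius => /negP[].
elim/big_ind: _ => // [m m' h h'|x _]; first by rewrite leq_min h h'.
by rewrite ltnNge none.
Qed.

Lemma distance_witness (T : sgraph) (x y : T) r : distance x y <= r -> r < #|T| ->
  exists p, [/\ path sedge x p, last x p = y & size p <= r].
Proof.
move=> dr rT; have hs : has (fun n => [exists p : n.-tuple T, path sedge x p && (last x p == y)])
    (iota 0 #|T|).
  by rewrite has_find size_iota; apply: leq_ltn_trans dr rT.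
have := nth_find 0 hs; rewrite -/(distance x y) nth_iota ?add0n; last first.
  exact: leq_ltn_trans dr rT.
case/existsP=> p /andP[pp /eqP lp]; exists p; split=> //.
by rewrite size_tuple.
Qed.

(** A path avoiding [x] between two distinct neighbours of [x] would close a cycle. *)
Lemma tree_unique_nbr (T : sgraph) (x z z' : T) : is_tree T -> x -- z -> x -- z' ->
  connect [rel u w : T | [&& u -- w, u != x & w != x]] z z' -> z = z'.
Proof.
move=> [_ _ acyc] xz xz' /connectP[p pp z'E].
case/shortenP: pp z'E => p' pp' up _ z'E; case: p' pp' up z'E => [|y p'] // pp' up z'E.
have nx w : w \in y :: p' -> w != x.
  have avoid (s : seq T) z0 : path [rel u w | [&& u -- w, u != x & w != x]] z0 s ->
      w \in s -> w != x.
    elim: s z0 => //= u s IH z0 /andP[/and3P[_ _ ux] us].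
    by rewrite inE => /predU1P[->|]; last exact: IH us.
  exact: avoid pp'.
have zx : z != x by apply: contraTneq xz => ->; rewrite sedge_irrefl.
have uc : ucycle sedge (x :: z :: y :: p').
  apply/andP; split; last first.
    rewrite /= inE negb_or eq_sym zx /=; apply/andP; split; last exact: up.
    by apply/negP => /nx; rewrite eqxx.
  have lx : last y p' -- x by rewrite [last y p'](esym z'E) sedge_sym.
  rewrite /= rcons_path xz lx andbT.
  by apply: (sub_path _ pp') => u w /and3P[].
by have := acyc _ uc.
Qed.

Section Fibers.
Variables (G : sgraph) (D : decomposition G) (k : nat).
Hypothesis wD : width D <= k.
Hypothesis rD : radius (dtree D) <= 2.
Local Notation T := (dtree D).

Lemma node_cut (t : T) (I : {set {set G}}) : internal t -> I \subset node_partition t ->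
  cut_rank (cover I) <= k.
Proof.
move=> tint It; apply: leq_trans wD; apply: leq_trans (leq_bigmax_cond _ tint).
exact: (leq_bigmax_cond (F := fun I => cut_rank (cover I)) _ It).
Qed.

Lemma card_dtree : 2 < #|T|.
Proof.
have [t /card_gt1P[x [y [xt yt xy]]]] := dtree_internal D.
rewrite !inE in xt yt.
have ne u : t -- u -> u != t by apply: contraTneq => ->; rewrite sedge_irrefl.
rewrite -cardsT (cardsD1 t) (cardsD1 x) (cardsD1 y) !inE.
by rewrite (ne x) // (ne y) // eq_sym xy.
Qed.

(** If the centre found is not internal, it has a unique neighbour; everything within distance two
    then hangs on that neighbour, which serves as a centre. *)
Lemma internal_centre : exists2 x : T, internal x &
  forall y, [\/ y = x, x -- y | exists2 z, x -- z & z -- y].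
Proof.
have [x xe] := radius_centre card_dtree rD.
have near y : [\/ y = x, x -- y | exists2 z, x -- z & z -- y].
  have dxy : distance x y <= 2 by apply: leq_trans xe; apply: leq_bigmax.
  have [[|u [|w [|? ?]]] //= [pp lp sz]] := distance_witness dxy card_dtree.
  - exact: Or31.
  - by move: pp => /andP[xu _]; apply: Or32; rewrite -lp.
  - by move: pp => /and3P[xu uw _]; apply: Or33; exists u; rewrite -?lp.
  - by [].
have [xint|xn] := boolP (internal x); first by exists x.
have uniq_nbr y z : x -- y -> x -- z -> y = z.
  move=> xy xz; apply/eqP; apply: contraNT xn => yz.
  by apply/card_gt1P; exists y, z; rewrite !inE.
have [w wx] : exists w : T, w != x.
  have /card_gt0P[w] : 0 < #|[set: T] :\ x|.
    by have := card_dtree; rewrite -cardsT (cardsD1 x) inE => /ltnW; rewrite ltnS.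
  by rewrite !inE andbT; exists w.
have [y xy] : exists y, x -- y.
  by case: (near w) => [E|xw|[z xz _]]; [rewrite E eqxx in wx|exists w|exists z].
have nbr u : u != y -> y -- u.
  move=> uy; case: (near u) => [->|xu|[z xz zu]]; first by rewrite sedge_sym.
    by rewrite (uniq_nbr _ _ xy xu) eqxx in uy.
  by rewrite (uniq_nbr _ _ xy xz).
have [v vP] : exists v : T, (v != x) && (v != y).
  have /card_gt0P[v] : 0 < #|[set: T] :\ x :\ y|.
    have := card_dtree; rewrite -cardsT (cardsD1 x) (cardsD1 y) !inE eq_sym.
    by case: (y == x); lia.
  by rewrite !inE andbT andbC; exists v.
case/andP: vP => vx vy; exists y; last first.
  by move=> u; have [->|/nbr yu] := eqVneq u y; [apply: Or31|apply: Or32].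
have yx : x != y by apply: contraTneq xy => ->; rewrite sedge_irrefl.
apply/card_gt1P; exists x, v; rewrite !inE (nbr x) // (nbr v) //; split=> //.
by rewrite eq_sym.
Qed.

(** The parts come from the components of the tree minus a centre [x]. A part with a leaf next to
    [x] is a singleton of cut-rank at most one, whence [k.+1]. In any other part all leaves are
    adjacent to one neighbour [z] of [x], and each is a block at [z]. *)
Lemma decomposition_fibers : exists phi : G -> {set T},
  (forall I : {set {set T}}, cut_rank (phi @^-1: I) <= k.+1) /\
  (forall X : {set G}, {in X &, forall x y, phi x = phi y} -> cut_rank X <= k.+1).
Proof.
have [x xint near] := internal_centre.
pose R t : rel T := [rel u w | [&& u -- w, u != t & w != t]].
have Rs t : connect_sym (R t).
  apply: sym_connect_sym => u w; rewrite /R /= (@sedge_sym T).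
  by congr (_ && _); apply: andbC.
have lf v : leaf (dmap D v) by apply/dmap_leaves; exists v.
have nint v t : internal t -> dmap D v != t.
  by apply: contraTneq => <-; have := lf v; rewrite /leaf /internal => /eqP->.
have only v y z : dmap D v -- y -> dmap D v -- z -> y = z.
  move=> vy vz; apply/eqP; have := lf v; apply: contraTT => yz.
  rewrite /leaf neq_ltn; apply/orP; right.
  by apply/card_gt1P; exists y, z; rewrite !inE.
have stuck v t u : dmap D v -- t -> connect (R t) (dmap D v) u -> u = dmap D v.
  move=> vt /connectP[[|w p] //= /andP[/and3P[vw _ wt] _] _].
  by rewrite (only v w t vw vt) eqxx in wt.
pose cls t v := [set u in [set~ t] | connect (R t) (dmap D v) u].
have clsP t v : dmap D v != t -> cls t v \in components_minus t.
  by move=> vt; apply/imsetP; exists (dmap D v); rewrite ?inE.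
exists (cls x); split=> [I|X Xc].
  apply: leqW.
  pose P := [set dmap D @^-1: A | A : {set T} in I :&: components_minus x].
  suff -> : cls x @^-1: I = cover P.
    apply: node_cut xint _; apply/subsetP=> _ /imsetP[A /setIP[_ Ax] ->].
    exact: imset_f.
  apply/setP=> v; rewrite inE; apply/idP/bigcupP => [vI|[_ /imsetP[A /setIP[AI Ax] ->]]].
    exists (dmap D @^-1: cls x v); last by rewrite !inE connect0 nint.
    by apply/imsetP; exists (cls x v) => //; rewrite inE vI clsP ?nint.
  case/imsetP: Ax AI => u ux -> AI; rewrite !inE => /andP[vx uv].
  rewrite (_ : cls x v = [set y in [set~ x] | connect (R x) u y]) //.
  by apply/setP=> w; rewrite !inE (same_connect (Rs x) uv).
have [->|[v vX]] := set_0Vmem X.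
  by apply: leq_trans (cut_rank_leq_card _) _; rewrite cards0.
have same w : w \in X -> connect (R x) (dmap D v) (dmap D w).
  move=> wX; have := Xc v w vX wX => /setP/(_ (dmap D w)).
  by rewrite !inE connect0 nint //= => ->.
have [xv|nxv] := boolP (x -- dmap D v).
  have XE : X \subset [set v].
    apply/subsetP=> w /same /(stuck v x) E; rewrite inE; apply/eqP/(@dmap_inj _ D)/E.
    by rewrite sedge_sym.
  apply: leq_trans (cut_rank_leq_card _) _.
  by apply: leq_trans (subset_leq_card XE) _; rewrite cards1.
have [z xz zv] : exists2 z, x -- z & z -- dmap D v.
  case: (near (dmap D v)) => // [E|xv]; last by rewrite xv in nxv.
  by have := nint v x xint; rewrite E eqxx.
have nbrx z' : x -- z' -> z' != x by apply: contraTneq => ->; rewrite sedge_irrefl.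
have zX w : w \in X -> z -- dmap D w.
  move=> wX; case: (near (dmap D w)) => [E|xw|[z' xz' z'w]].
  - by have := nint w x xint; rewrite E eqxx.
  - have wv := same w wX; rewrite Rs in wv.
    by rewrite -(stuck w x (dmap D v) _ wv) // sedge_sym.
  - suff -> : z = z' by [].
    apply: (tree_unique_nbr (dtree_is_tree D) xz xz').
    have step u y : x -- y -> y -- dmap D u -> connect (R x) y (dmap D u).
      by move=> xy yu; apply/connect1/and3P; rewrite yu nbrx // nint.
    apply: connect_trans (step v z xz zv) _; apply: connect_trans (same w wX) _.
    by rewrite [connect _ _ _](Rs x); apply: step.
have zint : internal z.
  apply/card_gt1P; exists x, (dmap D v); rewrite !inE sedge_sym xz zv; split=> //.
  by rewrite eq_sym nint.
apply: leqW.
pose P := [set dmap D @^-1: cls z w | w in X].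
have clsz w : w \in X -> dmap D @^-1: cls z w = [set w].
  move=> wX; apply/setP=> u; rewrite !inE nint //=; apply/idP/eqP => [c|->]; last exact: connect0.
  by apply: (@dmap_inj _ D); apply: stuck c; rewrite sedge_sym zX.
suff -> : X = cover P.
  apply: (node_cut zint); apply/subsetP=> _ /imsetP[w wX ->].
  by apply: imset_f; apply: clsP; apply: nint.
apply/setP=> w; apply/idP/bigcupP => [wX|[_ /imsetP[u uX ->]]].
  by exists (dmap D @^-1: cls z w); [apply: imset_f|rewrite clsz // inE].
by rewrite clsz // inE => /eqP->.
Qed.

End Fibers.

(** * The characterization *)


Lemma chunked_brittleness (G : sgraph) k q (Y Z : 'I_q -> {set G}) :
  (forall i, conn (@sedge G) (Y i)) ->
  (forall i j, i != j -> {in Y i & Y j, forall x y, ~~ (x -- y)}) ->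
  (forall i, Z i \subset Y i) -> (forall i, k.+1 < cut_rank (Z i)) -> 4 * k.+1 < q ->
  k < rank_brittleness 2 G.
Proof.
move=> Yc Yf ZY Zk kq; rewrite ltnNge; apply/negP => rb.
have G1 : 1 < #|G|.
  have := Zk (Ordinal (leq_ltn_trans (leq0n _) kq)) => /leq_trans/(_ (cut_rank_leq_card _)).
  by move/leq_trans/(_ (max_card _)); apply: leq_ltn_trans.
have [D [wD rD]] := rank_brittleness_decomposition (isT : 0 < 2) G1 rb.
have [phi [h1 h2]] := decomposition_fibers wD rD.
have := chunks_bound h1 h2 Yc Yf ZY Zk.
by rewrite leqNgt kq.
Qed.

Lemma path_brittleness k : exists2 n, 1 <= n & k < rank_brittleness 2 (path_graph n).
Proof.
(* Chunks are intervals of [L] vertices with one vertex between consecutive chunks. Within a chunk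
   the positions [3 * t] and [3 * t + 1] form an induced matching of size [k.+2], because matching
   edges have a gap of one vertex. *)
pose q := (4 * k.+1).+1; pose L := 3 * k.+2; pose N := q * L.+1.
exists N.+1 => //.
have bound (i : 'I_q) : i * L.+1 + L.+1 <= N.
  by rewrite -mulSnr leq_mul2r ltn_ord orbT.
have gap (i j : 'I_q) : i < j -> i * L.+1 + L.+1 <= j * L.+1.
  by move=> ij; rewrite -mulSnr leq_mul2r ij orbT.
have inK m (i : 'I_q) : m < L.+1 -> (inord (i * L.+1 + m) : 'I_N.+1) = i * L.+1 + m :> nat.
  move=> mL; rewrite inordK // ltnS; apply: leq_trans (bound i).
  by rewrite leq_add2l ltnW.
pose Y (i : 'I_q) := [set v : path_graph N.+1 | i * L.+1 <= v < i * L.+1 + L].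
pose Z (i : 'I_q) := [set (inord (i * L.+1 + (3 * (t : 'I_k.+2)).+1) : path_graph N.+1) | t : 'I_k.+2].
have tL (t : 'I_k.+2) : (3 * t).+1 < L by rewrite /L; have := ltn_ord t; lia.
apply: (@chunked_brittleness _ k q Y Z) => //.
- move=> i; apply: (@conn_root _ _ _ (inord (i * L.+1 + 0))); first exact: (@path_graph_sym N.+1).
  move=> v; rewrite inE => /andP[iv vi].
  rewrite -[v](inord_val v) -(subnKC iv).
  have : v - i * L.+1 < L by rewrite ltn_subLR.
  elim: (v - i * L.+1) => [|m IH] mL; first exact: connect0.
  apply: connect_trans (IH (ltnW mL)) _; apply: connect1.
  have m1 : m.+1 < L.+1 by apply: leqW.
  rewrite /restr !inE !inK ?(ltnW m1) // !leq_addr !ltn_add2l mL (ltnW mL) /=.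
  by rewrite /path_graph_rel /= !inK ?(ltnW m1) // addnS eqxx.
- move=> i j ij x y; rewrite !inE /= /path_graph_rel /= => /andP[ix xi] /andP[jy yj].
  have [lt|lt|/val_inj/eqP] := ltngtP i j; last by rewrite (negbTE ij).
    by move: (gap i j lt) ix xi jy yj; clear; lia.
  by move: (gap j i lt) ix xi jy yj; clear; lia.
- move=> i; apply/subsetP=> _ /imsetP[t _ ->].
  by rewrite inE (inK _ i) ?leq_addr ?ltn_add2l ?tL //; apply/leqW/tL.
move=> i; pose r (t : 'I_k.+2) : path_graph N.+1 := inord (i * L.+1 + 3 * t).
have tL1 (t : 'I_k.+2) : (3 * t).+1 < L.+1 by apply/leqW/tL.
apply: (@cut_rank_matching (path_graph N.+1) (Z i) k.+2
  (fun t => inord (i * L.+1 + (3 * t).+1) : 'I_N.+1) r).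
- by move=> t; apply: imset_f.
- move=> t; apply/imsetP=> -[s _ /(congr1 val)]; rewrite /= !inK ?(ltnW (tL1 _)) ?tL1 //.
  by move/eqP; rewrite eqn_add2l; lia.
- move=> s t; rewrite /= /path_graph_rel /= !inK ?(ltnW (tL1 _)) ?tL1 //.
  rewrite -!addnS !eqn_add2l -(inj_eq val_inj) /=.
  by move: (nat_of_ord s) (nat_of_ord t) => {}s {}t; clear; lia.
Qed.

Fact leg_edge_subproof n (k : 'I_n) : [set None; Some k] \in edges (star 'I_n).
Proof.
by rewrite inE; apply/existsP; exists None; apply/existsP; exists (Some k); rewrite /= eqxx.
Qed.

Definition leg_edge n (k : 'I_n) : {A : {set star 'I_n} | A \in edges (star 'I_n)} :=
  exist (fun A : {set star 'I_n} => A \in edges (star 'I_n)) _ (leg_edge_subproof k).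

Lemma T2_root_connect n (i : 'I_n) (x : copies n (T2 n)) : x.1 = i ->
  connect (restr (@sedge (copies n (T2 n))) [set u | u.1 == i]) (i, inl None) x.
Proof.
case: x => j u /= ->.
pose c : copies n (T2 n) := (i, inl None); pose S := [set u : copies n (T2 n) | u.1 == i].
have cE E : connect (restr sedge S) c (i, inr E).
  apply: connect1; rewrite /restr !inE /= /copies_rel /= !eqxx /=.
  by have [k ->] := star_edge (valP E); rewrite !inE eqxx.
case: u => [[k|]|E]; [|exact: connect0|exact: cE].
apply: connect_trans (cE (leg_edge k)) _; apply: connect1.
by rewrite /restr !inE /= /copies_rel /= !eqxx /= !inE eqxx orbT.
Qed.

Lemma copies_brittleness k : exists2 n, 1 <= n & k < rank_brittleness 2 (copies n (T2 n)).
Proof.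
(* The copies themselves are the chunks, and the edges between leaves and subdivision vertices form
   the induced matching. *)
pose n := (4 * k.+1).+1; exists n => //.
pose Y (i : 'I_n) := [set u : copies n (T2 n) | u.1 == i].
pose Z (i : 'I_n) := [set ((i, inl (Some l)) : copies n (T2 n)) | l : 'I_n].
apply: (@chunked_brittleness _ k n Y Z) => //.
- move=> i; apply: (@conn_root _ _ _ ((i, inl None) : copies n (T2 n))); first exact: sedge_sym.
  by move=> x; rewrite inE => /eqP; apply: T2_root_connect.
- move=> i j ij x y; rewrite !inE => /eqP xi /eqP yj.
  by rewrite /= /copies_rel /= xi yj (negbTE ij).
- by move=> i; apply/subsetP=> _ /imsetP[l _ ->]; rewrite inE.
move=> i; have kn : k.+2 <= n by rewrite /n; lia.
apply: leq_trans kn _.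
apply: (@cut_rank_matching (copies n (T2 n)) (Z i) n (fun l => (i, inl (Some l)))
          (fun l => (i, inr (leg_edge l)) : copies n (T2 n))).
- by move=> l; apply: imset_f.
- by move=> l; apply/imsetP=> -[].
- by move=> s t; rewrite /= /copies_rel /= eqxx /= !inE /= (inj_eq Some_inj).
Qed.

Theorem theorem1p3 (C : sgraph -> Prop) (HC : vertex_minor_ideal C) :
  (exists k : nat, forall G : sgraph, C G -> rank_brittleness 2 G <= k) <->
  (~ (forall n : nat, 1 <= n -> C (path_graph n))) /\
  (~ (forall n : nat, 1 <= n -> C (copies n (T2 n)))).
Proof.
split=> [[k Ck]|[/existsNP[n0 /not_implyP[n00 nP]] /existsNP[n1 /not_implyP[n10 nT]]]].
  split=> all; [have [n n1] := path_brittleness k|have [n n1] := copies_brittleness k];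
  by rewrite ltnNge Ck //; apply: all.
(* The missing graphs fix all constants: [n1] gives the number of hubs and the threshold, and
   together with [n0] these determine the bound [K]. *)
have [m [w hubs]] := hub_extraction n10.
have [K steps] := iterated_step n0 m w.
exists K => G CG; apply: rank_brittleness_le => G1.
have gG : is_graph (@sedge G) by split; [apply: sedge_sym|apply: sedge_irrefl].
have [e re [[u [uI _ uE]]|[phi [h1 h2]]|[F [H [st cH]]]]] := steps G _ gG.
- by case: nP; apply: (@ideal_pattern C G (path_graph n0) setT e u HC CG re uI) => i j; rewrite uE.
- apply: (parts_decomposition (phi := phi)) => // [I|X y Xy].
    by rewrite -(crk_reach _ gG re).
  by rewrite -(crk_reach _ gG re); apply: h2 Xy.
have [e' re' [f fI fE]] := hubs G e F H (reach_graph gG re) st cH.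
by case: nT; apply: (ideal_pattern HC CG (reach_trans re re') fI fE).
Qed.
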